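(* Let $m\in\mathbb{N}$, let $p\in(1,\infty)$, and let $E\subset\mathbb{R}$ be a closed set. A function $f:E\to\mathbb{R}$ belongs to the trace space $W^m_p(\mathbb{R})|_E$ if and only if the function $f^{\#}_{k,E}$ belongs to $L_p(\mathbb{R})$ for every $k=0,\dots,m$. Furthermore, $$\|f\|_{W^m_p(\mathbb{R})|_E}\sim\sum_{k=0}^m\|f^{\#}_{k,E}\|_{L_p(\mathbb{R})}$$ with constants in this equivalence depending only on $m$ and $p$; i.e., each side is bounded by a constant depending only on $m$ and $p$ times the other.
   Context: Sobolev spaces. $L^m_p(\mathbb{R})$ is the space of all functions $F:\mathbb{R}\to\mathbb{R}$ such that $F^{(m-1)}$ is absolutely continuous on $\mathbb{R}$ and the weak derivative $F^{(m)}$ belongs to $L_p(\mathbb{R})$. $W^m_p(\mathbb{R})$ is the space of all $F\in L^m_p(\mathbb{R})$ whose derivatives of all orders $0,\dots,m$ belong to $L_p(\mathbb{R})$, normed by $\|F\|_{W^m_p(\mathbb{R})}=\sum_{k=0}^m\|F^{(k)}\|_{L_p(\mathbb{R})}$. The trace space is $W^m_p(\mathbb{R})|_E=\{f:E\to\mathbb{R}:\ \exists F\in W^m_p(\mathbb{R}),\ F|_E=f\}$, with trace norm $\|f\|_{W^m_p(\mathbb{R})|_E}=\inf\{\|F\|_{W^m_p(\mathbb{R})}: F\in W^m_p(\mathbb{R}),\ F|_E=f\}$. Divided differences. For a set $S=\{x_0,\dots,x_k\}$ of $k+1$ distinct points, $\Delta^kf[S]=\Delta^kf[x_0,\dots,x_k]=\sum_{i=0}^k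 f(x_i)\big/\prod_{j\ne i}(x_i-x_j)$ (so $\Delta^0f[\{x_0\}]=f(x_0)$). Sharp maximal functions. For $0\le k\le m-1$ and $x\in\mathbb{R}$, $$f^{\#}_{k,E}(x)=\sup\{|\Delta^kf[S]|:\ S\subset E,\ \#S=k+1,\ \operatorname{diam}(S\cup\{x\})\le1\},$$ and for $k=m$, $$f^{\#}_{m,E}(x)=\sup\left\{\frac{\operatorname{diam}S}{\operatorname{diam}(S\cup\{x\})}\,|\Delta^mf[S]|:\ S\subset E,\ \#S=m+1,\ \operatorname{diam}(S\cup\{x\})\le1\right\}.$$ If the family of sets $S$ satisfying the conditions is empty, one puts $f^{\#}_{k,E}(x)=0$. *)

(* Defs.v *)
From HB Require Import structures.
From mathcomp Require Import all_boot all_order all_algebra finmap.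
From mathcomp Require Import all_classical all_reals all_analysis.
From mathcomp Require Import measurable_realfun.

Set Implicit Arguments.
Unset Strict Implicit.
Unset Printing Implicit Defensive.

Import Order.TTheory GRing.Theory Num.Theory.
Import numFieldNormedType.Exports.

Local Open Scope classical_set_scope.
Local Open Scope ring_scope.

Section Lp_membership.
Context {R : realType}.
Implicit Types (p : R) (f : R -> \bar R).

(* Extended-real valued, because a supremum such as [sharp_maximal] below may
   be infinite at some points. *)
Definition in_Lp p f :=
  measurable_fun [set: R] f /\ ('N[lebesgue_measure]_p%:E[f] < +oo)%E.

End Lp_membership.

Section Sobolev.
Context {R : realType}.
Implicit Types (m k : nat) (p : R) (u g phi F : R -> R).

(* The usual epsilon-delta definition, over finite families of
   non-overlapping intervals, on the whole real line. *)
Definition abs_continuous u :=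
  forall e : R, 0 < e -> exists2 d : R, 0 < d &
    forall (n : nat) (a b : 'I_n -> R),
      (forall i, a i <= b i) ->
      trivIset [set: 'I_n] (fun i => `]a i, b i[%classic) ->
      \sum_(i < n) (b i - a i) < d ->
      \sum_(i < n) `|u (b i) - u (a i)| < e.

Definition test_function phi :=
  (forall k (x : R), derivable (derive1n k phi) x 1) /\
  (exists M : R, forall x, M < `|x| -> phi x = 0).

Definition is_weak_derivative u g :=
  [/\ locally_integrable [set: R] u, locally_integrable [set: R] g &
      forall phi, test_function phi ->
        (\int[lebesgue_measure]_x (u x * derive1 phi x)%:E =
         - \int[lebesgue_measure]_x (g x * phi x)%:E)%E].

(* A representative of the weak derivative, which is unique almost everywhere;
   the zero function when there is none. *)
Definition weak_derive u : R -> R :=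
  xget (cst 0) [set g | is_weak_derivative u g].

(* For F in L^m_p, 0 < m: the orders k < m are classical derivatives, the top
   order is the weak derivative of the absolutely continuous F^(m-1). *)
Definition sobolev_derive m F k : R -> R :=
  if (k < m)%N then derive1n k F else weak_derive (derive1n m.-1 F).

Definition homogeneous_sobolev m p F :=
  [/\ forall k, (k < m.-1)%N -> forall x : R, derivable (derive1n k F) x 1,
      abs_continuous (derive1n m.-1 F) &
      exists2 g, is_weak_derivative (derive1n m.-1 F) g &
                 in_Lp p (EFin \o g)].

Definition sobolev m p F :=
  homogeneous_sobolev m p F /\
  forall k, (k <= m)%N -> in_Lp p (EFin \o sobolev_derive m F k).

Definition sobolev_norm m p F : \bar R :=
  (\sum_(k < m.+1) 'N[lebesgue_measure]_p%:E[EFin \o sobolev_derive m F k])%E.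

End Sobolev.

(* A function E -> R is represented by a total f : R -> R; all the notions
   below depend only on the values of f on E. *)
Section trace.
Context {R : realType}.
Implicit Types (m : nat) (p : R) (E : set R) (f F : R -> R).

Definition sobolev_extension m p E f F :=
  sobolev m p F /\ forall x, E x -> F x = f x.

Definition sobolev_trace m p E f := exists F, sobolev_extension m p E f F.

Definition sobolev_trace_norm m p E f : \bar R :=
  ereal_inf [set sobolev_norm m p F | F in sobolev_extension m p E f].

End trace.

Section sharp_maximal.
Context {R : realType}.
Implicit Types (m k : nat) (E : set R) (f : R -> R) (S : {fset R}).

Definition divided_difference f S : R :=
  \sum_(x <- S) f x / \prod_(y <- S | y != x) (x - y).

Definition diam (A : set R) : R := sup [set `|x - y| | x in A & y in A].

Definition admissible k E (x : R) S :=
  [/\ [set` S] `<=` E, #|` S| = k.+1 & diam ([set` S] `|` [set x]) <= 1].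

Definition sharp_weight m k (x : R) S : R :=
  if (k < m)%N then 1 else diam [set` S] / diam ([set` S] `|` [set x]).

Definition sharp_maximal m E f k (x : R) : \bar R :=
  if `[< admissible k E x = set0 >] then 0%E else
  ereal_sup [set (sharp_weight m k x S * `|divided_difference f S|)%:E
            | S in admissible k E x].

End sharp_maximal.

(* Main.v *)
Require Import Defs.
From HB Require Import structures.
From mathcomp Require Import all_boot all_order all_algebra finmap.
From mathcomp Require Import all_classical all_reals all_analysis.
From mathcomp Require Import measurable_realfun.
From mathcomp Require Import ring lra zify.
Import Order.TTheory GRing.Theory Num.Theory.
Import numFieldNormedType.Exports.
Local Open Scope classical_set_scope.
Local Open Scope ring_scope.
Set Implicit Arguments.
Unset Strict Implicit.
Unset Printing Implicit Defensive.

(** Both halves of the equivalence hold pointwise before they hold in norm.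

    Let F extend f.  By the mean value theorem for divided differences, a divided
    difference of order k < m over points within 1 of x is F^(k)(c)/k! for some c
    with |c - x| <= 1, and |F^(k)(c)| is bounded by the averages of |F^(k)| and
    |F^(k+1)| over the ball of radius 2 about x.  For k = m, let a and b be the
    extreme points of S: (a - b) Delta^m F[S] is a difference of two divided
    differences of order m - 1, hence an increment of F^(m-1), hence at most the
    integral of |F^(m)| over a ball whose radius is comparable with
    diam (S u {x}).  The weight diam S / diam (S u {x}) turns this integral into
    an average.  So every sharp maximal function is dominated by
    Hardy-Littlewood maximal functions of derivatives of F
    ([sharp_maximal_le_HL]), and these are bounded on L_p because p > 1
    ([strong_maximal], by interpolation from the weak type inequality).

    Conversely, let E first be finite.  Each point y of E gets the Lagrange
    polynomial of degree < m of f on a cluster of at most m points of E around y,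
    and points at some fixed distance from E get the polynomial 0; consecutive
    polynomials are glued by smooth steps.  The clusters are grown by Prim's
    algorithm.  This choice makes the clusters of two points at distance h either
    equal or full and contained in an interval of length O(h)
    ([prim_cluster_dichotomy]).  In the second case, exchanging the points one at
    a time shows that the two polynomials differ, in the derivative of order i,
    by O(h^(m-i)) times a bound for the weighted divided differences of order m
    ([local_poly_jump]), and this absorbs the factors 1/h produced by
    differentiating the steps.  Hence all derivatives up to the order m are
    bounded at each x by a constant times f#_0(x) + ... + f#_m(x), with a
    constant depending only on m ([finite_extension]).

    Since that constant does not depend on the number of points, an arbitrary E
    is reached along an ultrafilter of finite subsets.  The derivatives of order
    below m are equibounded and equicontinuous, so they converge pointwise; those
    of order m are dominated by one locally integrable function, so their
    integrals converge to those of a density ([ultralimit_density],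
    [ultralimit_jets]).  That densities of increments and weak derivatives are the
    same thing ([weak_derivative_primitive], [primitive_weak_derivative]) makes
    the limit a Sobolev function. *)

(** * Functions with all their derivatives *)

Section Jets.
Context {R : realType}.
Implicit Types (u v : nat -> R -> R) (f : R -> R).

(** A function is carried together with a chosen sequence of its derivatives: sums,
    products and affine changes of variable are then explicit formulas, and no
    derivability side conditions appear. *)
Definition jet u := forall k (x : R), is_derive x (1 : R) (u k) (u k.+1 x).

(** Differentiability from a first-order expansion with an explicit modulus: the
    form in which derivatives pass to limits, since the modulus can be chosen
    uniformly. *)
Lemma is_derive_modulus f (x l : R) (w : R -> R) :
  (forall y, `|f y - f x - l * (y - x)| <= `|y - x| * w y) ->
  w y @[y --> x] --> (0 : R) -> is_derive x (1 : R) f l.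
Proof.
move=> fw w0; apply/is_derive1_caratheodory.
exists (fun z => if z == x then l else (f z - f x) / (z - x)); split.
- move=> z; case: eqVneq => [->|zx]; first by rewrite !subrr mulr0.
  by rewrite divfK// subr_eq0.
- apply/cvgrPdist_le => /= e e0; rewrite eqxx.
  move/cvgrPdist_le : w0 => /(_ _ e0); apply: filterS => y.
  rewrite sub0r normrN => wy; case: eqVneq => [_|yx].
    by rewrite subrr normr0 ltW.
  have yx0 : 0 < `|y - x| by rewrite normr_gt0 subr_eq0.
  rewrite -(ler_pM2l yx0) -normrM mulrBr [(y - x) * (_ / _)]mulrC divfK ?subr_eq0//.
  rewrite distrC [(y - x) * l]mulrC.
  rewrite (le_trans (fw y))// ler_wpM2l//.
  by rewrite (le_trans _ wy)// ler_norm.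
- by rewrite eqxx.
Qed.

Lemma near_is_derive f g (x l : R) : (\forall y \near x, f y = g y) ->
  is_derive x (1 : R) f l -> is_derive x (1 : R) g l.
Proof. exact: near_eq_is_derive. Qed.

Lemma is_derive_ext f g (x l : R) : f =1 g ->
  is_derive x (1 : R) f l -> is_derive x (1 : R) g l.
Proof. by move/funext ->. Qed.

Lemma jet_derive1n u k : jet u -> derive1n k (u 0%N) = u k.
Proof.
move=> ju; elim: k => [//|k IH]; rewrite derive1nS IH; apply/funext => x.
by rewrite derive1E; have /@derive_val := ju k x.
Qed.

Lemma jet_derivable u k (x : R) : jet u -> derivable (u k) x 1.
Proof. by move=> /(_ k x) []. Qed.

Lemma jet_continuous u k : jet u -> continuous (u k).
Proof.
by move=> ju x; apply/differentiable_continuous/derivable1_diffP/jet_derivable.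
Qed.

Lemma jet_horner (p : {poly R}) : jet (fun k => horner p^`(k)).
Proof. by move=> k x; rewrite derivnS; exact: is_derive_poly. Qed.

Lemma jetD u v : jet u -> jet v -> jet (fun k x => u k x + v k x).
Proof. by move=> ju jv k x; have := is_deriveD (ju k x) (jv k x). Qed.

Lemma jetB u v : jet u -> jet v -> jet (fun k x => u k x - v k x).
Proof. by move=> ju jv k x; have := is_deriveB (ju k x) (jv k x). Qed.

Lemma jet_affine (a s : R) u : jet u ->
  jet (fun k x => u k (s * (x - a)) * s ^+ k).
Proof.
move=> ju k x.
have d1 : is_derive x (1 : R) (fun x => s * (x - a)) s.
  have := is_deriveZ s (is_deriveB (is_derive_id x (1:R)) (is_derive_cst a x (1:R))).
  by rewrite subr0 /GRing.scale/= mulr1.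
have h := is_deriveZ (s ^+ k) (@is_derive1_comp _ (u k)
  (fun x0 : R => s * (x0 - a)) x _ _ (ju k (s * (x - a))) d1).
apply: (@is_derive_ext (fun x0 => s ^+ k * u k (s * (x0 - a)))).
  by move=> y; rewrite mulrC.
by apply: (is_derive_eq h); rewrite /GRing.scale/= exprS; ring.
Qed.

Definition jet_mul u v k (x : R) : R :=
  \sum_(i < k.+1) 'C(k, i)%:R * (u i x * v (k - i)%N x).

Lemma jet_mulP u v : jet u -> jet v -> jet (jet_mul u v).
Proof.
move=> ju jv k x.
pose D (i : 'I_k.+1) := 'C(k, i)%:R *
  (u i x * v (k - i).+1 x + v (k - i)%N x * u i.+1 x).
have H (i : 'I_k.+1) : is_derive x (1 : R)
    (fun y => 'C(k, i)%:R * (u i y * v (k - i)%N y)) (D i).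
  by have := is_deriveZ 'C(k, i)%:R (is_deriveM (ju i x) (jv (k - i)%N x)).
have := is_derive_sum H.
have -> : \sum_(i < k.+1) (fun y : R => 'C(k, i)%:R * (u i y * v (k - i)%N y)) =
    jet_mul u v k by apply/funext => y; rewrite fct_sumE.
move=> h; apply: is_derive_eq.
rewrite /jet_mul /D.
under eq_bigr do rewrite mulrDr.
rewrite big_split/= big_ord_recl [RHS]big_ord_recl/= -addrA; congr (_ + _).
  by rewrite !bin0 subn0.
under [RHS]eq_bigr => i _ do rewrite /bump/= add1n binS natrD mulrDl subSS.
rewrite big_split/=; congr (_ + _); last first.
  by apply: eq_bigr => i _; rewrite [v _ _ * _]mulrC.
rewrite [RHS]big_ord_recr/= bin_small// mul0r addr0.
apply: eq_bigr => i _; rewrite /bump/= add1n.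
by rewrite -subSn// subSS.
Qed.

End Jets.

(** * A smooth step *)

Section SmoothStep.
Context {R : realType}.

Lemma exprn_expRN_bound n (y : R) : 0 <= y -> y ^+ n * expR (- y) <= n`!%:R.
Proof.
move=> y0; rewrite expRN ler_pdivrMr ?expR_gt0//; case: n => [|n].
  by rewrite expr0 fact0 mul1r -[leLHS]expR0 ler_expR.
rewrite mulrC -ler_pdivrMr ?ltr0n ?fact_gt0//.
by apply: le_trans (expR_ge1Dxn n y0); rewrite lerDr.
Qed.

Lemma poly_expRN_bound (P : {poly R}) :
  exists C, forall y, 0 <= y -> `|P.[y]| * expR (- y) <= C.
Proof.
exists (\sum_(i < size P) `|P`_i| * i`!%:R) => y y0.
rewrite horner_coef (le_trans (ler_wpM2r (expR_ge0 _) (ler_norm_sum _ _ _)))//.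
rewrite mulr_suml; apply: ler_sum => i _.
rewrite normrM -mulrA ler_wpM2l// normrX ger0_norm//.
exact: exprn_expRN_bound.
Qed.

(** The flat functions P(1/x) exp(-1/x), extended by zero: differentiation maps
    this family to itself, so one computation gives all derivatives. *)
Definition flat_exp (P : {poly R}) (x : R) : R :=
  if 0 < x then P.[x^-1] * expR (- x^-1) else 0.

(** Away from 0 this is calculus; at 0 the exponential beats every power of 1/x,
    so the difference quotients are O(|x|). *)
Lemma is_derive_flat_exp P (x : R) :
  is_derive x (1 : R) (flat_exp P) (flat_exp ('X^2 * (P - P^`())) x).
Proof.
have [x0|x0|x0] := ltgtP 0 x.
- rewrite /flat_exp x0.
  apply: (@near_is_derive _ (fun x => P.[x^-1] * expR (- x^-1))).
    near=> y; rewrite ifT//; near: y; exact: lt_nbhsr.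
  have xn0 : x != 0 by rewrite gt_eqF.
  have dV : is_derive x (1 : R) (fun y : R => y^-1) (- x ^- 2).
    have := is_deriveV xn0 (is_derive_id x (1 : R)).
    by rewrite /GRing.scale/= mulr1.
  have dP := is_derive1_comp (is_derive_poly P x^-1) dV.
  have dN : is_derive x (1 : R) (fun y : R => - y^-1) (x ^- 2).
    by have := is_deriveN dV; rewrite opprK.
  have dE := @is_derive1_comp _ expR (fun y : R => - y^-1) x _ _
    (is_derive_expR (- x^-1)) dN.
  have := is_deriveM dP dE; rewrite /GRing.scale/=.
  move=> h; apply: is_derive_eq; rewrite !hornerE /= exprVn.
  by ring.
- rewrite /flat_exp ltNge (ltW x0)/=.
  apply: (@near_is_derive _ (cst (0 : R))) => //.
    near=> y; rewrite /cst ltNge ifF//; apply/negbF; apply/ltW.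
    near: y; exact: lt_nbhsl.
- rewrite -x0 {2}/flat_exp ltxx.
  have [C hC] := poly_expRN_bound ('X^2 * P).
  apply: (@is_derive_modulus _ _ _ _ (fun y => C * `|y|)).
    move=> y; rewrite {2}/flat_exp ltxx mul0r !subr0 /flat_exp.
    have C0 : 0 <= C.
      by apply: le_trans (hC 0 (lexx _)); rewrite mulr_ge0 ?expR_ge0.
    case: ifPn => y0; last by rewrite normr0 !mulr_ge0.
    have yn0 : y != 0 by rewrite gt_eqF.
    rewrite (gtr0_norm y0) normrM (ger0_norm (expR_ge0 _)).
    have /hC : 0 <= y^-1 by rewrite invr_ge0 ltW.
    rewrite !hornerE normrM ger0_norm ?exprn_ge0 ?invr_ge0 ?(ltW y0)// => h.
    rewrite [leRHS](_ : _ = C * y ^+ 2); last by rewrite /=; ring.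
    rewrite -ler_pdivrMr ?exprn_gt0//.
    by apply: le_trans h; rewrite exprVn mulrC mulrA.
  rewrite -[X in _ --> X](mulr0 C); apply: cvgMr.
  by rewrite -[X in _ --> X](@normr0 _ R); apply: cvg_norm.
Unshelve. all: by end_near. Qed.

Definition flat_jet k : R -> R :=
  flat_exp (iter k (fun P => 'X^2 * (P - P^`())) 1).

Lemma jet_flat : jet flat_jet.
Proof. by move=> k x; exact: is_derive_flat_exp. Qed.

Definition bump_jet : nat -> R -> R :=
  jet_mul flat_jet (fun k x => flat_jet k (- 1 * (x - 1)) * (- 1) ^+ k).

Lemma jet_bump : jet bump_jet.
Proof. apply: jet_mulP; [exact: jet_flat|exact: jet_affine jet_flat]. Qed.

Lemma bump_jet_out k (x : R) : (x <= 0) || (1 <= x) -> bump_jet k x = 0.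
Proof.
move=> /orP x01; rewrite /bump_jet /jet_mul big1// => i _.
have [xle|xge] := x01.
  by rewrite /flat_jet {1}/flat_exp ltNge xle/= mul0r mulr0.
by rewrite /flat_jet [flat_exp _ (- 1 * _)]/flat_exp ltNge mulN1r oppr_le0 subr_ge0 xge/=
  mul0r !mulr0.
Qed.

Lemma bump_ge0 (x : R) : 0 <= bump_jet 0 x.
Proof.
rewrite /bump_jet /jet_mul big_ord1 bin0 mul1r expr0 mulr1 mulr_ge0//;
  by rewrite /flat_jet/= /flat_exp; case: ifP => // _; rewrite hornerE mul1r expR_ge0.
Qed.

Lemma bump_gt0 (x : R) : 0 < x < 1 -> 0 < bump_jet 0 x.
Proof.
move=> /andP[x0 x1]; rewrite /bump_jet /jet_mul big_ord1 bin0 mul1r expr0 mulr1.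
by rewrite mulr_gt0// /flat_jet/= /flat_exp ?x0 ?mulN1r ?oppr_gt0 ?subr_lt0 ?x1
  !hornerE expR_gt0.
Qed.

Local Notation mu := (@lebesgue_measure R).

Lemma integrable_bump : mu.-integrable setT (EFin \o bump_jet 0).
Proof.
have -> : EFin \o bump_jet 0 = (EFin \o bump_jet 0) \_ `[0, 1]%classic.
  apply/funext => x; rewrite patchE; case: ifPn => // /negP.
  rewrite inE/= in_itv/= => /negP; rewrite negb_and -!ltNge => h /=.
  by rewrite bump_jet_out//; case/orP: h => /ltW ->//; rewrite orbT.
apply/integrable_restrict => //; rewrite ?setTI//.
apply: continuous_compact_integrable; first exact: segment_compact.
exact/continuous_subspaceT/(jet_continuous jet_bump).
Qed.

Lemma segment_bound (f : R -> R) (a b : R) : {within `[a, b], continuous f} ->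
  exists M, forall x, a <= x <= b -> `|f x| <= M.
Proof.
move=> cf; have [ab|ba] := leP a b; last first.
  by exists 0 => x /andP[ax xb]; have := le_lt_trans (le_trans ax xb) ba; rewrite ltxx.
have cnf : {within `[a, b], continuous (fun x => `|f x|)}.
  by move=> x; apply: cvg_norm; exact: cf.
have [c _ H] := EVT_max ab cnf; exists `|f c| => x xab.
by apply: H; rewrite in_itv.
Qed.

(** The step is the normalized integral of the bump exp(-1/x) exp(-1/(1-x)). *)
Lemma smooth_step : exists psi : nat -> R -> R,
  [/\ jet psi,
      forall x, x <= 0 -> psi 0%N x = 0,
      forall x, 1 <= x -> psi 0%N x = 1,
      forall k x, (x <= 0) || (1 <= x) -> psi k.+1 x = 0 &
      (forall k, exists M, forall x, `|psi k x| <= M) /\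
      (forall x, 0 <= psi 1%N x)].
Proof.
pose I x := (\int[mu]_(t in [set` Interval -oo%O (BRight x)]) bump_jet 0 t)%R.
have dI x : is_derive x (1 : R) I (bump_jet 0 x).
  have xx1 : x < x + 1 by rewrite ltrDl.
  have [|//| |h1 h2] := @continuous_FTC1 R (bump_jet 0) -oo%O x (x + 1) xx1.
  - by apply: integrableS integrable_bump.
  - by rewrite ltNyr.
  - exact: (jet_continuous jet_bump).
  - by apply: DeriveDef; [exact: h1|rewrite -derive1E; exact: h2].
have I0 x : x <= 0 -> I x = 0.
  move=> x0; rewrite /I (@eq_Rintegral _ _ _ _ _ (cst 0)) ?Rintegral_cst// ?mul0r//.
  move=> y; rewrite inE/= in_itv/= => yx.
  by rewrite bump_jet_out// (le_trans yx x0).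
have I1 x : 1 <= x -> I x = I 1.
  move=> x1; have [->//|xn1] := eqVneq x 1.
  have x1' : 1 < x by rewrite lt_neqAle eq_sym xn1.
  have cI : {within `[1, x], continuous I}.
    apply: continuous_subspaceT => y.
    apply/differentiable_continuous/derivable1_diffP.
    by have [] := dI y.
  have [c cx E] := MVT x1' (fun y _ => dI y) cI.
  move: E; rewrite bump_jet_out ?mul0r; first by move/eqP; rewrite subr_eq0 => /eqP.
  by move: cx; rewrite in_itv/= => /andP[/ltW -> _]; rewrite orbT.
have I1_gt0 : 0 < I 1.
  have cI : {within `[0, 1], continuous I}.
    apply: continuous_subspaceT => y.
    apply/differentiable_continuous/derivable1_diffP.
    by have [] := dI y.
  have [c cx E] := MVT ltr01 (fun y _ => dI y) cI.
  move: E; rewrite (I0 0)// !subr0 mulr1 => ->; apply: bump_gt0.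
  by move: cx; rewrite in_itv.
(* All derivatives of the step are those of the bump, shifted by one order. *)
pose psi k := if k is k'.+1 then fun x => (I 1)^-1 * bump_jet k' x
              else fun x => (I 1)^-1 * I x.
have jpsi : jet psi.
  case=> [|k] x; first by have := is_deriveZ (I 1)^-1 (dI x).
  by have := is_deriveZ (I 1)^-1 (jet_bump k x).
exists psi; split => //.
- by move=> x x0; rewrite /psi/= (I0 x)// mulr0.
- by move=> x x1; rewrite /psi/= (I1 x)// mulVf// gt_eqF.
- by move=> k x h; rewrite /psi bump_jet_out// mulr0.
- split; last by move=> x; rewrite /psi mulr_ge0 ?bump_ge0// invr_ge0 ltW.
  move=> k.
  have [M hM] : exists M, forall x, 0 <= x <= 1 -> `|psi k x| <= M.
    by apply: segment_bound; exact/continuous_subspaceT/jet_continuous.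
  exists (Num.max M 1) => x; rewrite le_max.
  have [x0|x0] := leP x 0.
    rewrite orbC; case: k hM => [|k] _; first by rewrite /psi/= (I0 x)// mulr0 normr0 ler01.
    by rewrite /psi bump_jet_out ?x0// mulr0 normr0 ler01.
  have [x1|x1] := leP 1 x.
    rewrite orbC; case: k hM => [|k] _.
      by rewrite /psi/= (I1 x)// mulVf ?gt_eqF// normr1 lexx.
    by rewrite /psi bump_jet_out ?x1 ?orbT// mulr0 normr0 ler01.
  by rewrite hM// (ltW x0) (ltW x1).
Qed.

End SmoothStep.

(** * Interpolation and divided differences *)

Section Lagrange.
Local Open Scope fset_scope.
Local Open Scope ring_scope.
Context {R : realType}.
Implicit Types (f : R -> R) (S A B T : {fset R}).

Definition node_poly S : {poly R} := \prod_(y <- S) ('X - y%:P).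

Definition interp_poly f S : {poly R} :=
  \sum_(x <- S) (f x / \prod_(y <- S | y != x) (x - y)) *:
                \prod_(y <- S | y != x) ('X - y%:P).

Lemma poly0_of_roots (p : {poly R}) S : (size p <= #|` S|)%N ->
  (forall x, x \in S -> p.[x] = 0) -> p = 0.
Proof.
move=> sp pS; apply: (@roots_geq_poly_eq0 _ _ (enum_fset S)) => //;
  last exact: fset_uniq.
by apply/allP => x xS; apply/rootP/pS.
Qed.

Lemma size_prod_fset_neq S (x : R) : x \in S ->
  size (\prod_(y <- S | y != x) ('X - y%:P) : {poly R}) = #|` S|.
Proof.
move=> xS; rewrite -big_filter size_prod_XsubC size_filter.
have := count_predC (pred1 x) (enum_fset S); rewrite (count_uniq_mem x (fset_uniq S)).
by rewrite -topredE /= in xS; rewrite [x \in _]xS add1n => <-.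
Qed.

Lemma coef_prod_fset_neq S (x : R) : x \in S ->
  (\prod_(y <- S | y != x) ('X - y%:P) : {poly R})`_(#|` S|.-1) = 1.
Proof.
move=> xS; rewrite -(size_prod_fset_neq xS) -lead_coefE.
by apply/eqP; apply: monic_prod_XsubC.
Qed.

Lemma size_node_poly S : size (node_poly S) = #|` S|.+1.
Proof. exact: size_prod_XsubC. Qed.

Lemma node_poly_monic S : node_poly S \is monic.
Proof. exact: monic_prod_XsubC. Qed.

Lemma coef_node_poly S : (node_poly S)`_#|` S| = 1.
Proof. by have /eqP := node_poly_monic S; rewrite lead_coefE size_node_poly. Qed.

Lemma node_poly_root S (x : R) : x \in S -> (node_poly S).[x] = 0.
Proof. by move=> xS; apply/rootP; rewrite root_prod_XsubC. Qed.

Lemma size_interp_poly f S : (size (interp_poly f S) <= #|` S|)%N.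
Proof.
rewrite /interp_poly big_seq (leq_trans (size_sum _ _ _))//.
apply/bigmax_leqP_seq => x xS _.
by rewrite (leq_trans (size_scale_leq _ _))// size_prod_fset_neq.
Qed.

Lemma interp_poly_interp f S (x : R) : x \in S -> (interp_poly f S).[x] = f x.
Proof.
move=> xS; rewrite /interp_poly horner_sum (big_fsetD1 x)//= [X in _ + X]big_seq [X in _ + X]big1 => [|y].
  rewrite addr0 hornerZ horner_prod.
  under [X in _ * X]eq_bigr do rewrite hornerXsubC.
  rewrite divfK// prodf_seq_neq0; apply/allP => y _; apply/implyP.
  by rewrite subr_eq0 eq_sym.
rewrite in_fsetD1 => /andP[yx yS]; rewrite hornerZ horner_prod.
rewrite [X in _ * X]big_mkcond (big_fsetD1 x)//= eq_sym yx hornerXsubC subrr mul0r mulr0//.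
Qed.

Lemma coef_interp_poly f S : (interp_poly f S)`_(#|` S|.-1) = divided_difference f S.
Proof.
rewrite /interp_poly coef_sum /divided_difference big_seq [RHS]big_seq.
by apply: eq_bigr => x xS; rewrite coefZ coef_prod_fset_neq// mulr1.
Qed.

(** Newton's form of the interpolant: adding the node a corrects by a multiple of
    the polynomial vanishing on the old nodes, and comparing leading coefficients
    identifies the multiple. *)
Lemma interp_polyU1 f S (a : R) : a \notin S ->
  interp_poly f (a |` S) =
  interp_poly f S + divided_difference f (a |` S) *: node_poly S.
Proof.
move=> aS; apply/eqP; rewrite -subr_eq0; apply/eqP.
have cS : #|` a |` S| = #|` S|.+1 by rewrite cardfsU1 aS.
apply: (@poly0_of_roots _ S) => [|x xS].
  apply/leq_sizeP => j; rewrite leq_eqVlt => /predU1P[<-|jS].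
    rewrite coefB coefD coefZ coef_node_poly -coef_interp_poly cS/= mulr1.
    by rewrite [X in _ - (X + _)]nth_default ?size_interp_poly// add0r subrr.
  rewrite coefB coefD coefZ !nth_default ?mulr0 ?addr0 ?subr0//.
  - by rewrite size_node_poly.
  - by rewrite (leq_trans (size_interp_poly _ _))// ltnW.
  - by rewrite (leq_trans (size_interp_poly _ _))// cS.
rewrite hornerD hornerN hornerD hornerZ !interp_poly_interp ?in_fsetU ?xS ?orbT// node_poly_root//.
by rewrite mulr0 addr0 subrr.
Qed.

Lemma node_polyU1 S (a : R) : a \notin S ->
  node_poly (a |` S) = ('X - a%:P) * node_poly S.
Proof. by move=> aS; rewrite /node_poly big_fsetU1. Qed.

(** Exchanging one node for another changes the interpolant by a polynomial
    vanishing on the common nodes, with the top divided difference as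
    coefficient; the factor a - b is what the weight in f#_m pays for. *)
Lemma interp_poly_exchange f A (a b : R) : a \notin A -> b \notin A -> a != b ->
  interp_poly f (a |` A) - interp_poly f (b |` A) =
  (divided_difference f (a |` (b |` A)) * (a - b)) *: node_poly A.
Proof.
move=> aA bA ab.
have H1 : a \notin b |` A by rewrite in_fset1U negb_or ab.
have H2 : b \notin a |` A by rewrite in_fset1U negb_or eq_sym ab.
have E : b |` (a |` A) = a |` (b |` A) by rewrite fsetUCA.
have := interp_polyU1 f H2; rewrite E (interp_polyU1 f H1) !node_polyU1//.
set d := divided_difference _ _ => /eqP.
rewrite addrC eq_sym -subr_eq addrAC eq_sym -subr_eq => /eqP <-.
rewrite -scalerBr -mulrBl (_ : 'X - b%:P - ('X - a%:P) = (a - b)%:P).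
  by rewrite mul_polyC scalerA.
by rewrite polyCB; ring.
Qed.

(** Compare the leading coefficients in the exchange formula. *)
Lemma divided_difference_recursion f A (a b : R) :
  a \notin A -> b \notin A -> a != b ->
  divided_difference f (a |` A) - divided_difference f (b |` A) =
  divided_difference f (a |` (b |` A)) * (a - b).
Proof.
move=> aA bA ab; have := interp_poly_exchange f aA bA ab.
move=> /(congr1 (fun p : {poly R} => p`_#|` A|)).
rewrite coefB coefZ coef_node_poly mulr1 => <-; rewrite -!coef_interp_poly.
by rewrite !cardfsU1 aA bA.
Qed.

Lemma size1_derivn (p : {poly R}) k (x : R) : (size p <= k.+1)%N ->
  (p^`(k)).[x] = p`_k * k`!%:R.
Proof.
move=> sp; have -> : p^`(k) = (p^`(k)`_0)%:P.
  apply: size1_polyC; apply/leq_sizeP => j j0; rewrite coef_derivn.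
  by rewrite nth_default ?mul0rn// (leq_trans sp)// addnC -[k.+1]add1n leq_add2r.
by rewrite hornerC coef_derivn addn0 ffactnn mulr_natr.
Qed.

Lemma derivn_size0 (p : {poly R}) k : (size p <= k)%N -> p^`(k) = 0.
Proof.
move=> sp; apply/polyP => i; rewrite coef_derivn coef0 nth_default ?mul0rn//.
by rewrite (leq_trans sp)// leq_addr.
Qed.

(** By induction on the factors, with ffact counting the terms of the derivative. *)
Lemma derivn_prod_XsubC_bound (s : seq R) k (x r : R) : 0 <= r ->
  (forall y, y \in s -> `|x - y| <= r) ->
  `|((\prod_(y <- s) ('X - y%:P))^`(k)).[x]| <=
  ((size s) ^_ k)%:R * r ^+ (size s - k).
Proof.
move=> r0; elim: s k => [|a s IH] k xs.
  rewrite big_nil; case: k => [|k]; first by rewrite hornerE normr1 mul1r expr0.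
  by rewrite derivn_size0 ?hornerE ?normr0 ?mulr_ge0// size_poly1.
have xs' y : y \in s -> `|x - y| <= r by move=> ys; rewrite xs// inE ys orbT.
have xa : `|x - a| <= r by rewrite xs// inE eqxx.
rewrite big_cons; set P := \prod_(j <- s) _.
have E : ((('X - a%:P) * P)^`(k)).[x] =
    (x - a) * P^`(k).[x] + k%:R * P^`(k.-1).[x].
  elim: k {IH} => [|k IH]; first by rewrite mul0r addr0 !derivn0 !hornerE.
  have -> : (('X - a%:P) * P)^`(k.+1) = ('X - a%:P) * P^`(k.+1) + k.+1%:R *: P^`(k).
    elim: k {IH} => [|k IH].
      by rewrite !derivn1 derivM derivXsubC mul1r scale1r addrC.
    rewrite derivnS IH derivD derivM derivXsubC mul1r derivZ -!derivnS.
    rewrite [P^`(k.+1) + _]addrC -addrA -[X in _ + (X + _)]scale1r -scalerDl.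
    by rewrite nat1r.
  by rewrite !hornerE.
rewrite E /= (le_trans (ler_normD _ _))// !normrM normr_nat.
have [ks|ks] := leqP k (size s).
- rewrite (@le_trans _ _ (r * ((size s) ^_ k)%:R * r ^+ (size s - k) +
     k%:R * ((size s ^_ k.-1)%:R * r ^+ (size s - k.-1))))//.
    rewrite lerD//; last by rewrite ler_wpM2l// IH.
    by rewrite -mulrA ler_pM// IH.
  case: k {E} ks => [|k] ks; first by rewrite mul0r addr0 !ffactn0 mulr1 mul1r subn0 exprS.
  rewrite subSS/= mulrA -natrM.
  have -> : (size s - k = (size s - k.+1).+1)%N by rewrite subnSK.
  rewrite exprS mulrAC [r * _ * _]mulrC -mulrDl -natrD.
  rewrite ler_wpM2r ?mulr_ge0 ?exprn_ge0// ler_nat ffactSS ffactnSr.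
  by rewrite [(k.+1 * _)%N]mulnC -mulnDr addnS subnK ?(ltnW ks)// mulnC.
- rewrite [P^`(k)]derivn_size0; last by rewrite size_prod_XsubC.
  rewrite horner0 normr0 mulr0 add0r (le_trans (ler_wpM2l _ (IH _ xs')))//.
  case: k ks {E} => [//|k]; rewrite ltnS /= => ks.
  by rewrite mulrA -natrM ffactSS subSS; move: ks; rewrite leq_eqVlt => /predU1P[->|/ffact_small->];
   rewrite ?muln0 ?mul0r// mulnC.
Qed.

Lemma ffact_le_fact n k : (n ^_ k <= n`!)%N.
Proof.
have [kn|kn] := leqP k n; last by rewrite ffact_small// ltnW.
by rewrite -(ffact_fact kn) leq_pmulr// fact_gt0.
Qed.

Lemma fset_insert_ind (P : {fset R} -> Prop) : P fset0 ->
  (forall a S, a \notin S -> P S -> P (a |` S)) -> forall S, P S.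
Proof.
move=> P0 PS S; elim: {S}#|` S| {-2}S (erefl #|` S|) => [S /cardfs0_eq ->//|n IH S cS].
have /fset0Pn[a aS] : S != fset0 by rewrite -cardfs_gt0 cS.
rewrite -(fsetD1K aS); apply: PS; first by rewrite in_fsetD1 eqxx.
by apply: IH; move: cS; rewrite (cardfsD1 a) aS => -[].
Qed.

(** Newton's form expresses the interpolant through divided differences over
    subsets of the nodes. *)
Lemma interp_poly_bound f S k (x H : R) :
  (forall y, y \in S -> `|x - y| <= 1) ->
  (forall T, T `<=` S -> (0 < #|` T|)%N -> `|divided_difference f T| <= H) ->
  `|((interp_poly f S)^`(k)).[x]| <= (#|` S| * (#|` S|)`!)%:R * H.
Proof.
elim/fset_insert_ind: S => [|a S aS IH] xS HT.
  by rewrite /interp_poly big_seq_fset0 linear0 horner0 normr0 cardfs0 mul0n mul0r.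
have H0 : 0 <= H.
  apply: le_trans (HT [fset a] _ _); rewrite ?cardfs1//.
  by rewrite fsubsetU// fsubset_refl.
rewrite interp_polyU1// derivnD hornerD (le_trans (ler_normD _ _))//.
rewrite derivnZ hornerZ normrM cardfsU1 aS add1n mulSn natrD mulrDl addrC lerD//.
  rewrite mulrC ler_pM//; last by apply: HT; rewrite ?fsubset_refl// cardfsU1 aS.
  apply: (le_trans (derivn_prod_XsubC_bound k ler01 _)).
    by move=> y yS; apply: xS; rewrite in_fsetU yS orbT.
  by rewrite expr1n mulr1 ler_nat (leq_trans (ffact_le_fact _ _))// factS leq_pmull.
apply: le_trans (IH _ _) _.
- by move=> y yS; apply: xS; rewrite in_fsetU yS orbT.
- by move=> T TS; apply: HT; rewrite (fsubset_trans TS)// fsubsetUr.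
- by rewrite ler_wpM2r// ler_nat leq_mul2l factS leq_pmull ?orbT.
Qed.

(** Pass from A to B by exchanging one node at a time: at most #(A minus B)
    exchanges, all among the nodes of A and B. *)
Lemma interp_poly_exchange_bound f A B k (x r K : R) : #|` A| = #|` B| ->
  (k < #|` A|)%N -> 0 <= r ->
  (forall y, y \in A `|` B -> `|x - y| <= r) ->
  (forall T a b, T `<=` A `|` B -> #|` T| = #|` A|.+1 -> a \in T -> b \in T ->
     `|divided_difference f T| * `|a - b| <= K) ->
  `|((interp_poly f A - interp_poly f B)^`(k)).[x]| <=
  (#|` A `\` B| * (#|` A|)`!)%:R * (K * r ^+ (#|` A|.-1 - k)).
Proof.
elim: {A}_.+1 {-2}A (ltnSn #|` A `\` B|) => // n IH A.
rewrite ltnS => An AB kA r0 xAB HK.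
have [AB0|/fset0Pn[a]] := eqVneq (A `\` B) fset0.
  have -> : A = B.
    apply/eqP; rewrite eqEfcard AB leqnn andbT.
    by rewrite -fsetD_eq0 AB0.
  by rewrite subrr linear0 horner0 normr0 fsetDv cardfs0 mul0n mul0r.
rewrite in_fsetD => /andP[aB aA].
have /fset0Pn[b] : B `\` A != fset0.
  rewrite -cardfs_gt0 -(ltn_add2l #|` A `&` B|) addn0.
  rewrite fsetIC cardfsID -AB -(cardfsID B A) -addn1 fsetIC leq_add2l cardfs_gt0.
  by apply/fset0Pn; exists a; rewrite in_fsetD aB.
rewrite in_fsetD => /andP[bA bB].
have ab : a != b by apply: contraNneq bA => <-.
(* Exchange one point a of A outside B for a point b of B outside A. *)
pose A' := A `\ a.
have aA' : a \notin A' by rewrite in_fsetD1 eqxx.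
have bA' : b \notin A' by rewrite in_fsetD1 negb_and bA orbT.
have EA : A = a |` A' by rewrite fsetD1K.
have cA : #|` A| = #|` A'|.+1 by rewrite EA cardfsU1 aA'.
have cB : #|` b |` A'| = #|` A| by rewrite cardfsU1 bA' cA.
have sub : (b |` A') `|` B `<=` A `|` B.
  apply/fsubsetP => y; rewrite !in_fsetU in_fset1 in_fsetD1.
  by case/orP => [/orP[/eqP->|/andP[_ ->]]|->]; rewrite ?bB ?orbT.
have cD : (#|` (b |` A') `\` B| < #|` A `\` B|)%N.
  have -> : (b |` A') `\` B = (A `\` B) `\ a.
    apply/fsetP => y; rewrite !in_fsetD !in_fsetU in_fset1 in_fset1.
    have [->|yb] := eqVneq y b; first by rewrite bB (negbTE bA) !andbF.
    by rewrite orFb in_fsetD1 andbCA.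
  by rewrite [ltnRHS](cardfsD1 a) in_fsetD aB aA.
have -> : interp_poly f A - interp_poly f B =
    (interp_poly f A - interp_poly f (b |` A')) + (interp_poly f (b |` A') - interp_poly f B).
  by rewrite addrA subrK.
rewrite derivnD hornerD (le_trans (ler_normD _ _))//.
have HA : `|((interp_poly f A - interp_poly f (b |` A'))^`(k)).[x]| <=
    (#|` A|)`!%:R * (K * r ^+ (#|` A|.-1 - k)).
  rewrite EA interp_poly_exchange// derivnZ hornerZ normrM -EA mulrCA ler_pM//.
    rewrite normrM HK//; rewrite ?in_fsetU ?in_fset1 ?eqxx ?orbT//.
      apply/fsubsetP => y; rewrite !in_fsetU !in_fset1 in_fsetD1.
      by case/orP => [/eqP->|/orP[/eqP->|/andP[_ ->]]]; rewrite ?aA ?bB ?orbT.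
    by rewrite cardfsU1 in_fsetU in_fset1 (negbTE ab) (negbTE aA') cB.
  apply: (le_trans (derivn_prod_XsubC_bound k r0 _)).
    by move=> y; rewrite in_fsetD1 => /andP[_ yA]; rewrite xAB// in_fsetU yA.
  rewrite cA/= ler_wpM2r ?exprn_ge0// ler_nat.
  by rewrite (leq_trans (ffact_le_fact _ _))// factS leq_pmull.
have K0 : 0 <= K.
  apply: le_trans (HK (a |` (b |` A')) a b _ _ _ _).
  - by rewrite mulr_ge0.
  - apply/fsubsetP => y; rewrite !in_fsetU !in_fset1 in_fsetD1.
    by case/orP => [/eqP->|/orP[/eqP->|/andP[_ ->]]]; rewrite ?aA ?bB ?orbT.
  - by rewrite cardfsU1 in_fsetU in_fset1 (negbTE ab) (negbTE aA') cB.
  - by rewrite in_fsetU in_fset1 eqxx.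
  - by rewrite !in_fsetU !in_fset1 eqxx orbT.
have HB := IH (b |` A') (leq_trans cD An).
apply: le_trans (lerD HA (HB _ _ r0 _ _)) _.
- by rewrite cB.
- by rewrite cB.
- by move=> y yB; apply: xAB; apply: (fsubsetP sub).
- by move=> T c d TB; rewrite cB => cT; apply: HK => //; exact: fsubset_trans sub.
rewrite cB -mulrDl ler_wpM2r ?mulr_ge0 ?exprn_ge0// -natrD ler_nat -mulSn.
by rewrite leq_mul2r cD orbT.
Qed.

End Lagrange.

(** * The mean value theorem for divided differences *)

Section MeanValue.
Context {R : realType}.
Implicit Types (f : R -> R) (S : {fset R}).

(** Rolle's theorem between consecutive zeros; the new zeros are again strictly
    increasing, so that the argument can be iterated. *)
Lemma rolle_path (f df : R -> R) (x : R) (s : seq R) :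
  (forall y, is_derive y (1 : R) f (df y)) ->
  path <%R x s -> all (fun y => f y == 0) (x :: s) ->
  exists s', [/\ size s' = size s, path <%R x s',
    all (fun y => y <= last x s) s' & all (fun y => df y == 0) s'].
Proof.
move=> dfx; elim: s x => [|y s IH] x /=; first by exists [::].
move=> /andP[xy ys] /and3P[/eqP fx /eqP fy fs].
have [|s' [ss' ps' ls' zs']] := IH y ys; first by rewrite /= fy eqxx.
have cf : {within `[x, y], continuous f}.
  apply: continuous_subspaceT => z.
  by apply/differentiable_continuous/derivable1_diffP; have [] := dfx z.
have df' z : z \in `]x, y[ -> derivable f z 1 by have [] := dfx z.
have [c] := Rolle xy df' cf (etrans fx (esym fy)).
rewrite in_itv/= => /andP[xc cy] dc.
exists (c :: s'); split => /=; rewrite ?ss'//.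
- rewrite xc/=; case: s' ps' {ss' ls' zs'} => //= z s' /andP[yz ->].
  by rewrite (lt_trans cy yz).
- rewrite ls' andbT (le_trans (ltW cy))//.
  by move: (order_path_min lt_trans ys) => /allP; case: (s) => //= z s2 /(_ (last z s2));
    rewrite mem_last => /(_ isT)/ltW.
- rewrite zs' andbT; have := dfx c => h; have := @derive_val _ _ _ _ _ _ _ h.
  by rewrite (@derive_val _ _ _ _ _ _ _ dc) => <-.
Qed.

Lemma rolle_iter n (u : nat -> R -> R) (x : R) (s : seq R) :
  (forall k y, (k < n)%N -> is_derive y (1 : R) (u k) (u k.+1 y)) ->
  size s = n -> path <%R x s -> all (fun y => u 0%N y == 0) (x :: s) ->
  exists2 c, x <= c <= last x s & u n c = 0.
Proof.
elim: n u x s => [|n IH] u x s du.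
  case: s => //= _ _ /andP[/eqP ux _]; exists x => //; by rewrite lexx.
move=> ss ps us.
have [s' [ss' ps' ls' zs']] := rolle_path (fun y => du 0%N y isT) ps us.
case: s' ss' ps' ls' zs' => [|y s']; first by rewrite ss.
rewrite ss => -[ss'] /= /andP[xy ps'] /andP[yl ls'] zs'.
have [c /andP[yc cl] uc] := IH (fun k => u k.+1) y s' (fun k z kn => du k.+1 z kn) ss' ps' zs'.
exists c => //; rewrite (le_trans (ltW xy) yc) (le_trans cl)//.
move/allP: ls'; case: (s') => //= z s2 H; apply: H; exact: mem_last.
Qed.

(** The difference with the interpolant has k+1 zeros, so its k-th derivative has
    one, and there the k-th derivative of the interpolant is k! times its leading
    coefficient. *)
Lemma divided_difference_mean k (u : nat -> R -> R) S (a b : R) :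
  (forall j y, (j < k)%N -> is_derive y (1 : R) (u j) (u j.+1 y)) ->
  #|` S|%fset = k.+1 -> (forall y, y \in S -> a <= y <= b) ->
  exists2 c, a <= c <= b & divided_difference (u 0%N) S = u k c / k`!%:R.
Proof.
move=> du cS Sab; pose L := interp_poly (u 0%N) S.
pose v j y := u j y - L^`(j).[y].
have dv j y : (j < k)%N -> is_derive y (1 : R) (v j) (v j.+1 y).
  by move=> jk; have := is_deriveB (du j y jk) (jet_horner L j y).
pose s := sort <=%R (enum_fset S).
have ms y : (y \in s) = (y \in S) by rewrite mem_sort.
have us : uniq s by rewrite sort_uniq fset_uniq.
have ss : size s = k.+1 by rewrite size_sort.
have ps : sorted <%R s by rewrite lt_sorted_uniq_le us/= sort_le_sorted.
case: s ms us ss ps => // x s ms us [ss] /= ps.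
have [|c /andP[xc cl] vc] := @rolle_iter k v x s dv ss ps.
  by apply/allP => y; rewrite ms => yS; rewrite /v derivn0 interp_poly_interp// subrr.
exists c.
  have /Sab/andP[ax _] : x \in S by rewrite -ms inE eqxx.
  have /Sab/andP[_ lb] : last x s \in S by rewrite -ms mem_last.
  by rewrite (le_trans ax xc) (le_trans cl lb).
move/eqP: vc; rewrite /v subr_eq0 => /eqP ->.
rewrite size1_derivn -?cS ?size_interp_poly//.
have -> : L`_k = divided_difference (u 0%N) S by rewrite -coef_interp_poly cS.
by rewrite mulfK// pnatr_eq0 -lt0n fact_gt0.
Qed.

End MeanValue.

(** * Greedy clusters of a finite set *)

Section Cluster.
Local Open Scope fset_scope.
Local Open Scope ring_scope.
Context {R : realType}.
Variables (E : {fset R}) (delta : R).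
Implicit Types (K C : {fset R}) (x y z w h : R).

Definition nearest K z := [/\ z \in E, z \notin K & exists2 w, w \in K &
  `|z - w| <= delta /\ forall z' w', z' \in E -> z' \notin K -> w' \in K ->
     `|z - w| <= `|z' - w'|].

(** One step of Prim's algorithm: add a point of E nearest to K, if there is one at
    distance at most delta. *)
Definition grow K : {fset R} :=
  if `[< exists z, nearest K z >] then xget 0 (nearest K) |` K else K.

Definition prim_cluster n x := iter n grow [fset x].

(** No point of E outside K is within h of K: the growth of K by gaps of length at
    most h is over. *)
Definition h_closed h K := forall z w, z \in E -> z \notin K -> w \in K ->
  h < `|z - w|.

Lemma seq_min (s : seq R) : s != [::] ->
  exists2 a, a \in s & forall b, b \in s -> a <= b.
Proof.
elim: s => // a [_ _|b s IH _].
  by exists a; rewrite ?inE// => b; rewrite inE => /eqP ->.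
have [c cs cmin] := IH isT; have [ac|ca] := leP a c.
  exists a; rewrite ?inE ?eqxx// => d; rewrite inE => /predU1P[->//|ds].
  exact: le_trans ac (cmin _ ds).
exists c; first by rewrite in_cons cs orbT.
move=> d; rewrite inE => /predU1P[->|/cmin//].
exact: ltW.
Qed.

Lemma growP K : (exists2 z, nearest K z & grow K = z |` K) \/
  (grow K = K /\ h_closed delta K).
Proof.
rewrite /grow; case: asboolP => [[z zK]|nK]; [left|right].
  by exists (xget 0 (nearest K)) => //; apply: (@xgetPex _ 0 (nearest K)); exists z.
split=> // z w zE zK wK; rewrite ltNge; apply/negP => zw; apply: nK.
pose s := [seq `|u.1 - u.2| | u <- [seq (z', w') | z' <- E `\` K, w' <- K]].
have sP z' w' : z' \in E -> z' \notin K -> w' \in K -> `|z' - w'| \in s.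
  move=> z'E z'K w'K; apply/mapP; exists (z', w') => //.
  by apply/allpairsP; exists (z', w'); split => //=; rewrite in_fsetD z'K.
have [|a] := @seq_min s; first by apply/eqP => s0; have := sP z w zE zK wK; rewrite s0.
move=> /mapP[[z' w'] /allpairsP[[z'' w''] /= [+ w'K [-> ->]]] ->] amin.
rewrite in_fsetD => /andP[z'K z'E]; exists z''; split => //; exists w'' => //; split.
  by rewrite (le_trans _ zw)// amin// sP.
by move=> *; rewrite amin// sP.
Qed.

Lemma grow_sub K : K `<=` grow K.
Proof.
by case: (growP K) => [[z _ ->]|[-> _]]; [exact: fsubsetUr|exact: fsubset_refl].
Qed.

Lemma prim_cluster_self n x : x \in prim_cluster n x.
Proof.
elim: n => [|n IH]; first by rewrite /prim_cluster/= in_fset1.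
by rewrite /prim_cluster iterS; exact: (fsubsetP (grow_sub _)).
Qed.

Lemma prim_cluster_sub n x : x \in E -> prim_cluster n x `<=` E.
Proof.
move=> xE; elim: n => [|n IH]; first by rewrite /prim_cluster/= fsub1set.
rewrite /prim_cluster iterS; case: (growP (iter n grow [fset x])) => [[z [zE _ _] ->]|[-> _]//].
by rewrite fsubUset fsub1set zE.
Qed.

Lemma card_prim_cluster n x : (#|` prim_cluster n x| <= n.+1)%N.
Proof.
elim: n => [|n IH]; first by rewrite /prim_cluster/= cardfs1.
rewrite /prim_cluster iterS; case: (growP (iter n grow [fset x])) => [[z _ ->]|[-> _]].
  by rewrite cardfsU1 (leq_trans (leq_add (leq_b1 _) IH)).
exact: leq_trans IH _.
Qed.

Lemma prim_cluster_dist n x y : 0 <= delta -> y \in prim_cluster n x ->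
  `|x - y| <= n%:R * delta.
Proof.
move=> d0; elim: n y => [|n IH] y.
  by rewrite /prim_cluster/= in_fset1 => /eqP ->; rewrite subrr normr0 mul0r.
rewrite /prim_cluster iterS; case: (growP (iter n grow [fset x])) => [[z + ->]|[-> _]].
  move=> [_ _ [w wn [zw _]]]; rewrite in_fset1U => /predU1P[->|/IH].
    rewrite -natr1 mulrDl mul1r (le_trans (ler_distD w _ _))// lerD//.
      exact: IH.
    by rewrite distrC.
  by move/le_trans; apply; rewrite ler_wpM2r// ler_nat.
by move=> /IH /le_trans; apply; rewrite ler_wpM2r// ler_nat.
Qed.

Lemma grow_open h K : h <= delta -> ~ h_closed h K ->
  exists z, [/\ z \notin K, grow K = z |` K, z \in E & exists2 w, w \in K & `|z - w| <= h].
Proof.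
move=> hd nK; have [z [w [zE zK wK zw]]] : exists z w,
    [/\ z \in E, z \notin K, w \in K & `|z - w| <= h].
  apply: contrapT => H; apply: nK => z w zE zK wK; rewrite ltNge; apply/negP => zw.
  by apply: H; exists z, w.
case: (growP K) => [[z' [z'E z'K [w' w'K [_ min]]] ->]|[_ cl]].
  by exists z'; split => //; exists w' => //; exact: le_trans (min z w zE zK wK) zw.
by have := cl z w zE zK wK; rewrite ltNge (le_trans zw hd).
Qed.

(** As long as gaps of length at most h are available, Prim's algorithm uses only
    such gaps; so it stays inside every h-closed set that contains the root. *)
Lemma prim_cluster_open h n x : 0 <= h -> h <= delta ->
  (forall i, (i < n)%N -> ~ h_closed h (prim_cluster i x)) ->
  [/\ #|` prim_cluster n x| = n.+1,
      forall C, h_closed h C -> x \in C -> prim_cluster n x `<=` C &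
      forall y, y \in prim_cluster n x -> `|x - y| <= n%:R * h].
Proof.
move=> h0 hd; elim: n => [_|n IH ncl].
  split; first by rewrite /prim_cluster/= cardfs1.
    by move=> C _ xC; rewrite /prim_cluster/= fsub1set.
  by move=> y; rewrite /prim_cluster/= in_fset1 => /eqP ->; rewrite subrr normr0 mul0r.
have [|c1 c2 c3] := IH; first by move=> i iln; apply: ncl; exact: ltnW.
have [z [zK E' zE [w wK zw]]] := grow_open hd (ncl n (leqnn _)).
rewrite /prim_cluster iterS -/(prim_cluster n x) E'; split.
- by rewrite cardfsU1 zK c1.
- move=> C clC xC; rewrite fsubUset c2// andbT fsub1set.
  apply/negPn/negP => zC; have := clC z w zE zC (fsubsetP (c2 _ clC xC) _ wK).
  by rewrite ltNge zw.
- move=> y; rewrite in_fset1U => /predU1P[->|/c3].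
    rewrite -natr1 mulrDl mul1r (le_trans (ler_distD w _ _))// lerD//.
      exact: c3.
    by rewrite distrC.
  by move/le_trans; apply; rewrite ler_wpM2r// ler_nat.
Qed.

(** Both clusters stop growing at the component of x and y in the graph of the
    gaps of length at most h, and they reach it after the same number of steps
    because each step adds one point. *)
Lemma prim_cluster_closed_eq h i x y : 0 <= h -> h <= delta ->
  x \in E -> y \in E -> `|x - y| <= h ->
  (forall j, (j < i)%N -> ~ h_closed h (prim_cluster j x)) ->
  h_closed h (prim_cluster i x) -> prim_cluster i x = prim_cluster i y.
Proof.
move=> h0 hd xE yE xy ncl clx.
have yx : y \in prim_cluster i x.
  apply/negPn/negP => yn; have := clx y x yE yn (prim_cluster_self _ _).
  by rewrite distrC ltNge xy.
have [cx minx _] := prim_cluster_open h0 hd ncl.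
have [j [ji ncly cly]] : exists j, [/\ (j <= i)%N,
    forall k, (k < j)%N -> ~ h_closed h (prim_cluster k y) & h_closed h (prim_cluster j y)].
  apply: contrapT => H.
  have ncly k : (k < i.+1)%N -> ~ h_closed h (prim_cluster k y).
    elim/ltn_ind: k => k IH ki cl; apply: H; exists k; split=> // l lk.
    by apply: IH => //; exact: ltn_trans ki.
  have [cy suby _] := prim_cluster_open h0 hd ncly.
  have := fsubset_leq_card (suby _ clx yx).
  by rewrite cx cy ltnn.
have [cy miny _] := prim_cluster_open h0 hd ncly.
have xy' : x \in prim_cluster j y.
  apply/negPn/negP => yn; have := cly x y xE yn (prim_cluster_self _ _).
  by rewrite ltNge xy.
have eq : prim_cluster i x = prim_cluster j y.
  by apply/eqP; rewrite eqEfsubset minx//= miny.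
by move: cx; rewrite eq cy => -[->].
Qed.

(** The clusters of two points at distance h can only differ if both growths are
    fed to the end by gaps of length at most h; then both have grown to full size
    within a few multiples of h.  This is what makes the jump between two
    interpolants small at the scale h at which it happens. *)
Lemma prim_cluster_dichotomy h n x y : 0 <= h -> h <= delta ->
  x \in E -> y \in E -> `|x - y| <= h ->
  prim_cluster n x = prim_cluster n y \/
  [/\ #|` prim_cluster n x| = n.+1, #|` prim_cluster n y| = n.+1 &
      forall z, z \in prim_cluster n x `|` prim_cluster n y ->
        `|x - z| <= n.+1%:R * h /\ `|y - z| <= n.+1%:R * h].
Proof.
move=> h0 hd xE yE xy.
have eqn i u v : (i < n)%N -> u \in E -> v \in E -> `|u - v| <= h ->
    h_closed h (prim_cluster i u) -> prim_cluster n u = prim_cluster n v.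
  elim/ltn_ind: i => i IH iln uE vE uv cl.
  have [[j [ji clj]]|H] := pselect (exists j, (j < i)%N /\ h_closed h (prim_cluster j u)).
    by apply: (IH j) => //; exact: ltn_trans iln.
  have eqi : prim_cluster i u = prim_cluster i v.
    by apply: (@prim_cluster_closed_eq h) => // j ji clj; apply: H; exists j.
  by rewrite /prim_cluster -(subnK (ltnW iln)) !iterD -!/(prim_cluster i _) eqi.
have [[i [iln cl]]|Hx] := pselect (exists i, (i < n)%N /\ h_closed h (prim_cluster i x)).
  by left; exact: (eqn i).
have [[i [iln cl]]|Hy] := pselect (exists i, (i < n)%N /\ h_closed h (prim_cluster i y)).
  by left; apply/esym; apply: (eqn i) => //; rewrite distrC.
right.
have [|cx _ dx] := @prim_cluster_open h n x h0 hd.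
  by move=> i iln cl; apply: Hx; exists i.
have [|cy _ dy] := @prim_cluster_open h n y h0 hd.
  by move=> i iln cl; apply: Hy; exists i.
split=> // z; rewrite in_fsetU -natr1 mulrDl mul1r => /orP[/dx xz|/dy yz].
  split; first by rewrite ler_wpDr.
  by rewrite (le_trans (ler_distD x _ _))// addrC lerD// distrC.
split; last by rewrite ler_wpDr.
by rewrite (le_trans (ler_distD y _ _))// addrC lerD.
Qed.

End Cluster.

(** * Diameters *)

Section Diameter.
Context {R : realType}.
Implicit Types (A : set R) (T : {fset R}) (x r : R).

Lemma diam_le A r : A !=set0 -> (forall a b, A a -> A b -> `|a - b| <= r) ->
  diam A <= r.
Proof.
move=> [a Aa] Ar; apply: ge_sup; first by exists `|a - a|, a => //; exists a.
by move=> _ [b Ab] [c Ac] <-; exact: Ar.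
Qed.

Lemma has_ubound_diam T x :
  has_ubound [set `|a - b| | a in [set` T] `|` [set x] & b in [set` T] `|` [set x]].
Proof.
pose M := \sum_(y <- T) `|x - y|.
have HM a : ([set` T] `|` [set x]) a -> `|x - a| <= M.
  case=> [aT|->]; last by rewrite subrr normr0 sumr_ge0.
  by rewrite /M (big_fsetD1 a)//= lerDl sumr_ge0.
exists (M + M) => _ [a Aa] [b Ab] <-.
by rewrite (le_trans (ler_distD x _ _))// lerD ?HM// distrC HM.
Qed.

Lemma diam_ge T x a b : a \in T -> b \in T ->
  `|a - b| <= diam ([set` T] `|` [set x]).
Proof.
move=> aT bT; apply: ub_le_sup; first exact: has_ubound_diam.
by exists a; [left|exists b => //; left].
Qed.

Lemma dist_diam T x a : a \in T -> `|x - a| <= diam ([set` T] `|` [set x]).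
Proof.
move=> aT; apply: ub_le_sup; first exact: has_ubound_diam.
by exists x; [right|exists a => //; left].
Qed.

Lemma dist_le_diam T a b : a \in T -> b \in T -> `|a - b| <= diam [set` T].
Proof.
move=> aT bT; apply: ub_le_sup; last by exists a => //; exists b.
have [M hM] := has_ubound_diam T a; exists M => _ [c Tc] [d Td] <-.
by apply: hM; exists c; [left|exists d => //; left].
Qed.

End Diameter.

(** * Gluing polynomials along an increasing list of nodes *)

Section Blending.
Context {R : realType}.
Variables (psi : nat -> R -> R) (Q : R -> {poly R}).
Hypothesis jpsi : jet psi.
Hypothesis psi0 : forall x, x <= 0 -> psi 0%N x = 0.
Hypothesis psi1 : forall x, 1 <= x -> psi 0%N x = 1.
Hypothesis psi' : forall k x, (x <= 0) || (1 <= x) -> psi k.+1 x = 0.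
Implicit Types (a b c x : R) (s : seq R) (k : nat).

(** The passage from Q a to Q b over the interval [a, b]. *)
Definition blend a b : nat -> R -> R :=
  jet_mul (fun k => horner (Q b - Q a)^`(k))
          (fun k x => psi k ((b - a)^-1 * (x - a)) * (b - a)^-1 ^+ k).

Fixpoint blends a s : nat -> R -> R :=
  if s is b :: s' then fun k x => blend a b k x + blends b s' k x
  else fun _ _ => 0.

(** The polynomial Q a corrected at each interval between consecutive nodes: a
    telescoping form of the gluing in which smoothness is obvious. *)
Definition blended a s k x := (Q a)^`(k).[x] + blends a s k x.

Lemma jet_blended a s : jet (blended a s).
Proof.
apply: jetD; first exact: jet_horner.
elim: s a => [|b s IH] a /=; first by move=> k x; exact: is_derive_cst.
by apply: jetD => //; apply: jet_mulP; [exact: jet_horner|exact: jet_affine].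
Qed.

Lemma blend_left a b k x : a < b -> x <= a -> blend a b k x = 0.
Proof.
move=> ab xa; rewrite /blend /jet_mul big1// => i _.
have t0 : (b - a)^-1 * (x - a) <= 0.
  by rewrite mulr_ge0_le0// ?invr_ge0 ?subr_ge0 ?subr_le0// ltW.
by case: (k - i)%N => [|j]; rewrite ?psi0 ?psi' ?t0// !mul0r !mulr0.
Qed.

Lemma blend_right a b k x : a < b -> b <= x ->
  blend a b k x = (Q b - Q a)^`(k).[x].
Proof.
move=> ab bx; rewrite /blend /jet_mul.
have t1 : 1 <= (b - a)^-1 * (x - a).
  by rewrite mulrC ler_pdivlMr ?subr_gt0// mul1r lerD2r.
rewrite big_ord_recr/= subnn psi1// expr0 !mulr1 binn mul1r big1 ?add0r// => i _.
have -> : (k - i = (k - i.+1).+1)%N by rewrite subnSK.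
by rewrite psi' ?t1 ?orbT// mul0r !mulr0.
Qed.

Lemma blends_left a s k x : path <%R a s -> x <= a -> blends a s k x = 0.
Proof.
elim: s a => [//|b s IH] a /= /andP[ab bs] xa.
by rewrite blend_left// add0r IH// (le_trans xa)// ltW.
Qed.

Lemma path_le_last a s (y : R) : path <%R a s -> y \in a :: s -> y <= last a s.
Proof.
elim: s a y => [|b s IH] a y /=; first by rewrite inE => _ /eqP ->.
move=> /andP[ab bs]; rewrite in_cons => /predU1P[->|]; last exact: IH.
by rewrite (le_trans (ltW ab))// IH// mem_head.
Qed.

(** All transitions to the left of x are complete and those to the right have not
    begun, so at most one of them is active at x. *)
Lemma blended_cases a s x : path <%R a s -> a <= x ->
  (last a s <= x /\ forall k, blended a s k x = (Q (last a s))^`(k).[x]) \/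
  exists b c, [/\ b \in a :: s, c \in a :: s, b < c, b <= x <= c &
    (forall y, y \in a :: s -> (y <= b) || (c <= y)) /\
    forall k, blended a s k x = (Q b)^`(k).[x] + blend b c k x].
Proof.
elim: s a => [|b s IH] a /=.
  by move=> _ ax; left; split=> // k; rewrite /blended/= addr0.
move=> /andP[ab bs] ax; have [xb|bx] := leP x b.
  right; exists a, b; rewrite !inE !eqxx ax xb ?orbT; split=> //; split.
    move=> y; rewrite !inE => /or3P[/eqP->|/eqP->|ys]; rewrite ?lexx ?orbT//.
    by rewrite (ltW (allP (order_path_min lt_trans bs) _ ys)) orbT.
  by move=> k; rewrite /blended/= blends_left// addr0.
have E k : blended a (b :: s) k x = blended b s k x.
  rewrite /blended/= blend_right ?(ltW bx)// addrA; congr (_ + _).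
  by rewrite -hornerD -derivnD addrC subrK.
have [[lx H]|[c [d [cs ds cd cxd [cons H]]]]] := IH b bs (ltW bx).
  by left; split => // k; rewrite E.
right; exists c, d; rewrite in_cons cs in_cons ds !orbT; split=> //; split.
  move=> y; rewrite in_cons => /predU1P[->|/cons//].
  apply/orP; left; rewrite (le_trans (ltW ab))//.
  move: cs; rewrite in_cons => /predU1P[->//|cs].
  exact/ltW/(allP (order_path_min lt_trans bs)).
by move=> k; rewrite E.
Qed.

Lemma blended_node a s y k : path <%R a s -> y \in a :: s ->
  blended a s k y = (Q y)^`(k).[y].
Proof.
elim: s a => [|b s IH] a /=.
  by move=> _; rewrite inE => /eqP ->; rewrite /blended addr0.
move=> /andP[ab bs]; rewrite in_cons => /predU1P[->|ys].
  by rewrite /blended blends_left ?addr0//= ab.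
rewrite -(IH b)// /blended/= blend_right//; last first.
  move: ys; rewrite in_cons => /predU1P[->//|ys].
  exact/ltW/(allP (order_path_min lt_trans bs)).
by rewrite addrA; congr (_ + _); rewrite -hornerD -derivnD addrC subrK.
Qed.

(** Each derivative that falls on the step costs a factor 1/(b - a), and the jump
    Q b - Q a has the matching power of b - a to spare. *)
Lemma blend_bound m a b k x C M : (k <= m)%N -> a < b -> b - a <= 1 ->
  0 <= C -> (forall j y, (j <= m)%N -> `|psi j y| <= M) ->
  (forall i, `|(Q b - Q a)^`(i).[x]| <= C * (b - a) ^+ (m - i)) ->
  `|blend a b k x| <= 2 ^+ m * (C * M).
Proof.
move=> km ab ba1 C0 HM HD; rewrite /blend /jet_mul.
have h0 : 0 < b - a by rewrite subr_gt0.
have M0 : 0 <= M by exact: le_trans (HM 0%N 0 isT).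
apply: (@le_trans _ _ (\sum_(i < k.+1) 'C(k, i)%:R * (C * M))).
  apply: le_trans (ler_norm_sum _ _ _) _; apply: ler_sum => i _.
  rewrite normrM normr_nat ler_wpM2l// !normrM.
  have ik : (i <= k)%N by rewrite -ltnS.
  apply: (@le_trans _ _ ((C * (b - a) ^+ (m - i)) * (M * (b - a)^-1 ^+ (k - i)))).
    rewrite ler_pM ?mulr_ge0//.
    rewrite ler_pM//; first by rewrite HM// (leq_trans (leq_subr _ _)).
    by rewrite normrX gtr0_norm// invr_gt0.
  rewrite mulrACA -[leRHS]mulr1 ler_wpM2l ?mulr_ge0//.
  have -> : (m - i = (k - i) + (m - k))%N.
    by rewrite addnC addnBA// subnK.
  rewrite exprD mulrAC -exprMn mulfV ?gt_eqF// expr1n mul1r.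
  by rewrite exprn_ile1// ltW.
rewrite -mulr_suml ler_wpM2r ?mulr_ge0//.
rewrite -natr_sum -(@ler_nat R) in km *; rewrite ler_nat in km.
have -> : (\sum_(i < k.+1) 'C(k, i) = 2 ^ k)%N.
  have := expnDn 1 1 k; rewrite addn1 => ->; apply: eq_bigr => i _.
  by rewrite !exp1n !muln1.
by rewrite natrX ler_weXn2l// ler1n.
Qed.

End Blending.

(** * Extension from a finite set *)

(** H bounds every quotient of which the functions f#_k (x), k <= m, are suprema. *)
Definition sharp_bound {R : realType} m (E : set R) (f : R -> R) (x H : R) :=
  forall k T, (k <= m)%N -> admissible k E x T ->
    sharp_weight m k x T * `|divided_difference f T| <= H.

Lemma leq_4S m : (0 < m)%N -> (4 * m.+1 <= 8 * m)%N.
Proof. lia. Qed.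

Section FiniteExtension.
Local Open Scope fset_scope.
Local Open Scope ring_scope.
Context {R : realType}.
Variables (m : nat) (m0 : (0 < m)%N) (E : {fset R}) (f : R -> R).
Implicit Types (a b c x y e z H : R) (T : {fset R}).

(** Small enough for m steps of length 2 mesh, and the points that they connect,
    to stay within the distance 1 that the sharp maximal functions can see. *)
Definition mesh : R := (8 * m)%:R^-1.

Lemma mesh_gt0 : 0 < mesh.
Proof. by rewrite invr_gt0 ltr0n muln_gt0. Qed.

Lemma mesh_m n : (n <= 8 * m)%N -> n%:R * mesh <= 1.
Proof. by move=> nm; rewrite ler_pdivrMr ?mul1r ?ler_nat// ltr0n muln_gt0. Qed.

(** Nodes at distance mesh from E, where the extension is made to vanish: they
    confine it to a neighbourhood of E and leave no gap longer than 2 mesh next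
    to a point of E. *)
Definition zero_nodes : {fset R} :=
  [fset z in [fset e + mesh | e in E] `|` [fset e - mesh | e in E] |
    all (fun e => mesh <= `|z - e|) E].

Definition nodes : seq R := sort <=%R (E `|` zero_nodes).

(** The polynomial of a node of E interpolates f on the cluster of that node, which
    has at most m points; the other nodes get 0. *)
Definition local_poly y : {poly R} :=
  if y \in E then interp_poly f (prim_cluster E (2 * mesh) m.-1 y) else 0.

Lemma mem_nodes y : (y \in nodes) = (y \in E) || (y \in zero_nodes).
Proof. by rewrite mem_sort in_fsetU. Qed.

Lemma zero_node_dist e z : e \in E -> z \in zero_nodes -> mesh <= `|z - e|.
Proof. by move=> eE; rewrite !inE => /andP[_ /allP]; apply. Qed.

Lemma next_node e : e \in E -> exists2 z, z \in nodes & e < z <= e + 2 * mesh.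
Proof.
move=> eE; have h := mesh_gt0.
have [H|/allPn[e' e'E]] := boolP (all (fun e' => mesh <= `|e + mesh - e'|) E).
  exists (e + mesh); last by apply/andP; split; lra.
  rewrite mem_nodes !inE H andbT; apply/orP; right; apply/orP; left.
  by apply/imfsetP; exists e.
rewrite -ltNge ltr_norml => /andP[h1 h2]; exists e'; first by rewrite mem_nodes e'E.
by apply/andP; split; lra.
Qed.

Lemma prev_node e : e \in E -> exists2 z, z \in nodes & e - 2 * mesh <= z < e.
Proof.
move=> eE; have h := mesh_gt0.
have [H|/allPn[e' e'E]] := boolP (all (fun e' => mesh <= `|e - mesh - e'|) E).
  exists (e - mesh); last by apply/andP; split; lra.
  rewrite mem_nodes !inE H andbT; apply/orP; right; apply/orP; right.
  by apply/imfsetP; exists e.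
rewrite -ltNge ltr_norml => /andP[h1 h2]; exists e'; first by rewrite mem_nodes e'E.
by apply/andP; split; lra.
Qed.

Lemma size_local_poly y : (size (local_poly y) <= m)%N.
Proof.
rewrite /local_poly; case: ifP => _; last by rewrite size_poly0.
by rewrite (leq_trans (size_interp_poly _ _))// (leq_trans (card_prim_cluster _ _ _ _))// prednK.
Qed.

Lemma admissible_of_dist x r T k : 0 <= r -> 2 * r <= 1 -> T `<=` E -> #|` T| = k.+1 ->
  (forall y, y \in T -> `|x - y| <= r) ->
  diam ([set` T] `|` [set x])%classic <= 2 * r /\ admissible k [set` E] x T.
Proof.
move=> r0 r1 TE cT xT.
have D : diam ([set` T] `|` [set x])%classic <= 2 * r.
  apply: diam_le; first by exists x; right.
  have h a : ([set` T] `|` [set x])%classic a -> `|x - a| <= r.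
    by case=> [/xT//|->]; rewrite subrr normr0.
  move=> a b /h xa /h xb; rewrite (le_trans (ler_distD x _ _))// mulr2n mulrDl mul1r lerD//.
  by rewrite distrC.
split=> //; split => //; last exact: le_trans D r1.
by move=> y /= yT; exact: (fsubsetP TE).
Qed.

(** All the divided differences of order below m over the cluster are admissible
    at x, because the cluster stays near x. *)
Lemma local_poly_bound x y H i : sharp_bound m [set` E] f x H ->
  `|x - y| <= 2 * mesh -> 0 <= H ->
  `|((local_poly y)^`(i)).[x]| <= (m * m`!)%:R * H.
Proof.
move=> xH xy H0; rewrite /local_poly; case: ifPn => yE; last first.
  by rewrite linear0 horner0 normr0 mulr_ge0.
have h := mesh_gt0.
have d0 : 0 <= 2 * mesh by rewrite mulr_ge0// ltW.
set S := prim_cluster _ _ _ _.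
have cS : (#|` S| <= m)%N by rewrite (leq_trans (card_prim_cluster _ _ _ _))// prednK.
have xS z : z \in S -> `|x - z| <= 2^-1.
  move=> /(prim_cluster_dist d0) yz.
  rewrite (le_trans (ler_distD y _ _))// (le_trans (lerD xy yz))//.
  rewrite -[X in X + _]mul1r -mulrDl nat1r prednK//.
  have := @mesh_m (m * 4); rewrite mulnC leq_mul2r orbT => /(_ isT); rewrite natrM; lra.
apply: le_trans (@interp_poly_bound _ f S i x H _ _) _.
- by move=> z /xS; lra.
- move=> T TS T0; have [k cT] : exists k, #|` T| = k.+1.
    by exists #|` T|.-1; rewrite prednK.
  have TE : T `<=` E by rewrite (fsubset_trans TS)// prim_cluster_sub.
  have km : (k < m)%N by rewrite -cT (leq_trans (fsubset_leq_card TS)).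
  have [| | |_ adm] := @admissible_of_dist x 2^-1 T k _ _ TE cT.
  - by lra.
  - by lra.
  - by move=> z zT; apply: xS; exact: (fsubsetP TS).
  - by have := xH k T (ltnW km) adm; rewrite /sharp_weight km mul1r.
- by rewrite ler_wpM2r// ler_nat leq_mul// leq_fact.
Qed.

(** Either the clusters agree and there is no jump, or they are full and their
    m+1 point subsets of diameter O(b - a) are admissible at x; the weight in
    f#_m then gives |Delta^m f [T]| diam T = O(b - a) H, and the exchange bound
    applies. *)
Lemma local_poly_jump x a b H i : sharp_bound m [set` E] f x H -> 0 <= H ->
  a \in E -> b \in E -> a < b -> b - a <= 2 * mesh -> a <= x <= b -> (i < m)%N ->
  `|((local_poly b - local_poly a)^`(i)).[x]| <=
  (2 * m * m`! * m.+1 ^ m)%:R * H * (b - a) ^+ (m - i).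
Proof.
move=> xH H0 aE bE ab ba /andP[ax xb] im; rewrite /local_poly aE bE.
have h0 : 0 <= b - a by rewrite subr_ge0 ltW.
have hab : `|b - a| <= b - a by rewrite ger0_norm.
have [->|[cb ca D]] := @prim_cluster_dichotomy _ E (2 * mesh) (b - a) m.-1 b a h0 ba bE aE hab.
  by rewrite subrr linear0 horner0 normr0 !mulr_ge0// exprn_ge0.
rewrite prednK// in cb ca D.
set A := prim_cluster _ _ _ b in cb D *; set B := prim_cluster _ _ _ a in ca D *.
pose r := m.+1%:R * (b - a).
have r0 : 0 <= r by rewrite mulr_ge0.
have r1 : 2 * r <= 1.
  have := mesh_m (leq_4S m0).
  rewrite natrM -mulrA => /(le_trans _); apply; rewrite /r.
  have -> : 4 * (m.+1%:R * mesh) = 2 * (m.+1%:R * (2 * mesh)) by ring.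
  by rewrite ler_wpM2l// ler_wpM2l.
have xAB z : z \in A `|` B -> `|x - z| <= r.
  move=> /D[_ az]; rewrite (le_trans (ler_distD a _ _))// /r -nat1r mulrDl mul1r lerD//.
  by rewrite ger0_norm ?subr_ge0// lerD2r.
have sAB : A `|` B `<=` E by rewrite fsubUset !prim_cluster_sub.
have := @interp_poly_exchange_bound _ f A B i x r (2 * r * H).
rewrite cb ca => /(_ erefl im r0 xAB) HH.
apply: le_trans (HH _) _.
  move=> T u v TAB cT uT vT.
  have TE := fsubset_trans TAB sAB.
  have [|dT adm] := @admissible_of_dist x r T m r0 r1 TE cT.
    by move=> z zT; apply: xAB; exact: (fsubsetP TAB).
  have := xH m T (leqnn _) adm; rewrite /sharp_weight ltnn.
  set d1 := diam [set` T]; set d2 := diam _ => Hd.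
  have [->|uv] := eqVneq u v; first by rewrite subrr normr0 mulr0 !mulr_ge0.
  have uv1 : `|u - v| <= d1 by exact: dist_le_diam.
  have uv2 : `|u - v| <= d2 by exact: diam_ge.
  have d2_gt0 : 0 < d2 by rewrite (lt_le_trans _ uv2)// normr_gt0 subr_eq0.
  rewrite (@le_trans _ _ (d2 * H))//; last by rewrite ler_wpM2r.
  apply: (@le_trans _ _ (d2 * (d1 / d2 * `|divided_difference f T|))).
    rewrite [d1 / d2]mulrC !mulrA mulfV ?gt_eqF// mul1r mulrC ler_wpM2r//.
  by rewrite ler_wpM2l// ltW.
have -> : 2 * r * H * r ^+ (m.-1 - i) = 2 * H * r ^+ (m - i).
  have -> : (m - i = (m.-1 - i).+1)%N by rewrite -subSn ?prednK// -ltnS prednK.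
  by rewrite exprS; ring.
rewrite /r exprMn !mulrA ler_wpM2r ?exprn_ge0//.
rewrite -[leLHS]mulrA [H * _]mulrC !mulrA ler_wpM2r//.
rewrite -(@natrX R) -(natrM _ _ 2) -natrM ler_nat.
have h1 : (#|` A `\` B| <= m)%N by rewrite -cb fsubset_leq_card// fsubsetDl.
have h2 : (m.+1 ^ (m - i) <= m.+1 ^ m)%N by rewrite leq_pexp2l// leq_subr.
rewrite leq_mul//.
by rewrite mulnC -mulnA leq_mul2l /= leq_mul2r h1 orbT.
Qed.

End FiniteExtension.

(** The constant depends neither on the number of points nor on their spacing, and
    the bound holds at each point separately: both are what allows the passage to
    infinite sets and to arbitrary p. *)
Lemma finite_extension (R : realType) (m : nat) : (0 < m)%N ->
  exists2 C : R, 0 < C & forall (E : {fset R}) (f : R -> R),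
  exists u, [/\ jet u, forall x, x \in E -> u 0%N x = f x &
    forall x H, 0 <= H -> sharp_bound m [set` E] f x H ->
      forall k, (k <= m)%N -> `|u k x| <= C * H].
Proof.
move=> m0.
have [psi [jpsi psi0 psi1 psi' [bpsi _]]] := @smooth_step R.
have [M HM] : exists M, forall j y, (j <= m)%N -> `|psi j y| <= M.
  have [B HB] := choice bpsi.
  exists (\sum_(j < m.+1) B j) => j y jm.
  rewrite (bigD1 (Ordinal (jm : (j < m.+1)%N)))//= (le_trans (HB j y))// lerDl.
  by rewrite sumr_ge0// => i _; exact: le_trans (normr_ge0 _) (HB i 0).
have M0 : 0 <= M by exact: le_trans (normr_ge0 _) (HM 0%N 0 isT).
have h := @mesh_gt0 R m m0.
pose C0 : R := (m * m`!)%:R.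
(* The second term serves a transition between a point of E and a zero node:
   there the jump is only O(H), but the length of the interval is at least
   mesh. *)
pose C1 : R := (2 * m * m`! * m.+1 ^ m)%:R + C0 * @mesh R m ^- m.
have C00 : 0 <= C0 by rewrite /C0.
have C01 : 0 <= C1 by rewrite addr_ge0// mulr_ge0// invr_ge0 exprn_ge0// ltW.
have C2 : 0 <= 2 ^+ m * (C1 * M) by rewrite mulr_ge0 ?exprn_ge0// mulr_ge0.
exists (C0 + 2 ^+ m * (C1 * M) + 1); first by rewrite ltr_wpDl// addr_ge0.
move=> E f; pose Q := @local_poly R m E f; pose N := @nodes R m E.
have mN y : (y \in N) = (y \in E) || (y \in @zero_nodes R m E) by exact: mem_nodes.
have pN : sorted <%R N.
  by rewrite lt_sorted_uniq_le sort_le_sorted sort_uniq fset_uniq.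
move Ns : N pN mN => [|a s] /= pN mN.
  exists (fun _ _ => 0); split => //.
  - by move=> k x; exact: is_derive_cst.
  - by move=> x xE; have := mN x; rewrite xE in_nil.
  - by move=> x H H0 _ k _; rewrite normr0 mulr_ge0// !addr_ge0.
pose u := blended psi Q a s.
have nextN e : e \in E -> exists2 z, z \in a :: s & e < z <= e + 2 * mesh m.
  by move=> eE; rewrite -Ns; exact: next_node.
have prevN e : e \in E -> exists2 z, z \in a :: s & e - 2 * mesh m <= z < e.
  by move=> eE; rewrite -Ns; exact: prev_node.
have Qout y : y \notin E -> Q y = 0 by rewrite /Q /local_poly => /negbTE ->.
have aE : a \notin E.
  apply/negP => /prevN[z]; rewrite in_cons => /predU1P[->|zs]; first by rewrite ltxx andbF.
  by rewrite ltNge (ltW (allP (order_path_min lt_trans pN) _ zs)) andbF.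
have maxN y : y \in a :: s -> y <= last a s.
  by move=> yN; exact: path_le_last.
have lE : last a s \notin E.
  apply/negP => /nextN[z] /maxN h1 /andP[h2 _]; by have := lt_le_trans h2 h1; rewrite ltxx.
exists u; split.
- exact: jet_blended.
- move=> x xE; rewrite /u (blended_node Q psi0 psi1 psi')// ?mN ?xE// derivn0.
  by rewrite /Q /local_poly xE interp_poly_interp// prim_cluster_self.
move=> x H H0 xH k km.
have CH : 0 <= (C0 + 2 ^+ m * (C1 * M) + 1) * H by rewrite mulr_ge0// !addr_ge0.
have [xa|ax] := leP x a.
  by rewrite /u /blended blends_left// addr0 Qout// linear0 horner0 normr0.
rewrite /u.
have [[_ ->]|[b [c [bN cN bc bxc [cons ->]]]]] :=
  blended_cases Q psi0 psi1 psi' pN (ltW ax).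
  by rewrite Qout// linear0 horner0 normr0.
have h0 : 0 < c - b by rewrite subr_gt0.
have [/andP[bE cE]|BC] := boolP ((b \notin E) && (c \notin E)).
  rewrite /blend /jet_mul !Qout// subrr linear0 horner0 add0r big1 ?normr0// => i _.
  by rewrite linear0 horner0 mul0r mulr0.
have cb2 : c - b <= 2 * mesh m.
  have [/nextN[z zN /andP[bz zb]]|bE] := boolP (b \in E).
    by have := cons z zN; rewrite leNgt bz/=; lra.
  have /prevN[z zN /andP[cz zc]] : c \in E by move: BC; rewrite bE/= negbK.
  by have := cons z zN; rewrite [c <= z]leNgt zc orbF; lra.
have mesh1 : 2 * @mesh R m <= 1 by apply: mesh_m => //; rewrite (leq_trans _ (leq_pmulr 8 m0)).
have bound y i : b <= y <= c -> `|(Q y)^`(i).[x]| <= C0 * H.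
  move=> byc; apply: local_poly_bound => //; rewrite (le_trans _ cb2)//.
  by move: byc bxc => /andP[? ?] /andP[? ?]; rewrite ler_norml; apply/andP; split; lra.
have jump i : `|(Q c - Q b)^`(i).[x]| <= C1 * H * (c - b) ^+ (m - i).
  have R0 : 0 <= C1 * H * (c - b) ^+ (m - i) by rewrite !mulr_ge0// exprn_ge0// ltW.
  have [mi|im] := leqP m i.
    rewrite derivn_size0 ?horner0 ?normr0//.
    rewrite (leq_trans (size_polyD _ _))// geq_max size_polyN.
    by rewrite !(leq_trans (size_local_poly _ _ _ _) mi).
  (* A zero node is at distance at least mesh from E, so powers of c - b are
     bounded below. *)
  have far : mesh m <= c - b -> C0 * H <= C1 * H * (c - b) ^+ (m - i).
    move=> mcb; apply: (@le_trans _ _ (C0 * mesh m ^- m * H * (c - b) ^+ (m - i))).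
      rewrite -[leLHS]mulr1 -!mulrA ler_wpM2l// mulrCA ler_wpM2l//.
      rewrite -ler_pdivrMl ?invr_gt0 ?exprn_gt0// invrK mulr1.
      apply: (@le_trans _ _ (mesh m ^+ (m - i))); last by rewrite lerXn2r ?nnegrE ?(ltW h) ?(ltW h0).
      by rewrite ler_wiXn2l ?(ltW h) ?leq_subr//; lra.
    by rewrite ler_wpM2r ?exprn_ge0 ?(ltW h0)// ler_wpM2r// /C1 lerDr.
  have [bE|bE] := boolP (b \in E); have [cE|cE] := boolP (c \in E).
  - apply: le_trans (local_poly_jump m0 xH H0 bE cE bc cb2 bxc im) _.
    rewrite ler_wpM2r ?exprn_ge0 ?(ltW h0)// ler_wpM2r// /C1 lerDl.
    by rewrite mulr_ge0// invr_ge0 exprn_ge0// ltW.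
  - rewrite (Qout c)// sub0r derivnN hornerN normrN (le_trans (bound b i _)) ?lexx ?(ltW bc)//.
    apply: far; move: cN; rewrite mN (negbTE cE)/= => /(zero_node_dist bE).
    by rewrite gtr0_norm.
  - rewrite (Qout b)// subr0 (le_trans (bound c i _)) ?lexx ?(ltW bc)//.
    apply: far; move: bN; rewrite mN (negbTE bE)/= => /(zero_node_dist cE).
    by rewrite distrC gtr0_norm.
  - by move: BC; rewrite bE cE.
rewrite (le_trans (ler_normD _ _))// -addrA mulrDl lerD ?bound ?lexx ?(ltW bc)//.
apply: (le_trans (blend_bound km bc (le_trans cb2 mesh1) _ HM jump)).
  by rewrite mulr_ge0.
rewrite [leRHS]mulrDl mul1r ler_wpDr// le_eqVlt; apply/orP; left; apply/eqP.
by ring.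
Qed.

(** * Indefinite integrals *)

Section Primitives.
Context {R : realType}.
Local Notation mu := (@lebesgue_measure R).
Implicit Types (u g h : R -> R) (a b x : R).

(** u is an indefinite integral of g, in a form that does not single out a base
    point. *)
Definition primitive u g := forall a b, a <= b ->
  (\int[mu]_(x in `[a, b]) (g x)%:E = (u b - u a)%:E)%E.

Lemma locally_integrable_itv g a b : locally_integrable setT g ->
  mu.-integrable `[a, b] (EFin \o g).
Proof.
move=> [mg _ lg]; apply/integrableP; split.
  by apply/measurable_EFinP; exact: measurable_funTS.
by apply: lg => //; exact: segment_compact.
Qed.

Lemma integrable_itv_continuous g a b : continuous g ->
  mu.-integrable `[a, b] (EFin \o g).
Proof.
move=> cg; apply: continuous_compact_integrable; first exact: segment_compact.
exact: continuous_subspaceT.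
Qed.

Lemma continuous_locally_integrable g : continuous g -> locally_integrable setT g.
Proof.
move=> cg; split; [exact: continuous_measurable_fun|exact: openT|].
move=> K _ cK; have /integrableP[] := @continuous_compact_integrable _ _ _ cK
  (continuous_subspaceT cg).
by [].
Qed.

Lemma patch_itv_out h a b : (forall x, ~~ (a <= x <= b) -> h x = 0) ->
  EFin \o h = (EFin \o h) \_ `[a, b].
Proof.
move=> h0; apply/funext => x; rewrite patchE; case: ifPn => // /negP.
by rewrite inE/= in_itv/= => /negP xab; rewrite h0.
Qed.

Lemma integrable_itv_out h a b : (forall x, ~~ (a <= x <= b) -> h x = 0) ->
  mu.-integrable `[a, b] (EFin \o h) -> mu.-integrable setT (EFin \o h).
Proof.
by move=> h0 ih; rewrite (patch_itv_out h0); apply/integrable_restrict; rewrite ?setTI.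
Qed.

Lemma integral_itv_out h a b : (forall x, ~~ (a <= x <= b) -> h x = 0) ->
  (\int[mu]_x (h x)%:E = \int[mu]_(x in `[a, b]) (h x)%:E)%E.
Proof.
move=> h0; rewrite [RHS]integral_mkcond.
by apply: eq_integral => x _; rewrite -[LHS]/((EFin \o h) x) (patch_itv_out h0).
Qed.

Lemma derive_primitive u g : (forall x, is_derive x (1 : R) u (g x)) ->
  continuous g -> primitive u g.
Proof.
move=> du cg a b; rewrite le_eqVlt => /predU1P[->|ab].
  by rewrite subrr set_itv1 integral_set1.
have cu : continuous u.
  move=> x; apply/differentiable_continuous/derivable1_diffP.
  by have [] := du x.
rewrite (@continuous_FTC2 _ g u)//.
- exact: continuous_subspaceT.
- split.
  + by move=> x _; have [] := du x.
  + by apply: cvg_at_right_filter; exact: cu.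
  + by apply: cvg_at_left_filter; exact: cu.
- by move=> x _; rewrite derive1E; have /@derive_val := du x.
Qed.

Lemma primitive_le_abs u g a b : locally_integrable setT g -> primitive u g ->
  a <= b -> (`|u b - u a|%:E <= \int[mu]_(x in `[a, b]) `|g x|%:E)%E.
Proof.
move=> lg ug ab; rewrite -abse_EFin -ug//.
apply: (le_trans (le_abse_integral _ _ _)) => //.
by have /integrableP[] := locally_integrable_itv a b lg.
Qed.

Lemma nicely_shrinking_right x : nicely_shrinking x (fun n => `[x, x + n.+1%:R^-1[%classic).
Proof.
split=> [n|]; first exact: measurable_itv.
have d0 n : 0 < n.+1%:R^-1 :> R by rewrite invr_gt0.
exists (2, fun n => PosNum (d0 n)); split => //=.
- exact: cvg_harmonic.
- move=> n z /=; rewrite in_itv/= /ball/= ltr_distlC => /andP[xz ->].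
  by rewrite (lt_le_trans _ xz)// ltrBlDr ltrDl.
- move=> n; rewrite (lebesgue_measure_ball _ (ltW _))// lebesgue_measure_itv/=.
  rewrite lte_fin ltrDl d0 -EFinD addrC addKr -EFinM lee_fin.
  by rewrite mulr_natl.
Qed.

(** Differentiate both sides at a common Lebesgue point. *)
Lemma primitive_ae_le u g G : locally_integrable setT g ->
  locally_integrable setT G -> primitive u g ->
  (forall a b, a <= b -> (`|u b - u a|%:E <= \int[mu]_(x in `[a, b]) (G x)%:E)%E) ->
  {ae mu, forall x, `|g x| <= G x}.
Proof.
move=> lg lG ug uG.
have aeF := ae_filter_ringOfSetsType mu.
apply: (filterS2 _ _ (lebesgue_differentiation lg) (lebesgue_differentiation lG)).
move=> x xg xG.
have cg := nice_lebesgue_differentiation nicely_shrinking_right lg xg.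
have cG := nice_lebesgue_differentiation nicely_shrinking_right lG xG.
rewrite -lee_fin -abse_EFin.
apply: (lee_cvg_to (cvg_abse cg) cG).
apply: nearW => n /=; rewrite abseM.
have d0 : 0 < n.+1%:R^-1 :> R by rewrite invr_gt0.
have mE : mu `[x, (x + n.+1%:R^-1)[ = (n.+1%:R^-1)%:E.
  by rewrite lebesgue_measure_itv/= lte_fin ltrDl d0 -EFinD addrC addKr.
rewrite mE inver gt_eqF// gee0_abs ?lee_fin ?invr_ge0 ?(ltW d0)//.
rewrite lee_wpmul2l ?lee_fin ?invr_ge0 ?(ltW d0)//.
rewrite !integral_itv_bndo_bndc; last 2 first.
- by case: lG => /measurable_EFinP mG _ _; exact: measurable_funS mG.
- by case: lg => /measurable_EFinP mg _ _; exact: measurable_funS mg.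
have xd : x <= x + n.+1%:R^-1 by rewrite lerDl ltW.
by rewrite ug// abse_EFin uG.
Qed.

End Primitives.

(** * Weak derivatives are densities of increments *)

Section WeakDerivative.
Context {R : realType}.
Local Notation mu := (@lebesgue_measure R).
Implicit Types (u g : R -> R) (a b x : R).
Variable psi : nat -> R -> R.
Hypothesis jpsi : jet psi.
Hypothesis psi0 : forall x, x <= 0 -> psi 0%N x = 0.
Hypothesis psi1 : forall x, 1 <= x -> psi 0%N x = 1.
Hypothesis psi' : forall k x, (x <= 0) || (1 <= x) -> psi k.+1 x = 0.
Hypothesis bpsi : forall k, exists M, forall x, `|psi k x| <= M.
Hypothesis psi1_ge0 : forall x, 0 <= psi 1%N x.

(** The step compressed to the interval [a, a + 1/(n+1)]. *)
Definition step_at a n k x : R := psi k (n.+1%:R * (x - a)) * n.+1%:R ^+ k.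

Lemma jet_step_at a n : jet (step_at a n).
Proof. exact: jet_affine. Qed.

Lemma step_at_out a n k x : ~~ (a <= x <= a + n.+1%:R^-1) -> step_at a n k.+1 x = 0.
Proof.
move=> xa; rewrite /step_at psi' ?mul0r//; move: xa.
rewrite negb_and -!ltNge => /orP[xa|ax]; apply/orP; [left|right].
  by rewrite mulr_ge0_le0// subr_le0 ltW.
by rewrite mulrC -ler_pdivrMr// mul1r lerBrDl ltW.
Qed.

Lemma integrable_step u a n k : continuous u ->
  mu.-integrable setT (EFin \o (fun x => u x * step_at a n k.+1 x)).
Proof.
move=> cu; apply: (@integrable_itv_out _ _ a (a + n.+1%:R^-1)).
  by move=> x xa; rewrite step_at_out// mulr0.
apply: integrable_itv_continuous => x.
by apply: cvgM; [exact: cu|exact: jet_continuous (jet_step_at _ _) _].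
Qed.

(** The derivatives of the steps at a have integral one and support shrinking to
    the point a, so they form an approximate identity. *)
Lemma step_mollify u a : continuous u ->
  (\int[mu]_x (u x * step_at a n 1%N x)%:E)%E @[n --> \oo] --> (u a)%:E.
Proof.
move=> cu.
have fin n : (\int[mu]_x (u x * step_at a n 1%N x)%:E)%E \is a fin_num.
  exact/integrable_fin_num/(integrable_step _ _ _ cu).
apply/fine_cvgP; split; first exact: nearW.
apply/cvgrPdist_le => /= e e0.
have /cvgrPdist_le/(_ e e0)[d /= d0 hd] := cu a.
near=> n.
have nd : n.+1%:R^-1 < d by near: n; exact: near_infty_natSinv_lt (PosNum d0).
have n0 : 0 < n.+1%:R^-1 :> R by rewrite invr_gt0.
pose b := a + n.+1%:R^-1.
have ab : a <= b by rewrite lerDl ltW.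
have ik (v : R -> R) : continuous v -> mu.-integrable `[a, b] (EFin \o (fun x => v x * step_at a n 1%N x)).
  move=> cv; apply: integrable_itv_continuous => x.
  by apply: cvgM; [exact: cv|exact: jet_continuous (jet_step_at _ _) _].
have I1 c : (\int[mu]_(x in `[a, b]) (c * step_at a n 1%N x)%:E = c%:E)%E.
  have := @integralZl _ _ _ mu _ (measurable_itv `[a, b]) (EFin \o step_at a n 1%N) _ c.
  rewrite /= => ->; last first.
    by apply: integrable_itv_continuous => x; exact: jet_continuous (jet_step_at _ _) _.
  rewrite (derive_primitive (jet_step_at a n 0%N) (jet_continuous (jet_step_at a n)))//.
  rewrite /step_at subrr mulr0 (psi0 (lexx _)) /b [a + _]addrC addrK mulfV//.
  rewrite (psi1 (lexx _)) mul0r subr0 mul1r expr0.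
  by rewrite mule1.
have bnd x : a <= x <= b -> `|u a - u x| <= e.
  move=> /andP[ax xb]; apply: hd => /=; rewrite distrC ger0_norm ?subr_ge0//.
  by rewrite ltrBlDl (le_lt_trans xb)// ltrD2l.
have s0 x : 0 <= step_at a n 1%N x by rewrite /step_at mulr_ge0.
have E : (\int[mu]_x (u x * step_at a n 1%N x)%:E =
    \int[mu]_(x in `[a, b]) (u x * step_at a n 1%N x)%:E)%E.
  by apply: integral_itv_out => x xa; rewrite step_at_out// mulr0.
rewrite ler_distlC -!lee_fin fineK// E; apply/andP; split.
  rewrite -(I1 (u a - e)); apply: le_integral => //.
  - exact: (ik (cst (u a - e)) (@cst_continuous _ _ _)).
  - exact: ik.
  - move=> x /=; rewrite inE/= in_itv/= => /bnd; rewrite ler_distl => /andP[h1 h2].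
    by rewrite lee_fin ler_wpM2r// lerBlDr.
rewrite -(I1 (u a + e)); apply: le_integral => //.
- exact: ik.
- exact: (ik (cst (u a + e)) (@cst_continuous _ _ _)).
- move=> x /=; rewrite inE/= in_itv/= => /bnd; rewrite ler_distl => /andP[h1 h2].
  by rewrite lee_fin ler_wpM2r//; lra.
Unshelve. all: by end_near. Qed.

(** A smooth approximation of the indicator of ]a, b]. *)
Definition plateau a b n : R -> R := fun x => step_at a n 0%N x - step_at b n 0%N x.

Lemma plateau_jet a b n : jet (fun k x => step_at a n k x - step_at b n k x).
Proof. by apply: jetB; exact: jet_step_at. Qed.

Lemma plateau_out a b n x : a <= b -> ~~ (a <= x <= b + 1) -> plateau a b n x = 0.
Proof.
move=> ab; rewrite negb_and -!ltNge /plateau /step_at !expr0 !mulr1.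
move=> /orP[xa|bx].
  rewrite !psi0 ?subrr// mulr_ge0_le0// subr_le0 ?ltW//.
  exact: lt_le_trans ab.
have n1 : 1 <= n.+1%:R :> R by rewrite ler1n.
rewrite !psi1 ?subrr//.
  by rewrite -[leLHS]mulr1 ler_pM//; lra.
by rewrite -[leLHS]mulr1 ler_pM//; lra.
Qed.

Lemma test_plateau a b n : a <= b -> test_function (plateau a b n).
Proof.
move=> ab; split.
  move=> k x; rewrite (jet_derive1n k (plateau_jet a b n)).
  exact: jet_derivable (plateau_jet a b n).
exists (`|a| + `|b| + 1) => x xM; apply: plateau_out => //.
apply: contraL xM => /andP[ax xb]; rewrite -leNgt ler_norml.
have h1 := ler_norm b; have h2 := ler_norm (- a); rewrite normrN in h2.
have h3 := normr_ge0 a; have h4 := normr_ge0 b.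
by apply/andP; split; lra.
Qed.

(** Test against plateaus: on one side the approximate identities at a and b give
    u a - u b, on the other dominated convergence gives the integral of g. *)
Lemma weak_derivative_primitive u g : continuous u -> is_weak_derivative u g ->
  primitive u g.
Proof.
move=> cu [_ lg wd] a b ab.
have L : (\int[mu]_x (u x * derive1 (plateau a b n) x)%:E)%E @[n --> \oo] -->
    (u a - u b)%:E.
  have -> : (fun n => \int[mu]_x (u x * derive1 (plateau a b n) x)%:E)%E =
      (fun n => \int[mu]_x (u x * step_at a n 1%N x)%:E -
                \int[mu]_x (u x * step_at b n 1%N x)%:E)%E.
    apply/funext => n; rewrite -integralB//; last 2 first.
    - exact: integrable_step.
    - exact: integrable_step.
    apply: eq_integral => x _; rewrite -[derive1 _]/(derive1n 1 (plateau a b n)).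
    by rewrite (jet_derive1n 1 (plateau_jet a b n)) mulrBr EFinB.
  by rewrite EFinB; apply: cvgeB => //; exact: step_mollify.
have [M HM] := bpsi 0%N.
have M0 : 0 <= M by exact: le_trans (HM 0).
have [mg _ _] := lg.
have D : (\int[mu]_x (g x * plateau a b n x)%:E)%E @[n --> \oo] -->
    (\int[mu]_x ((EFin \o g) \_ `]a, b]) x)%E.
  pose G := fun x => ((2 * M) * `|g x|)%:E.
  have iG : mu.-integrable setT (G \_ `[a, b + 1]).
    apply/integrable_restrict => //; rewrite setTI.
    have := @integrableZl _ _ _ mu _ _ (2 * M) _
      (integrable_abse (locally_integrable_itv a (b + 1) lg)).
    by apply.
  have mplat n : measurable_fun setT (EFin \o (fun x => g x * plateau a b n x)).
    apply/measurable_EFinP; apply: measurable_funM => //.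
    apply: continuous_measurable_fun.
    exact: (jet_continuous (plateau_jet a b n) (k := 0%N)).
  have mlim : measurable_fun setT ((EFin \o g) \_ `]a, b]).
    apply/(measurable_restrictT _ _).1 => //.
    by apply/measurable_EFinP; exact: measurable_funTS.
  have [||_ _] // := @dominated_convergence _ _ _ mu setT measurableT
     (fun n => EFin \o (fun x => g x * plateau a b n x)) ((EFin \o g) \_ `]a, b])
     (G \_ `[a, b + 1]) mplat mlim _ iG _.
  - apply: aeW => x _.
    suff H : exists N, forall n, (N <= n)%N ->
        (g x * plateau a b n x)%:E = ((EFin \o g) \_ `]a, b]) x.
      have [N HN] := H; apply: cvg_near_cst.
      by exists N; [by []|move=> n Nn; exact: HN].
    have pos c : c < x -> exists N, forall n, (N <= n)%N -> step_at c n 0%N x = 1.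
      move=> cx; exists (Num.truncn (x - c)^-1) => n Nn.
      rewrite /step_at expr0 mulr1 psi1// -ler_pdivrMr ?subr_gt0// mul1r.
      by rewrite ltW// (lt_le_trans (truncnS_gt _))// ler_nat ltnS.
    have neg c n : x <= c -> step_at c n 0%N x = 0.
      by move=> xc; rewrite /step_at expr0 mulr1 psi0// mulr_ge0_le0// subr_le0.
    have [xa|ax] := leP x a.
      exists 0%N => n _; rewrite /plateau !neg ?(le_trans xa ab)// subrr mulr0 patchE.
      by rewrite memNset//= in_itv/= ltNge xa.
    have [N1 H1] := pos _ ax; have [xb|bx] := leP x b.
      exists N1 => n nN; rewrite /plateau H1// (neg b)// subr0 mulr1 patchE mem_set//=.
      by rewrite in_itv/= ax xb.
    have [N2 H2] := pos _ bx; exists (N1 + N2)%N => n nN.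
    rewrite /plateau H1 ?H2 ?(leq_trans _ nN) ?leq_addl ?leq_addr// subrr mulr0 patchE.
    by rewrite memNset//= in_itv/= ax leNgt bx.
  - apply: aeW => x n _; rewrite patchE; case: ifPn => [_|/negP].
      rewrite /G/= lee_fin normrM mulrC ler_wpM2r// /plateau /step_at !expr0 !mulr1.
      by rewrite (le_trans (ler_normB _ _))// mulr2n mulrDl mul1r lerD.
    rewrite inE/= in_itv/= => /negP xab.
    by rewrite plateau_out// mulr0 normr0.
have : (\int[mu]_x (g x * plateau a b n x)%:E)%E @[n --> \oo] --> (u b - u a)%:E.
  rewrite -opprB EFinN.
  have -> : (fun n => \int[mu]_x (g x * plateau a b n x)%:E)%E =
      (fun n => - \int[mu]_x (u x * derive1 (plateau a b n) x)%:E)%E.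
    by apply/funext => n; rewrite wd ?oppeK//; exact: test_plateau.
  exact: cvgeN.
move=> /(cvg_unique (@ereal_hausdorff R) D) <-.
rewrite -integral_mkcond/= integral_itv_obnd_cbnd//.
by apply/measurable_EFinP; exact: measurable_funTS.
Qed.

End WeakDerivative.

(** * Densities of increments are weak derivatives *)

Section WeakDerivativeOfPrimitive.
Context {R : realType}.
Local Notation mu := (@lebesgue_measure R).
Implicit Types (u g phi : R -> R) (a b x : R).

Lemma test_function_jet phi : test_function phi -> jet (fun k => derive1n k phi).
Proof.
move=> [dphi _] k x; rewrite derive1nS derive1E; apply: derivableP.
exact: dphi.
Qed.

(** Truncation at x, written as a kernel on the square so that Fubini's theorem
    applies. *)
Lemma primitive_ext a b u g x : primitive u g -> a <= x -> x <= b ->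
  (\int[mu]_t (((EFin \o g) \_ `[a, b]) t * ((t <= x)%R%:R)%:E) = (u x - u a)%:E)%E.
Proof.
move=> ug ax xb; rewrite -ug// [RHS]integral_mkcond; apply: eq_integral => t _.
rewrite !patchE; case: ifPn => [|/negP].
  rewrite inE/= in_itv/= => /andP[at_ tb]; case: ifPn => [|/negP].
    by rewrite inE/= in_itv/= => /andP[_ ->]; rewrite mule1.
  by rewrite inE/= in_itv/= at_/= => /negP/negbTE ->; rewrite mule0.
rewrite inE/= in_itv/= => /negP h; rewrite mul0e; case: ifPn => //.
rewrite inE/= in_itv/= => /andP[at_ tx].
by move: h; rewrite at_/= (le_trans tx xb).
Qed.

Lemma primitive_ext_right a b u g x : primitive u g -> a <= x -> x <= b ->
  (\int[mu]_t (((EFin \o g) \_ `[a, b]) t * ((x <= t)%R%:R)%:E) = (u b - u x)%:E)%E.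
Proof.
move=> ug ax xb; rewrite -ug// [RHS]integral_mkcond; apply: eq_integral => t _.
rewrite !patchE; case: ifPn => [|/negP].
  rewrite inE/= in_itv/= => /andP[at_ tb]; case: ifPn => [|/negP].
    by rewrite inE/= in_itv/= => /andP[-> _]; rewrite mule1.
  by rewrite inE/= in_itv/= tb andbT => /negP/negbTE ->; rewrite mule0.
rewrite inE/= in_itv/= => /negP h; rewrite mul0e; case: ifPn => //.
rewrite inE/= in_itv/= => /andP[xt tb].
by move: h; rewrite (le_trans ax xt) tb.
Qed.

(** Integrate phi'(x) g(t) over the triangle t <= x in both orders. *)
Lemma primitive_weak_derivative u g : continuous u -> locally_integrable setT g ->
  primitive u g -> is_weak_derivative u g.
Proof.
move=> cu lg ug; split => //; first exact: continuous_locally_integrable.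
move=> phi tphi; have jphi := test_function_jet tphi.
have [_ [M HM]] := tphi.
pose b := Num.max M 0 + 1; pose a := - b.
have b0 : 0 < b by rewrite ltr_wpDl// le_max lexx orbT.
have Mb : M < b.
  by rewrite (@le_lt_trans _ _ (Num.max M 0)) ?le_max ?lexx// ltrDl.
have ab : a <= b by rewrite /a; lra.
have out x : ~~ (a < x < b) -> M < `|x|.
  rewrite -ltr_norml -leNgt; exact: lt_le_trans.
have out' x : ~~ (a <= x <= b) -> M < `|x|.
  by rewrite -ler_norml -ltNge; exact: lt_trans.
have phi0 x : ~~ (a <= x <= b) -> phi x = 0 by move=> /out'/HM.
have phia : phi a = 0 by apply: HM; apply: out; rewrite ltxx.
have phib : phi b = 0 by apply: HM; apply: out; rewrite ltxx andbF.
set dphi := derive1 phi.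
have dphi0 x : ~~ (a <= x <= b) -> dphi x = 0.
  move=> /out' Mx; rewrite /dphi derive1E.
  apply: derive_val; apply: (@near_is_derive _ (cst 0)).
  near=> y; rewrite /cst HM//; near: y.
  have cn : {for x, continuous (fun y : R => `|y|)} by apply: norm_continuous.
  exact: (cn _ (lt_nbhsr Mx)).
have cdphi : continuous dphi by exact: (jet_continuous jphi (k := 1%N)).
have pphi : primitive phi dphi.
  exact: (derive_primitive (jphi 0%N) cdphi).
have n01 (c : bool) : (`|(c%:R : R)%:E| <= 1)%E.
  by case: c; rewrite abse_EFin ?normr1 ?normr0 lee_fin.
pose gJ := (EFin \o g) \_ `[a, b]; pose dJ := (EFin \o dphi) \_ `[a, b].
have [mg _ _] := lg.
have mgJ : measurable_fun setT gJ.
  apply/(measurable_restrictT _ _).1 => //.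
  by apply/measurable_EFinP; exact: measurable_funTS.
have mdJ : measurable_fun setT dJ.
  apply/(measurable_restrictT _ _).1 => //.
  by apply/measurable_EFinP; apply: measurable_funTS; exact: continuous_measurable_fun.
have igJ : mu.-integrable setT gJ.
  by apply/integrable_restrict; rewrite ?setTI//; exact: locally_integrable_itv.
have idJ : mu.-integrable setT dJ.
  by apply/integrable_restrict; rewrite ?setTI//; exact: integrable_itv_continuous.
(* The integrand on the triangle, truncated to a square containing the support
   of phi. *)
pose f (z : R * R) : \bar R := (dJ z.1 * (gJ z.2 * ((z.2 <= z.1)%R%:R)%:E))%E.
have mf : measurable_fun setT f.
  apply: emeasurable_funM; first by apply: measurableT_comp.
  apply: emeasurable_funM; first by apply: measurableT_comp.
  apply/measurable_EFinP.
  have -> : (fun z : R * R => (z.2 <= z.1)%R%:R) =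
      (fun z : R * R => if z.2 <= z.1 then 1 else 0 : R).
    by apply/funext => z; case: ifP.
  apply: measurable_fun_ifT => //.
  by apply: measurable_fun_ler.
have if_ : (mu \x mu)%E.-integrable setT f.
  have mf' : measurable_fun [set: measurableTypeR R * measurableTypeR R] f := mf.
  apply/(integrable12ltyP mu mu mf').
  have /integrableP[_ Kg] := igJ; have /integrableP[_ Kd] := idJ.
  have Hx x : (\int[mu]_y `|f (x, y)| <= `|dJ x| * \int[mu]_y `|gJ y|)%E.
    rewrite -ge0_integralZl//; last first.
      by apply: measurableT_comp.
    apply: ge0_le_integral => //.
    - by apply: measurableT_comp => //; apply: measurableT_comp mf _.
    - by apply: measurable_funeM; apply: measurableT_comp.
    - move=> y _; rewrite /f/= !abseM lee_wpmul2l// -[leRHS]mule1 lee_wpmul2l//.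
  apply: (@le_lt_trans _ _ (\int[mu]_x (`|dJ x| * \int[mu]_y `|gJ y|))%E).
    apply: ge0_le_integral => //.
    - by move=> x _; exact: integral_ge0.
    - apply: (measurable_fun_fubini_tonelli_F (m2 := mu) (abse \o f)).
        by apply: measurableT_comp.
      by move=> z; exact: abse_ge0.
    - by apply: emeasurable_funM => //; apply: measurableT_comp.
  rewrite ge0_integralZr//; last 2 first.
  - by apply: measurableT_comp.
  - exact: integral_ge0.
  by rewrite lte_mul_pinfty ?ge0_fin_numE ?integral_ge0.
have := Fubini if_; rewrite /f/=.
have gJ_fin t : gJ t \is a fin_num by rewrite /gJ patchE; case: ifP.
have dJ_fin t : dJ t \is a fin_num by rewrite /dJ patchE; case: ifP.
have il x : mu.-integrable setT (fun y => gJ y * ((y <= x)%R%:R)%:E)%E.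
  apply: (@le_integrable _ _ _ mu _ measurableT _ gJ) => //.
    apply: emeasurable_funM => //; apply/measurable_EFinP.
    have -> : (fun y : R => (y <= x)%R%:R) = (fun y : R => if y <= x then 1 else 0 : R).
      by apply/funext => z; case: ifP.
    apply: measurable_fun_ifT => //.
    by apply: measurable_fun_ler.
  move=> y _; rewrite abseM -[leRHS]mule1 lee_wpmul2l//.
have ir y : mu.-integrable setT (fun x => dJ x * ((y <= x)%R%:R)%:E)%E.
  apply: (@le_integrable _ _ _ mu _ measurableT _ dJ) => //.
    apply: emeasurable_funM => //; apply/measurable_EFinP.
    have -> : (fun x : R => (y <= x)%R%:R) = (fun x : R => if y <= x then 1 else 0 : R).
      by apply/funext => z; case: ifP.
    apply: measurable_fun_ifT => //.
    by apply: measurable_fun_ler.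
  move=> x _; rewrite abseM -[leRHS]mule1 lee_wpmul2l//.
have L x : (\int[mu]_y (dJ x * (gJ y * ((y <= x)%R%:R)%:E)) =
    (((fun x => dphi x * (u x - u a)) : R -> R) x)%:E)%E.
  rewrite -(fineK (dJ_fin x)) integralZl//.
  have [xab|xab] := boolP (a <= x <= b).
    have /andP[ax xb] := xab.
    by rewrite (primitive_ext ug ax xb) fineK// /dJ patchE mem_set//= in_itv.
  by rewrite /dJ patchE memNset/= ?in_itv//= ?mul0e ?dphi0// ?mul0r//; apply/negP.
have Rr y : (\int[mu]_x (dJ x * (gJ y * ((y <= x)%R%:R)%:E)) =
    (((fun y => - (g y * phi y)) : R -> R) y)%:E)%E.
  under eq_integral do rewrite muleCA.
  rewrite -(fineK (gJ_fin y)) integralZl//.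
  have [yab|yab] := boolP (a <= y <= b).
    have /andP[ay yb] := yab.
    rewrite (primitive_ext_right pphi ay yb) fineK// /gJ patchE mem_set//= ?in_itv//=.
    by rewrite phib sub0r -EFinM mulrN.
  by rewrite /gJ patchE memNset/= ?in_itv//= ?mul0e ?phi0// ?mulr0 ?oppr0//; apply/negP.
under eq_integral do rewrite L.
under [X in _ = X -> _]eq_integral do rewrite Rr.
have iud : mu.-integrable setT (EFin \o (fun x => dphi x * u x)).
  apply: (@integrable_itv_out _ _ a b) => [x xab|]; first by rewrite dphi0// mul0r.
  by apply: integrable_itv_continuous => x; apply: cvgM; [exact: cdphi|exact: cu].
have idp : mu.-integrable setT (EFin \o dphi).
  by apply: (@integrable_itv_out _ _ a b) => //; exact: integrable_itv_continuous.
have -> : (\int[mu]_x (dphi x * (u x - u a))%:E = \int[mu]_x (u x * dphi x)%:E)%E.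
  transitivity (\int[mu]_x ((dphi x * u x)%:E - (u a)%:E * (dphi x)%:E))%E.
    by apply: eq_integral => x _; rewrite -EFinM -EFinB mulrBr [dphi x * u a]mulrC.
  rewrite integralB//; last exact: (integrableZl _ _ idp).
  rewrite integralZl// (integral_itv_out dphi0) (pphi _ _ ab) phia phib subrr mule0 sube0.
  by apply: eq_integral => x _; rewrite mulrC.
move=> ->; under eq_integral do rewrite EFinN.
rewrite integralN//; apply: integrable_add_def => //.
apply: (@integrable_itv_out _ _ a b) => [x xab|]; first by rewrite phi0// mulr0.
have cphi : continuous phi by exact: (jet_continuous jphi (k := 0%N)).
have [B HB] := segment_bound (continuous_subspaceT cphi : {within `[a, b], continuous phi}).
have := @integrableZl _ _ _ mu _ _ B _ (integrable_abse (locally_integrable_itv a b lg)).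
move=> H; apply: le_integrable (H _) => //.
  apply/measurable_EFinP; apply: measurable_funTS; apply: measurable_funM => //.
  exact: continuous_measurable_fun.
move=> x /=; rewrite in_itv/= => xab; rewrite lee_fin normrM [B * _]mulrC normrM normr_id.
by rewrite ler_wpM2l// (le_trans (HB _ xab))// ler_norm.
Unshelve. all: by end_near. Qed.

End WeakDerivativeOfPrimitive.

(** * Weak limits of dominated families *)

Section UltraLimits.

(** Along an ultrafilter every bounded real family converges. *)
Lemma ultra_bounded_cvg {R : realType} {I : Type} (F : set_system I) (f : I -> R) (B : R) :
  UltraFilter F -> (forall i, `|f i| <= B) -> cvg (f i @[i --> F]).
Proof.
move=> UF fB; have PF : ProperFilter F := @ultra_proper _ _ UF.
have [|p [_ pcl]] := @segment_compact R (- B) B (f @ F) _.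
  by apply: nearW => i /=; rewrite in_itv/= -ler_norml.
apply/cvg_ex; exists p => U pU.
have [//|H] := in_ultra_setVsetC (f @^-1` U) UF.
have [x [nUx Ux]] : (~` U `&` U) !=set0 by apply: pcl.
by [].
Qed.

Context d (T : measurableType d) {R : realType}.
Variable mu : {sigma_finite_measure set T -> \bar R}.

(** The weak compactness in L1 of a dominated family, in the only form that is
    used.  The limits of the integrals over each set exist by boundedness; the
    dominating function controls the tails uniformly in the index, which makes the
    limit set function countably additive and absolutely continuous, and its
    density is the limit. *)
Lemma ultralimit_density (J : Type) (F : set_system J) (h : J -> T -> R) (G : T -> R) :
  UltraFilter F -> (forall i, mu.-integrable setT (EFin \o h i)) ->
  mu.-integrable setT (EFin \o G) -> (forall x, 0 <= G x) ->
  (forall i, {ae mu, forall x, `|h i x| <= G x}) ->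
  exists2 g : T -> R, mu.-integrable setT (EFin \o g) & forall A, measurable A ->
    fine (\int[mu]_(x in A) (h i x)%:E)%E @[i --> F] -->
    fine (\int[mu]_(x in A) (g x)%:E)%E.
Proof.
move=> UF ih iG G0 hG; have PF : ProperFilter F := @ultra_proper _ _ UF.
pose La A := fine (\int[mu]_(x in A) (G x)%:E)%E.
pose la i A := fine (\int[mu]_(x in A) (h i x)%:E)%E.
have iGA A : measurable A -> mu.-integrable A (EFin \o G).
  by move=> mA; apply: integrableS iG.
have ihA i A : measurable A -> mu.-integrable A (EFin \o h i).
  by move=> mA; apply: integrableS (ih i).
have laLa i A : measurable A -> `|la i A| <= La A.
  move=> mA; rewrite /la /La.
  have f1 : (\int[mu]_(x in A) (h i x)%:E)%E \is a fin_num.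
    exact: (integrable_fin_num _ (ihA i A mA)).
  have f2 : (\int[mu]_(x in A) (G x)%:E)%E \is a fin_num.
    exact: (integrable_fin_num _ (iGA A mA)).
  rewrite -fine_abse// fine_le ?abse_fin_num//.
  apply: (le_trans (le_abse_integral _ _ _)) => //.
    exact: (measurable_int mu (ihA i A mA)).
  apply: ae_ge0_le_integral => //.
  - by apply: measurableT_comp => //; exact: (measurable_int mu (ihA i A mA)).
  - by move=> x _; rewrite lee_fin.
  - exact: (measurable_int mu (iGA A mA)).
  - by apply: filterS (hG i) => x hx _; rewrite abse_EFin lee_fin.
have addP (f : T -> R) A B : mu.-integrable setT (EFin \o f) -> measurable A ->
    measurable B -> [disjoint A & B] ->
    fine (\int[mu]_(x in A `|` B) (f x)%:E)%E =
    fine (\int[mu]_(x in A) (f x)%:E)%E + fine (\int[mu]_(x in B) (f x)%:E)%E.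
  move=> if_ mA mB AB; rewrite integral_setU//; last first.
    by apply: measurable_funTS; exact: (measurable_int mu if_).
  by rewrite fineD//; apply: integrable_fin_num => //; apply: integrableS if_.
pose rest (S : nat -> set T) n := \bigcup_(j in [set j | (n <= j)%N]) S j.
have mrest S n : (forall j, measurable (S j)) -> measurable (rest S n).
  by move=> mS; apply: bigcup_measurable.
have split_rest (f : T -> R) S n : mu.-integrable setT (EFin \o f) ->
    (forall j, measurable (S j)) -> trivIset setT S ->
    fine (\int[mu]_(x in \bigcup_j S j) (f x)%:E)%E =
    \sum_(0 <= j < n) fine (\int[mu]_(x in S j) (f x)%:E)%E +
    fine (\int[mu]_(x in rest S n) (f x)%:E)%E.
  move=> if_ mS tS; elim: n => [|n IH].
    rewrite big_geq// add0r; congr (fine (integral _ _ _)).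
    by apply/seteqP; split=> x [j _ Sj]; exists j.
  rewrite IH big_nat_recr//= -addrA; congr (_ + _).
  have -> : rest S n = S n `|` rest S n.+1.
    apply/seteqP; split=> x.
      move=> [j /=]; rewrite leq_eqVlt => /predU1P[<-|nj] Sj; first by left.
      by right; exists j.
    by move=> [Snx|[j /= nj Sj]]; [exists n => /=|exists j => //=; exact: ltnW].
  apply: addP => //; first exact: mrest.
  apply/disj_setPS => x [Snx [j /= nj Sjx]].
  have nj' := tS n j Logic.I Logic.I (ex_intro _ x (conj Snx Sjx)).
  by rewrite nj' /= ltnn in nj.
(* The limit of the set functions A |-> int_A h_i, which is the charge to be
   differentiated. *)
pose nu A : \bar R := (lim (la i A @[i --> F]))%:E.
have cvgla A : measurable A -> la i A @[i --> F] --> lim (la i A @[i --> F]).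
  move=> mA; have : cvg (la i A @[i --> F]).
    by apply: (@ultra_bounded_cvg _ _ _ _ (La A)) => // i; exact: laLa.
  by [].
have nuLa A : measurable A -> (`|nu A| <= (La A)%:E)%E.
  move=> mA; rewrite /nu abse_EFin lee_fin.
  apply: (cvgr_to_le (cvg_norm (cvgla A mA))).
  by apply: nearW => i; exact: laLa.
have nu0 : nu set0 = 0%E.
  apply/eqP; rewrite -abse_eq0 eq_le abse_ge0 andbT (le_trans (nuLa _ measurable0))//.
  by rewrite /La integral_set0.
have finnu A : measurable A -> nu A \is a fin_num by [].
have snu : semi_sigma_additive nu.
  move=> S mS tS mUS.
  have e0 : (La (\bigcup_j S j) - \sum_(0 <= j < n) La (S j)) @[n --> \oo] --> (0 : R).
    have := @semi_sigma_additive_nng_induced _ _ _ mu (EFin \o G) (measurable_int mu iG) _ S mS tS mUS.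
    rewrite /= => /(_ (fun x => G0 x)) H.
    rewrite -[X in _ --> X](subrr (La (\bigcup_j S j))); apply: cvgB; first exact: cvg_cst.
    have E : (fun n => \sum_(0 <= i < n) \int[mu]_(t in S i) (G t)%:E)%E =
        EFin \o (fun n => \sum_(0 <= j < n) La (S j)).
      apply/funext => n; rewrite /= -sumEFin; apply: eq_bigr => i _.
      by rewrite /La fineK//; apply: integrable_fin_num => //; exact: iGA.
    have E2 : (\int[mu]_(t in \bigcup_n S n) (G t)%:E)%E = (La (\bigcup_j S j))%:E.
      by rewrite /La fineK//; apply: integrable_fin_num => //; exact: iGA.
    rewrite E E2 in H.
    by have /fine_cvgP[_] := H.
  have -> : (fun n => \sum_(0 <= i < n) nu (S i))%E =
      (fun n => (\sum_(0 <= i < n) lim (la k (S i) @[k --> F]))%:E).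
    by apply/funext => n; rewrite -sumEFin.
  apply: cvg_EFin; first exact: nearW.
  rewrite /nu/=; apply/cvgrPdist_le => /= e egt0.
  move/cvgrPdist_le: e0 => /(_ e egt0); apply: filterS => n.
  rewrite sub0r normrN => /(le_trans (ler_norm _)) He; apply: le_trans He.
  have cS : \sum_(0 <= j < n) la i (S j) @[i --> F] -->
      \sum_(0 <= j < n) lim (la k (S j) @[k --> F]).
    elim: (n) => [|k IH].
      rewrite big_geq//.
      have -> : (fun i => \sum_(0 <= j < 0) la i (S j)) = cst 0.
        by apply/funext => i; rewrite big_geq.
      exact: cvg_cst.
    rewrite big_nat_recr//=.
    have -> : (fun i => \sum_(0 <= j < k.+1) la i (S j)) =
        (fun i => \sum_(0 <= j < k) la i (S j) + la i (S k)).
      by apply/funext => i; rewrite big_nat_recr.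
    by apply: cvgD => //; exact: cvgla.
  apply: (cvgr_to_le (cvg_norm (cvgB (cvgla _ mUS) cS))).
  apply: nearW => i.
  change (`|la i (\bigcup_j S j) - \sum_(0 <= j < n) la i (S j)| <=
    La (\bigcup_j S j) - \sum_(0 <= j < n) La (S j)).
  rewrite {1}/la (split_rest (h i) S n)// addrAC subrr add0r.
  rewrite (le_trans (laLa i _ (mrest S n mS)))//.
  by rewrite /La (split_rest G S n)// addrAC subrr add0r.
pose c : {charge set T -> \bar R} := HB.pack nu (isCharge.Build _ _ _ nu nu0 finnu snu).
have cmu : c `<< mu.
  move=> N N0 A mA AN; have muA := N0 A mA AN.
  apply/eqP; rewrite -abse_eq0 eq_le abse_ge0 andbT (le_trans (nuLa A mA))// /La.
  by rewrite null_set_integral//; exact: (measurable_int mu (iGA A mA)).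
exists (fun x => fine (Radon_Nikodym c mu x)).
  apply: eq_integrable (Radon_Nikodym_integrable cmu) => // x _ /=.
  by rewrite fineK//; exact: Radon_Nikodym_fin_num.
move=> A mA.
have -> : fine (\int[mu]_(x in A) (fine (Radon_Nikodym c mu x))%:E)%E =
   lim (la i A @[i --> F]).
  under eq_integral do rewrite fineK ?Radon_Nikodym_fin_num//.
  by rewrite -Radon_Nikodym_integral.
exact: cvgla.
Qed.

End UltraLimits.

(** * Limits of smooth functions with dominated derivatives *)

Section LimitJets.
Context {R : realType}.
Local Notation mu := (@lebesgue_measure R).
Implicit Types (u g G : R -> R) (a b c x y : R).

Lemma exists_primitive g : locally_integrable setT g ->
  exists2 P, continuous P & primitive P g.
Proof.
move=> lg; have mg : measurable_fun setT (EFin \o g).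
  by case: lg => /measurable_EFinP.
pose J a b := fine (\int[mu]_(x in `]a, b]) (g x)%:E)%E.
have iJ a b : mu.-integrable `]a, b] (EFin \o g).
  apply: integrableS (locally_integrable_itv a b lg) => //.
  exact: subset_itv_oc_cc.
have J0 a b : b <= a -> J a b = 0.
  by move=> ba; rewrite /J set_itv_ge ?integral_set0// -leNgt bnd_simp.
have chasles a b c : a <= b -> b <= c -> J a c = J a b + J b c.
  move=> ab bc; rewrite /J.
  have -> : `]a, c]%classic = `]a, b] `|` `]b, c] :> set R.
    by rewrite -itv_bndbnd_setU// bnd_simp.
  rewrite integral_setU//.
  - by rewrite fineD//; apply: integrable_fin_num.
  - exact: measurable_funS mg.
  - apply/disj_setPS => x [] /=; rewrite !in_itv/= => /andP[_ xb] /andP[bx _].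
    by have := lt_le_trans bx xb; rewrite ltxx.
(* J vanishes when its bounds are in the wrong order, so this is the signed
   integral from 0 to y. *)
pose P y := J 0 y - J y 0.
have PJ a b : a <= b -> J a b = P b - P a.
  move=> ab; rewrite /P; have [a0|a0] := leP 0 a.
    rewrite (chasles 0 a b)// (J0 b 0) ?(le_trans a0)// (J0 a 0)//; ring.
  have [b0|b0] := leP 0 b.
    rewrite (chasles a 0 b) ?(ltW a0)// (J0 b 0)// (J0 0 a) ?(ltW a0)//; ring.
  rewrite (chasles a b 0) ?(ltW b0)// (J0 0 a) ?(ltW a0)// (J0 0 b) ?(ltW b0)//; ring.
have prim : primitive P g.
  move=> a b ab; rewrite -PJ// /J fineK ?integrable_fin_num//.
  by rewrite integral_itv_obnd_cbnd//; apply: measurable_funS mg.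
exists P => // x.
have xx : x - 1 <= x + 1 by lra.
have /(continuous_within_itvP _ _)[] := parameterized_integral_continuous xx (locally_integrable_itv _ _ lg).
  by lra.
move=> /(_ x) + _ _; rewrite in_itv/= => H.
have {}H : {for x, continuous (fun y => parameterized_integral mu (x - 1) y g)}.
  by apply: H; apply/andP; split; lra.
have {}H : {for x, continuous (fun y => parameterized_integral mu (x - 1) y g + P (x - 1))}.
  by apply: cvgD; [exact: H|exact: cvg_cst].
have E y : x - 1 < y -> parameterized_integral mu (x - 1) y g + P (x - 1) = P y.
  move=> xy; rewrite /parameterized_integral /Rintegral prim ?ltW//=; ring.
rewrite /continuous_at -[X in _ --> X](E x); last by lra.
apply: cvg_trans H; apply: near_eq_cvg; near=> y; rewrite E//.
near: y; apply: lt_nbhsr; lra.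
Unshelve. all: by end_near. Qed.

Lemma ae_ex (Q : R -> Prop) : {ae mu, forall x, Q x} -> exists x, Q x.
Proof.
move=> [N [mN N0 HN]]; apply: contrapT => nQ.
have : (mu `[0%R, 1%R] <= mu N)%E.
  apply: le_measure; rewrite ?inE//; move=> x _; apply: HN => /= Qx.
  by apply: nQ; exists x.
by rewrite N0 lebesgue_measure_itv/= lte_fin ltr01 -EFinB subr0 lee_fin ler10.
Qed.

(** Below the order m the family is equibounded and equicontinuous with the modulus
    given by a primitive P of G, so pointwise limits exist, and the first-order
    expansions pass to the limit with that modulus.  At the order m only weak
    limits exist: they give densities g_N of the increments of u_(m-1) on each
    interval [-N, N]. *)
Lemma ultralimit_jets (J : Type) (F : set_system J) (m : nat)
    (U : J -> nat -> R -> R) G : UltraFilter F -> (0 < m)%N ->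
  (forall i, jet (U i)) -> locally_integrable setT G -> (forall x, 0 <= G x) ->
  {ae mu, forall x, forall i k, (k <= m)%N -> `|U i k x| <= G x} ->
  exists u : nat -> R -> R, exists g : R -> R,
    [/\ forall k x, (k < m)%N -> U i k x @[i --> F] --> u k x,
        forall k x, (k.+1 < m)%N -> is_derive x (1 : R) (u k) (u k.+1 x),
        forall k, (k < m)%N -> continuous (u k),
        locally_integrable setT g /\ primitive (u m.-1) g &
        forall a b, a <= b ->
          (`|u m.-1 b - u m.-1 a|%:E <= \int[mu]_(x in `[a, b]) (G x)%:E)%E].
Proof.
move=> UF m0 jU lG G0 hU; have PF : ProperFilter F := @ultra_proper _ _ UF.
have [P cP pP] := exists_primitive lG.
have mG : measurable_fun setT (EFin \o G) by case: lG => /measurable_EFinP.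
have aeF := ae_filter_ringOfSetsType mu.
have incr i k a b : (k < m)%N -> a <= b -> `|U i k b - U i k a| <= P b - P a.
  move=> km ab; rewrite -lee_fin -(pP _ _ ab).
  have cU := jet_continuous (jU i) (k := k.+1).
  apply: (le_trans (primitive_le_abs (continuous_locally_integrable cU)
    (derive_primitive (jU i k) cU) ab)).
  apply: ae_ge0_le_integral => //.
  - apply/measurable_EFinP; apply: measurable_funTS.
    by apply: measurableT_comp => //; exact: continuous_measurable_fun.
  - by move=> x _; rewrite lee_fin.
  - exact: measurable_funS mG.
  - by apply: filterS hU => x hx _; rewrite lee_fin hx.
have incr' i k a b : (k < m)%N -> `|U i k b - U i k a| <= `|P b - P a|.
  move=> km; have [ab|/ltW ba] := leP a b.
    by rewrite (le_trans (incr i k a b km ab))// ler_norm.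
  by rewrite distrC [leRHS]distrC (le_trans (incr i k b a km ba))// ler_norm.
have Pnd a b : a <= b -> P a <= P b.
  move=> ab; rewrite -subr_ge0 -lee_fin -(pP _ _ ab).
  by apply: integral_ge0 => x _; rewrite lee_fin.
have [x0 hx0] := ae_ex hU.
pose u k x := lim (U i k x @[i --> F]).
have cu k x : (k < m)%N -> U i k x @[i --> F] --> u k x.
  move=> km; have : cvg (U i k x @[i --> F]).
    apply: (@ultra_bounded_cvg _ _ _ _ (G x0 + `|P x - P x0|)) => // i.
    rewrite -[U i k x](subrK (U i k x0)) addrC (le_trans (ler_normD _ _))//.
    by rewrite lerD ?incr'// hx0// ltnW.
  by [].
have uincr k a b : (k < m)%N -> `|u k b - u k a| <= `|P b - P a|.
  move=> km; apply: (cvgr_to_le (cvg_norm (cvgB (cu k b km) (cu k a km)))).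
  by apply: nearW => i; exact: incr'.
have P0 x : `|P y - P x| @[y --> x] --> (0 : R).
  rewrite -(@normr0 _ R) -(subrr (P x)); apply: cvg_norm; apply: cvgB; last exact: cvg_cst.
  exact: cP.
have cuk k : (k < m)%N -> continuous (u k).
  move=> km x; apply/cvgrPdist_le => /= e e0.
  have /cvgrPdist_le/(_ e e0) := P0 x; apply: filterS => y.
  rewrite sub0r normrN normr_id; apply: le_trans.
  by rewrite distrC uincr.
have du k x : (k.+1 < m)%N -> is_derive x (1 : R) (u k) (u k.+1 x).
  move=> km; apply: (@is_derive_modulus _ _ _ _ (fun y => `|P y - P x|)) => // y.
  have c1 : U i k y - U i k x - U i k.+1 x * (y - x) @[i --> F] -->
      u k y - u k x - u k.+1 x * (y - x).
    apply: cvgB; first by apply: cvgB; apply: cu; exact: ltnW.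
    by apply: cvgM; [exact: cu|exact: cvg_cst].
  apply: (cvgr_to_le (cvg_norm c1)); apply: nearW => i.
  change (`|U i k y - U i k x - U i k.+1 x * (y - x)| <= `|y - x| * `|P y - P x|).
  have cUk : continuous (U i k) by exact: jet_continuous (jU i).
  have mvt a b : a < b -> exists2 z, a <= z <= b & U i k b - U i k a = U i k.+1 z * (b - a).
    move=> ab; have [z + E] := MVT ab (fun z _ => jU i k z) (continuous_subspaceT cUk).
    by rewrite in_itv/= => /andP[/ltW az /ltW zb]; exists z; rewrite ?az.
  have [xy|yx|->] := ltgtP x y; last by rewrite !subrr mulr0 subrr !normr0 mulr0.
    have [z /andP[xz zy] ->] := mvt x y xy.
    rewrite -mulrBl normrM mulrC ler_wpM2l// (le_trans (incr' i k.+1 x z km))//.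
    have h1 := Pnd _ _ xz; have h2 := Pnd _ _ zy; rewrite !ger0_norm; lra.
  have [z /andP[yz zx] E] := mvt y x yx.
  have -> : U i k y - U i k x = U i k.+1 z * (y - x).
    by rewrite -[LHS]opprB E -mulrN opprB.
  rewrite -mulrBl normrM mulrC ler_wpM2l// (le_trans (incr' i k.+1 x z km))//.
  have h1 := Pnd _ _ yz; have h2 := Pnd _ _ zx.
  rewrite distrC [leRHS]distrC !ger0_norm; lra.
have mm : (m.-1 < m)%N by rewrite prednK.
have [gN HgN] : exists gN : nat -> R -> R, forall N : nat,
    mu.-integrable setT (EFin \o gN N) /\
    forall a b, - N%:R <= a -> a <= b -> b <= N%:R ->
      (\int[mu]_(x in `[a, b]) (gN N x)%:E = (u m.-1 b - u m.-1 a)%:E)%E.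
  suff H (N : nat) : exists g : R -> R, mu.-integrable setT (EFin \o g) /\
    forall a b, - N%:R <= a -> a <= b -> b <= N%:R ->
      (\int[mu]_(x in `[a, b]) (g x)%:E = (u m.-1 b - u m.-1 a)%:E)%E.
    by have [gN HgN] := choice H; exists gN.
  pose K := `[(- N%:R : R), N%:R]%classic.
  have irestr f : locally_integrable setT f -> mu.-integrable setT (EFin \o (f \_ K)).
    move=> lf; rewrite -restrict_EFin; apply/integrable_restrict; rewrite ?setTI//.
      exact: measurable_itv.
    exact: locally_integrable_itv.
  have lUi i : locally_integrable setT (U i m).
    by apply: continuous_locally_integrable; exact: jet_continuous (jU i).
  have [g ig Hg] := @ultralimit_density _ _ _ mu J F (fun i => U i m \_ K) (G \_ K)
    UF (fun i => irestr _ (lUi i)) (irestr _ lG)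
    (fun x => ltac:(by rewrite patchE; case: ifP))
    (fun i => ltac:(by apply: filterS hU => x hx; rewrite !patchE; case: ifP => _; rewrite ?normr0// hx)).
  exists g; split => // a b Na ab bN.
  have fg : (\int[mu]_(x in `[a, b]) (g x)%:E)%E \is a fin_num.
    by apply: integrable_fin_num => //; apply: integrableS ig.
  rewrite -(fineK fg); congr EFin.
  have L1 := Hg `[a, b]%classic (measurable_itv _).
  have L2 : fine (\int[mu]_(x in `[a, b]) ((U i m \_ K) x)%:E)%E @[i --> F] -->
      u m.-1 b - u m.-1 a.
    have -> : (fun i => fine (\int[mu]_(x in `[a, b]) ((U i m \_ K) x)%:E)%E) =
       (fun i => U i m.-1 b - U i m.-1 a).
      apply/funext => i.
      have := derive_primitive (jU i m.-1) (jet_continuous (jU i)) ab.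
      rewrite prednK// => pU; rewrite -[RHS]/(fine (_ - _)%:E) -pU.
      congr fine; apply: eq_integral => x; rewrite inE/= in_itv/= => /andP[ax xb].
      have xK : K x by rewrite /K/= in_itv/= (le_trans Na ax) (le_trans xb bN).
      by rewrite patchE mem_set.
    by apply: cvgB; exact: cu.
  exact: (cvg_unique (@Rhausdorff R) L1 L2).
have lgN N : locally_integrable setT (gN N).
  by apply: open_integrable_locally; [exact: openT|exact: (HgN N).1].
(* The densities on the intervals [-N, N] agree almost everywhere with the
   limit of difference quotients, which is a single measurable function on the
   line. *)
pose q n x := (u m.-1 (x + n.+1%:R^-1) - u m.-1 x) * n.+1%:R.
pose g x := fine (limn_esup (fun n => (q n x)%:E)).
have gE (N : nat) : {ae mu, forall x, - N%:R < x -> x < N%:R -> g x = gN N x}.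
  apply: filterS (lebesgue_differentiation (lgN N)) => x xL Nx xN.
  have := nice_lebesgue_differentiation nicely_shrinking_right (lgN N) xL => c1.
  have c2 : (q n x)%:E @[n --> \oo] --> (gN N x)%:E.
    apply: cvg_trans c1; apply: near_eq_cvg; near=> n.
    have d0 : 0 < n.+1%:R^-1 :> R by rewrite invr_gt0.
    have xd : x + n.+1%:R^-1 <= N%:R.
      rewrite -lerBrDl ltW//; near: n.
      have h : 0 < N%:R - x by rewrite subr_gt0.
      exact: near_infty_natSinv_lt (PosNum h).
    rewrite lebesgue_measure_itv/= lte_fin ltrDl d0 -EFinD addrC addKr inver gt_eqF//.
    rewrite invrK integral_itv_bndo_bndc; last first.
      by case: (lgN N) => /measurable_EFinP mgN _ _; exact: measurable_funS mgN.
    rewrite (HgN N).2//; last by rewrite lerDl ltW.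
      by rewrite /q mulrC.
    exact: ltW.
  rewrite /g is_cvg_limn_esupE; last by apply/cvg_ex; exists (gN N x)%:E.
  by rewrite (cvg_lim _ c2).
have mg : measurable_fun setT g.
  apply: measurableT_comp; first exact: fine_measurable.
  apply: measurable_fun_limn_esup => n; apply/measurable_EFinP.
  apply: measurable_funM => //; apply: measurable_funB.
    apply: measurableT_comp; first by apply: continuous_measurable_fun; exact: cuk.
    exact: measurable_funD.
  by apply: continuous_measurable_fun; exact: cuk.
have bigN a b : exists N : nat, - N%:R < a /\ b < N%:R.
  exists (Num.truncn (`|a| + `|b|)).+1.
  have := truncnS_gt (`|a| + `|b|) => h.
  have h1 := ler_norm b; have h2 := ler_norm (- a); rewrite normrN in h2.
  have h3 := normr_ge0 a; have h4 := normr_ge0 b.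
  by split; lra.
have mgNs N : measurable_fun setT (gN N) by case: (lgN N).
exists u, g; split => //.
- split.
    split => //; first exact: openT.
    move=> K _ cK.
    have [a [b Kab]] : exists a b, K `<=` `[a, b].
      have [M [_ HM]] := compact_bounded cK.
      exists (- (M + 1)), (M + 1) => x Kx /=; rewrite in_itv/= -ler_norml.
      by apply: HM => //; rewrite ltrDl.
    have [N [Na bN]] := bigN a b.
    have mK : measurable K by exact: compact_measurable.
    have mabs (f : R -> R) : measurable_fun setT f ->
        measurable_fun K (fun x => `|f x|%:E).
      move=> mf; apply/measurable_EFinP; apply: measurable_funTS.
      exact: measurableT_comp.
    rewrite (@ae_eq_integral _ _ _ mu K (fun x => `|gN N x|%:E))//.
    + by case: (lgN N) => _ _; apply.
    + exact: mabs.
    + exact: mabs (mgNs N).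
    + apply: filterS (gE N) => x Hx Kx; rewrite Hx//.
        by have := Kab _ Kx; rewrite /= in_itv/= => /andP[+ _]; exact: lt_le_trans.
      by have := Kab _ Kx; rewrite /= in_itv/= => /andP[_ ]/le_lt_trans; apply.
  move=> a b ab; have [N [Na bN]] := bigN a b.
  rewrite -((HgN N).2 a b (ltW Na) ab (ltW bN)).
  apply: ae_eq_integral => //.
  + by apply/measurable_EFinP; exact: measurable_funTS.
  + by apply/measurable_EFinP; exact: (measurable_funTS (mgNs N)).
  + apply: filterS (gE N) => x Hx /=; rewrite in_itv/= => /andP[ax xb].
    by rewrite Hx ?(lt_le_trans Na)// (le_lt_trans xb).
- move=> a b ab; rewrite pP// lee_fin (le_trans (uincr _ _ _ mm))//.
  by rewrite ger0_norm// subr_ge0 Pnd.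
Unshelve. all: by end_near. Qed.

End LimitJets.

(** * Elementary inequalities for Lp norms *)

Section Lnorms.
Context d (T : measurableType d) {R : realType} (mu : {measure set T -> \bar R}).
Variable p : R.
Hypothesis p1 : 1 < p.
Local Open Scope ereal_scope.
Implicit Types f g : T -> \bar R.

Let p0 : (0 < p)%R. Proof. exact: lt_trans p1. Qed.

Lemma LnormE f : 'N[mu]_p%:E[f] = (\int[mu]_x (`|f x| `^ p)) `^ p^-1.
Proof. by rewrite unlock. Qed.

Lemma poweR_le (r : R) (x y : \bar R) : (0 <= r)%R -> 0 <= x -> x <= y ->
  x `^ r <= y `^ r.
Proof.
move=> r0 x0 xy; apply: gt0_ler_poweR => //; rewrite in_itv/= ?leey ?andbT//.
exact: le_trans xy.
Qed.

Lemma measurable_powLnorm f : measurable_fun setT f ->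
  measurable_fun setT (fun x => `|f x| `^ p).
Proof.
move=> mf; apply: (measurableT_comp (measurable_poweR p)).
exact: measurableT_comp.
Qed.

Lemma Lnorm_le_ae f g : measurable_fun setT f -> measurable_fun setT g ->
  {ae mu, forall x, `|f x| <= `|g x|} -> 'N[mu]_p%:E[f] <= 'N[mu]_p%:E[g].
Proof.
move=> mf mg fg; rewrite !LnormE; apply: poweR_le.
- by rewrite invr_ge0 ltW.
- by apply: integral_ge0 => x _; exact: poweR_ge0.
- apply: ae_ge0_le_integral => //.
  + by move=> x _; exact: poweR_ge0.
  + exact: measurable_powLnorm.
  + by move=> x _; exact: poweR_ge0.
  + exact: measurable_powLnorm.
  + by apply: filterS fg => x xfg _; apply: poweR_le => //; exact: ltW.
Qed.

Lemma Lnorm_scale f (c : R) : measurable_fun setT f -> (0 <= c)%R ->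
  'N[mu]_p%:E[(fun x => c%:E * f x)] = c%:E * 'N[mu]_p%:E[f].
Proof.
move=> mf c0; rewrite !LnormE.
under eq_integral => x _ do rewrite abseM gee0_abs ?lee_fin// poweRM ?lee_fin// poweR_EFin.
rewrite ge0_integralZl_EFin//; last 2 first.
- exact: measurable_powLnorm.
- exact: powR_ge0.
rewrite poweRM ?lee_fin ?powR_ge0//; last by apply: integral_ge0 => x _; exact: poweR_ge0.
  by rewrite poweR_EFin -powRrM mulfV ?gt_eqF// powRr1.
by move=> x _; exact: poweR_ge0.
Qed.

(** By homogeneity, since x + y <= 2 max(x, y). *)
Lemma poweR_subadd (r : R) (x y : \bar R) : (0 <= r)%R -> 0 <= x -> 0 <= y ->
  (x + y) `^ r <= (2 `^ r)%:E * (x `^ r + y `^ r).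
Proof.
move=> r0; wlog xy : x y / x <= y => [H x0 y0|x0 y0].
  have [xy|yx] := leP x y; first exact: H.
  by rewrite addeC [in leRHS]addeC; apply: H => //; exact: ltW.
apply: (@le_trans _ _ ((2%:E * y) `^ r)).
  by apply: poweR_le => //; [exact: adde_ge0|rewrite mule_natl mule2n leeD2r].
by rewrite poweRM// poweR_EFin lee_wpmul2l ?lee_fin ?powR_ge0// leeDr// poweR_ge0.
Qed.

(** A crude triangle inequality for functions with values in [0, +oo], where the
    constant does not matter. *)
Lemma LnormD_le f g : measurable_fun setT f -> measurable_fun setT g ->
  (forall x, 0 <= f x) -> (forall x, 0 <= g x) ->
  'N[mu]_p%:E[(fun x => f x + g x)] <= 4%:E * ('N[mu]_p%:E[f] + 'N[mu]_p%:E[g]).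
Proof.
move=> mf mg f0 g0; rewrite !LnormE.
set X := \int[mu]_x _ `^ p; set Y := \int[mu]_x _ `^ p; set Z := \int[mu]_x _ `^ p.
have Y0 : 0 <= Y by apply: integral_ge0 => x _; exact: poweR_ge0.
have Z0 : 0 <= Z by apply: integral_ge0 => x _; exact: poweR_ge0.
have i0 : (0 <= p^-1)%R by rewrite invr_ge0 ltW.
have XYZ : X <= (2 `^ p)%:E * (Y + Z).
  rewrite /X /Y /Z -ge0_integralD//; last 4 first.
  - by move=> x _; exact: poweR_ge0.
  - exact: measurable_powLnorm.
  - by move=> x _; exact: poweR_ge0.
  - exact: measurable_powLnorm.
  rewrite -ge0_integralZl_EFin//; last 2 first.
  - by move=> x _; rewrite adde_ge0 ?poweR_ge0.
  - by apply: emeasurable_funD; exact: measurable_powLnorm.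
  apply: ge0_le_integral => //.
  - by move=> x _; exact: poweR_ge0.
  - by apply: measurable_powLnorm; exact: emeasurable_funD.
  - by apply: measurable_funeM; apply: emeasurable_funD; exact: measurable_powLnorm.
  - move=> x _; rewrite !gee0_abs ?adde_ge0//.
    by apply: poweR_subadd => //; exact: ltW.
apply: (@le_trans _ _ (((2 `^ p)%:E * (Y + Z)) `^ p^-1)).
  by apply: poweR_le => //; apply: integral_ge0 => x _; exact: poweR_ge0.
have -> : ((2 `^ p)%:E * (Y + Z)) `^ p^-1 = 2%:E * (Y + Z) `^ p^-1.
  have c0 : 0 <= (2 `^ p)%:E :> \bar R by rewrite lee_fin powR_ge0.
  have YZ0 : 0 <= Y + Z by exact: adde_ge0.
  by rewrite (poweRM _ c0 YZ0) poweR_EFin -powRrM mulfV ?gt_eqF// powRr1.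
have -> : 4%:E = 2%:E * 2%:E :> \bar R by rewrite -EFinM; congr EFin; ring.
rewrite -muleA lee_wpmul2l//.
apply: (le_trans (poweR_subadd i0 Y0 Z0)).
rewrite lee_wpmul2r ?adde_ge0 ?poweR_ge0// lee_fin.
rewrite -[leRHS]powRr1//; apply: ler_powR; first by rewrite ler1n.
by rewrite invf_le1// ltW.
Qed.

Lemma Lnorm_sum_le n (f : nat -> T -> \bar R) :
  (forall i, measurable_fun setT (f i)) -> (forall i x, 0 <= f i x) ->
  'N[mu]_p%:E[(fun x => \sum_(i < n) f i x)] <=
  (4 ^+ n)%:E * \sum_(i < n) 'N[mu]_p%:E[f i].
Proof.
move=> mf f0; elim: n => [|n IH].
  under eq_Lnorm => x do rewrite big_ord0.
  by rewrite Lnorm0 ?gt_eqF ?lte_fin// big_ord0 mule0.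
under eq_Lnorm => x do rewrite big_ord_recr/=.
have S0 x : 0 <= \sum_(i < n) f i x by apply: sume_ge0.
apply: (le_trans (LnormD_le _ _ _ _)) => //; first exact: emeasurable_sum.
rewrite exprS EFinM -muleA lee_wpmul2l// big_ord_recr/=.
rewrite ge0_muleDr ?sume_ge0// ?Lnorm_ge0//; last by move=> i _; exact: Lnorm_ge0.
rewrite leeD// -[leLHS]mul1e lee_wpmul2r ?Lnorm_ge0//.
by rewrite lee_fin exprn_ege1// ler1n.
Qed.

End Lnorms.

(** * The maximal inequality in Lp *)

Section StrongMaximal.
Context {R : realType}.
Local Notation mu := (@lebesgue_measure R).
Local Notation HL := (@HL_maximal R).
Variable p : R.
Hypothesis p1 : 1 < p.
Implicit Types (f : R -> R) (c s v x : R).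

Let p0 : 0 < p. Proof. exact: lt_trans p1. Qed.

(** The part of f that alone is responsible for the maximal function exceeding c:
    the rest contributes at most c/2. *)
Definition above c f x : R := if c < 2 * `|f x| then f x else 0.

Lemma measurable_above c f : measurable_fun setT f -> measurable_fun setT (above c f).
Proof.
move=> mf; apply: measurable_fun_ifT => //.
apply: measurable_fun_ltr => //; apply: measurable_funM => //.
exact: measurableT_comp.
Qed.

Lemma above_le c f x : `|above c f x| <= `|f x|.
Proof. by rewrite /above; case: ifP; rewrite ?normr0. Qed.

Lemma locally_integrable_above c f : locally_integrable setT f ->
  locally_integrable setT (above c f).
Proof.
move=> [mf oT lf]; split => //; first exact: measurable_above.
move=> K KT cK; apply: le_lt_trans (lf K KT cK).
have mK : measurable K by exact: compact_measurable.
apply: ge0_le_integral => //.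
- by apply/measurable_EFinP/measurable_funTS; apply: measurableT_comp => //; exact: measurable_above.
- by apply/measurable_EFinP/measurable_funTS; apply: measurableT_comp.
- by move=> x _; rewrite lee_fin above_le.
Qed.

Lemma HL_above f c x : locally_integrable setT f -> 0 < c ->
  (HL f x <= HL (above c f) x + (c / 2)%:E)%E.
Proof.
move=> lf c0; have [mf _ _] := lf.
have [ma _ _] := locally_integrable_above c lf.
rewrite [leLHS]/HL_maximal; apply: ge_ereal_sup => y [r /=]; rewrite in_itv/= andbT => r0 <- {y}.
have mB : mu (ball x r) = (r *+ 2)%:E by rewrite lebesgue_measure_ball// ltW.
have mBr : measurable (ball x r) by exact: measurable_ball.
have r2 : 0 < r *+ 2 by rewrite mulrn_wgt0.
apply: (@le_trans _ _ (iavg (above c f) (ball x r) + (c / 2)%:E)%E); last first.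
  rewrite leeD2r//; apply: ereal_sup_ubound; exists r => //=.
  by rewrite in_itv/= andbT.
have -> : iavg f (ball x r) = iavg (above c f \+ (f \- above c f))%R (ball x r).
  by congr iavg; apply/funext => y /=; rewrite addrC subrK.
apply: (le_trans (iavgD _ _ _ _)) => //.
- by rewrite mB ltry.
- exact: measurable_funTS.
- by apply: measurable_funTS; exact: measurable_funB.
rewrite leeD2l// /iavg mB inver gt_eqF//.
rewrite lee_pdivrMl// -EFinM.
apply: (@le_trans _ _ (\int[mu]_(y in ball x r) (cst (c / 2)%:E) y)%E); last first.
  by rewrite integral_cst//= mB -EFinM mulrC.
apply: ge0_le_integral => //.
- apply: measurable_funTS; apply: measurableT_comp => //.
  by apply/measurable_EFinP; exact: measurable_funB.
move=> y _; rewrite abse_EFin lee_fin /above /=; case: ifPn => [_|].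
  by rewrite subrr normr0 divr_ge0// ltW.
by rewrite -leNgt subr0 ler_pdivlMr// mulrC.
Qed.

Lemma weak_type_above f c : locally_integrable setT f -> 0 < c ->
  (mu [set x | c%:E < HL f x] <= (6 / c)%:E * \int[mu]_x `|above c f x|%:E)%E.
Proof.
move=> lf c0; have la := locally_integrable_above c lf.
have c2 : 0 < c / 2 by rewrite divr_gt0.
have -> : 6 / c = 3 / (c / 2) by field; rewrite gt_eqF.
apply: le_trans (maximal_inequality la c2).
have mset g a : locally_integrable setT g -> measurable [set x | (a%:E < HL g x)%E].
  move=> lg; rewrite -[X in measurable X]setTI; apply: emeasurable_fun_o_infty => //.
  exact: measurable_HL_maximal.
apply: le_measure; rewrite ?inE; [exact: mset|exact: mset|].
move=> x /= cx; rewrite -(@lteD2rE _ (c / 2)%:E)// -EFinD.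
have -> : c / 2 + c / 2 = c by field.
by rewrite (lt_le_trans cx)// HL_above.
Qed.

Let q : R := 2 `^ (p - 1).

Let q1 : 1 < q.
Proof.
by rewrite /q /powR pnatr_eq0/= -[ltLHS]expR0 ltr_expR mulr_gt0 ?subr_gt0// ln_gt0// ltr1n.
Qed.

Let K : R := q / (q - 1).

(** A geometric sum is comparable with its largest term. *)
Lemma geometric_above s v n : 0 < s -> 0 <= v ->
  \sum_(j < n) (if s * 2 ^+ j < v then (s * 2 ^+ j) `^ (p - 1) else 0) <=
  K * v `^ (p - 1).
Proof.
move=> s0 v0; have K0 : 0 <= K by rewrite divr_ge0 ?subr_ge0 ?(ltW q1)// ltW// (lt_trans _ q1).
have q10 : 0 < q - 1 by rewrite subr_gt0 q1.
have tE j : (s * 2 ^+ j) `^ (p - 1) = s `^ (p - 1) * q ^+ j.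
  rewrite powRM ?exprn_ge0 ?(ltW s0)//; congr (_ * _).
  by rewrite -[2 ^+ j]powR_mulrn// -powRrM mulrC powRrM powR_mulrn// powR_ge0.
elim: n => [|n IH]; first by rewrite big_ord0 mulr_ge0// powR_ge0.
rewrite big_ord_recr/=; case: ifPn => [tv|_]; last by rewrite addr0.
apply: (@le_trans _ _ (\sum_(j < n.+1) s `^ (p - 1) * q ^+ j)).
  rewrite big_ord_recr/= -tE lerD2r; apply: ler_sum => j _; rewrite -tE.
  by case: ifP => // _; exact: powR_ge0.
rewrite -mulr_sumr.
have -> : \sum_(j < n.+1) q ^+ j = (q ^+ n.+1 - 1) / (q - 1).
  by rewrite subrX1 mulrC mulKf// gt_eqF.
apply: (@le_trans _ _ (K * (s * 2 ^+ n) `^ (p - 1))).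
  have -> : K * (s * 2 ^+ n) `^ (p - 1) = s `^ (p - 1) * (q ^+ n.+1 / (q - 1)).
    by rewrite tE /K exprS; field; rewrite gt_eqF.
  rewrite ler_wpM2l ?powR_ge0// ler_wpM2r ?invr_ge0 ?(ltW q10)//.
  by rewrite gerBl.
rewrite ler_wpM2l//; apply: ge0_ler_powR; rewrite ?nnegrE ?subr_ge0 ?(ltW p1)//.
  by rewrite mulr_ge0 ?exprn_ge0 ?(ltW s0).
exact: ltW.
Qed.

(** Every value above s lies between two consecutive points s 2^j. *)
Lemma dyadic_above (v : \bar R) s : 0 < s -> (s%:E < v)%E ->
  (v `^ p <= \sum_(0 <= j <oo)
     if (s * 2 ^+ j)%:E < v then ((2 * (s * 2 ^+ j)) `^ p)%:E else 0)%E.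
Proof.
move=> s0 sv.
have t0 j : 0 < s * 2 ^+ j by rewrite mulr_gt0// exprn_gt0.
have u0 (j : nat) : (0 <= if (s * 2 ^+ j)%:E < v then ((2 * (s * 2 ^+ j)) `^ p)%:E else 0)%E.
  by case: ifP => // _; rewrite lee_fin powR_ge0.
have term j : ((s * 2 ^+ j)%:E < v)%E -> (((2 * (s * 2 ^+ j)) `^ p)%:E <=
     \sum_(0 <= j <oo) if (s * 2 ^+ j)%:E < v then ((2 * (s * 2 ^+ j)) `^ p)%:E else 0)%E.
  move=> jv; apply: le_trans (nneseries_lim_ge j.+1 _); last by move=> n _ _; exact: u0.
  rewrite big_nat_recr//= jv leeDr//; apply: sume_ge0 => i _; exact: u0.
have archi a : exists j, a <= s * 2 ^+ j.
  exists (Num.truncn (a / s)).+1; rewrite mulrC -ler_pdivrMr// ltW//.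
  apply: (lt_le_trans (truncnS_gt _)); rewrite -natrX ler_nat.
  exact/ltnW/ltn_expl.
case: v sv u0 term => [v| |]// sv u0 term; last first.
  rewrite poweRyr ?gt_eqF// leye_eq; apply/eqP/eqyP => A A0.
  have [i hi] := archi (A `^ p^-1); apply: le_trans (term i (ltry _)).
  rewrite lee_fin (_ : A = A `^ (p^-1 * p)); last first.
    by rewrite mulVf ?gt_eqF// powRr1// ltW.
  rewrite powRrM; apply: ge0_ler_powR; rewrite ?nnegrE ?powR_ge0 ?(ltW p0)//.
    by rewrite mulr_ge0// ltW.
  by rewrite (le_trans hi)// ler_peMl ?ler1n// ltW.
have [j vj] := archi v.
have ex : exists j, v <= s * 2 ^+ j by exists j.
have [n vn nmin] := ex_minnP ex.
case: n vn nmin => [|n] vn nmin.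
  by move: sv; rewrite lte_fin ltNge; move: vn; rewrite expr0 mulr1 => ->.
have vgt : s * 2 ^+ n < v.
  by rewrite ltNge; apply/negP => /nmin; rewrite ltnn.
apply: le_trans (term n _); last by rewrite lte_fin.
rewrite poweR_EFin lee_fin; apply: ge0_ler_powR; rewrite ?nnegrE ?(ltW p0)//.
- by rewrite ltW// (lt_trans _ vgt).
- by rewrite mulr_ge0// ltW.
- by rewrite mulrCA -exprS.
Qed.

Let A : R := 6 * 2 `^ p * (2 `^ (p - 1) * K).

Let A0 : 0 < A.
Proof.
have K0 : 0 < K by apply: divr_gt0; rewrite ?subr_gt0 ?q1// (lt_trans _ q1).
by rewrite /A; apply: mulr_gt0; apply: mulr_gt0; rewrite ?powR_gt0.
Qed.

Lemma measurable_HL f : locally_integrable setT f ->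
  measurable_fun [set: measurableTypeR R] (HL f).
Proof. exact: measurable_HL_maximal. Qed.

Lemma integral_level (h : measurableTypeR R -> \bar R) (c b : R) :
  measurable_fun setT h ->
  (\int[mu]_x (if c%:E < h x then b%:E else 0) = b%:E * mu [set x | c%:E < h x])%E.
Proof.
move=> mh; rewrite -(@integral_cst _ _ _ mu [set x | (c%:E < h x)%E]); last first.
  by rewrite -[X in measurable X]setTI; exact: emeasurable_fun_o_infty.
rewrite [RHS]integral_mkcond; apply: eq_integral => x _; rewrite patchE.
by case: ifPn => hx; [rewrite mem_set|rewrite memNset//; exact/negP].
Qed.

(** Marcinkiewicz interpolation: the weak type estimate at the levels s 2^j is
    summed, and exchanging sum and integral leaves at each point a geometric sum
    over the levels below 2 |f x|. *)
Lemma integral_HL_above f s : 0 < s -> locally_integrable setT f ->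
  (\int[mu]_x (if s%:E < HL f x then HL f x `^ p else 0) <=
   A%:E * \int[mu]_x `|f x|%:E `^ p)%E.
Proof.
move=> s0 lf; have mH := measurable_HL lf.
have [mf _ _] := lf.
have t0 j : 0 < s * 2 ^+ j by rewrite mulr_gt0// exprn_gt0.
(* G j is the level set term before the weak type estimate and L j the one
   after it. *)
pose G j x := (if (s * 2 ^+ j)%:E < HL f x then ((2 * (s * 2 ^+ j)) `^ p)%:E else 0)%E.
pose L j x := ((6 * 2 `^ p)%:E * ((s * 2 ^+ j) `^ (p - 1) * `|above (s * 2 ^+ j) f x|)%:E)%E.
have G0 j x : (0 <= G j x)%E by rewrite /G; case: ifP => // _; rewrite lee_fin powR_ge0.
have L0 j x : (0 <= L j x)%E by rewrite mule_ge0// lee_fin mulr_ge0// powR_ge0.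
have mG j : measurable_fun [set: measurableTypeR R] (G j).
  by apply: measurable_fun_ifT => //; exact: measurable_fun_lte.
have mLr j : measurable_fun [set: R]
    (fun x => ((s * 2 ^+ j) `^ (p - 1) * `|above (s * 2 ^+ j) f x|)%:E).
  apply/measurable_EFinP; apply: measurable_funM => //.
  by apply: measurableT_comp => //; exact: measurable_above.
have mL j : measurable_fun [set: R] (L j) by exact: measurable_funeM.
have GL j : (\int[mu]_x G j x <= \int[mu]_x L j x)%E.
  rewrite [leLHS]integral_level// [leRHS]ge0_integralZl_EFin//; last 2 first.
  - by move=> x _; rewrite lee_fin mulr_ge0// powR_ge0.
  - exact: mLr.
  under eq_integral => x _ do rewrite EFinM.
  rewrite ge0_integralZl_EFin//; last 2 first.
  - apply/measurable_EFinP; apply: measurableT_comp => //; exact: measurable_above.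
  - exact: powR_ge0.
  apply: (@le_trans _ _ (((2 * (s * 2 ^+ j)) `^ p)%:E * ((6 / (s * 2 ^+ j))%:E *
      \int[mu]_x `|above (s * 2 ^+ j) f x|%:E))%E).
    by rewrite lee_wpmul2l ?lee_fin ?powR_ge0//; exact: weak_type_above.
  rewrite !muleA -!EFinM lee_wpmul2r//; first by apply: integral_ge0 => x _; rewrite lee_fin.
  have -> : (s * 2 ^+ j) `^ (p - 1) = (s * 2 ^+ j) `^ p / (s * 2 ^+ j).
    by rewrite powRB ?gt_eqF// ?powRr1 ?ltW// (gt_eqF (t0 j)) implybT.
  by rewrite powRM ?(ltW (t0 j))// lee_fin le_eqVlt; apply/orP; left; apply/eqP; ring.
apply: (@le_trans _ _ (\int[mu]_x \sum_(0 <= j <oo) G j x)%E).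
  apply: ge0_le_integral => //.
  - by move=> x _; case: ifP => // _; exact: poweR_ge0.
  - apply: measurable_fun_ifT => //; first exact: measurable_fun_lte.
    exact: (measurableT_comp (measurable_poweR p)).
  - by apply: ge0_emeasurable_sum.
  - by move=> x _; case: ifPn => // [sx|_]; [exact: dyadic_above|exact: nneseries_ge0].
rewrite integral_nneseries//.
apply: (@le_trans _ _ (\sum_(0 <= j <oo) \int[mu]_x L j x)%E).
  apply: lee_nneseries => [i _ _|i _]; last exact: GL.
  by apply: integral_ge0 => x _; exact: G0.
rewrite -integral_nneseries// -ge0_integralZl_EFin//; last 3 first.
- by move=> x _; exact: poweR_ge0.
- apply: (measurableT_comp (measurable_poweR p)); apply/measurable_EFinP.
  exact: measurableT_comp.
- exact: ltW.
apply: ge0_le_integral => //.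
- by move=> x _; exact: nneseries_ge0.
- apply: ge0_emeasurable_sum => [i x _ _|i _]; [exact: L0|exact: mL].
- apply: measurable_funeM; apply: (measurableT_comp (measurable_poweR p)).
  by apply/measurable_EFinP; exact: measurableT_comp.
move=> x _; rewrite /L nneseriesZl; last first.
  by move=> i _; rewrite lee_fin mulr_ge0// powR_ge0.
rewrite /A [in leRHS]EFinM -muleA lee_wpmul2l ?lee_fin ?mulr_ge0 ?powR_ge0//.
apply: lime_le; first by apply: is_cvg_nneseries => n _ _; rewrite lee_fin mulr_ge0// powR_ge0.
apply: nearW => n; rewrite sumEFin poweR_EFin lee_fin.
have -> : `|f x| `^ p = `|f x| `^ (p - 1) * `|f x|.
  have [->|fx] := eqVneq (f x) 0; first by rewrite normr0 mulr0 powR0 ?gt_eqF.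
  rewrite -[in X in _ = _ * X](powRr1 (normr_ge0 (f x))) -powRD ?subrK//.
  by rewrite normr_eq0 fx implybT.
apply: (@le_trans _ _ (K * (2 * `|f x|) `^ (p - 1) * `|f x|)); last first.
  by rewrite powRM// le_eqVlt; apply/orP; left; apply/eqP; ring.
rewrite big_mkord; apply: (le_trans _ (ler_wpM2r _ (geometric_above n s0 _))) => //.
rewrite mulr_suml; apply: ler_sum => j _; rewrite /above; case: ifP => _ //.
by rewrite normr0 mulr0 mul0r.
Qed.

Lemma HL_ge0 f x : (0 <= HL f x)%E.
Proof.
apply: (le_trans (iavg_ge0 f (ball x 1))); apply: ereal_sup_ubound.
by exists 1 => //=; rewrite in_itv/= ltr01.
Qed.

Lemma integral_HL f : locally_integrable setT f ->
  (\int[mu]_x HL f x `^ p <= A%:E * \int[mu]_x `|f x|%:E `^ p)%E.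
Proof.
move=> lf; have mH := measurable_HL lf.
have H0 := HL_ge0 f.
pose g n x := (if (n.+1%:R^-1)%:E < HL f x then HL f x `^ p else 0)%E.
have -> : (\int[mu]_x HL f x `^ p = \int[mu]_x limn (g^~ x))%E.
  apply: eq_integral => x _; apply/esym; apply: lim_near_cst => //.
  have [Hx|Hx] := ltP 0%E (HL f x); last first.
    have Hx0 : HL f x = 0%E by apply/eqP; rewrite eq_le Hx H0.
    rewrite Hx0.
    by apply: nearW => n; rewrite /g Hx0 poweR0r ?gt_eqF//; case: ifP.
  have [N Nx] : exists N : nat, ((N.+1%:R^-1)%:E < HL f x)%E.
    case: (HL f x) Hx => [r| |] // r0.
      exists (Num.truncn r^-1); rewrite lte_fin invf_plt ?posrE//.
      exact: truncnS_gt.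
    by exists 0%N; rewrite ltry.
  exists N => // n /= Nn; rewrite /g ifT//; apply: le_lt_trans Nx.
  by rewrite lee_fin lef_pV2 ?posrE// ler_nat.
have mg n : measurable_fun [set: measurableTypeR R] (g n).
  apply: measurable_fun_ifT => //; first exact: measurable_fun_lte.
  exact: (measurableT_comp (measurable_poweR p)).
have g0 n x : (0 <= g n x)%E by rewrite /g; case: ifP => // _; exact: poweR_ge0.
have ndg x : {homo g^~ x : n k / (n <= k)%N >-> (n <= k)%E}.
  move=> n k nk; rewrite /g; case: ifPn => [gx|_]; last exact: g0.
  rewrite ifT//; apply: le_lt_trans gx.
  by rewrite lee_fin lef_pV2 ?posrE// ler_nat.
rewrite monotone_convergence//.
apply: lime_le.
  by apply: ereal_nondecreasing_is_cvgn => n k nk; apply: ge0_le_integral => // x _; exact: ndg.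
by apply: nearW => n; exact: integral_HL_above.
Qed.

Theorem strong_maximal : exists2 B : R, 0 < B & forall f, locally_integrable setT f ->
  ('N[mu]_p%:E[HL f] <= B%:E * 'N[mu]_p%:E[EFin \o f])%E.
Proof.
exists (A `^ p^-1); first exact: powR_gt0.
move=> f lf; rewrite !LnormE//.
have H0 := HL_ge0 f.
under eq_integral => x _ do rewrite gee0_abs//.
have I0 : (0 <= \int[mu]_x `|(EFin \o f) x| `^ p)%E.
  by apply: integral_ge0 => x _; exact: poweR_ge0.
rewrite -poweR_EFin -(poweRM _ _ I0) ?lee_fin ?(ltW A0)//.
apply: poweR_le; first by rewrite invr_ge0 ltW.
  by apply: integral_ge0 => x _; exact: poweR_ge0.
exact: integral_HL.
Qed.

End StrongMaximal.


(** * Sets that extend to one side of each of their points *)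

Section MeasurableSided.
Context {R : realType}.
Implicit Types (A : set R) (x y : R).

Lemma measurable_subset1 A : (forall x y, A x -> A y -> x = y) -> measurable A.
Proof.
move=> A1; have [[x Ax]|/set0P/negP/negPn/eqP ->//] := pselect (A !=set0).
suff -> : A = [set x] by exact: measurable_set1.
by apply/seteqP; split=> [y Ay|_ ->//]; exact: A1.
Qed.

(** Such a set is open up to countably many points: of the points that
    are not interior, at most one is joined within the set to a given rational on
    a given side. *)
Lemma measurable_sided A :
  (forall x, A x -> exists2 e, 0 < e &
     (forall y, x <= y <= x + e -> A y) \/ (forall y, x - e <= y <= x -> A y)) ->
  measurable A.
Proof.
move=> HA.
pose U (q : rat) :=
  [set x | [/\ A x, ~ A° x, x < ratr q & forall y, x < y < ratr q -> A y]].
pose V (q : rat) :=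
  [set x | [/\ A x, ~ A° x, ratr q < x & forall y, ratr q < y < x -> A y]].
have opn (a b x : R) : (forall y, a < y < b -> A y) -> a < x < b -> A° x.
  move=> ab xab; have xab' : x \in `]a, b[ by rewrite in_itv.
  by apply: filterS (near_in_itvoo xab') => y; rewrite in_itv/=; exact: ab.
have -> : A = A° `|` (\bigcup_q U q `|` \bigcup_q V q).
  apply/seteqP; split => [x Ax|x [/interior_subset//|[[q _ []]//|[q _ []]//]]].
  have [?|nx] := pselect (A° x); [by left|right].
  have [e e0 [h|h]] := HA x Ax.
    have /rat_in_itvoo[q] : x < x + e by rewrite ltrDl.
    rewrite in_itv/= => /andP[xq qe]; left; exists q => //; split => // y /andP[xy yq].
    by apply: h; rewrite (ltW xy) (ltW (lt_trans yq qe)).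
  have /rat_in_itvoo[q] : x - e < x by rewrite gtrBl.
  rewrite in_itv/= => /andP[qe xq]; right; exists q => //; split => // y /andP[qy yx].
  by apply: h; rewrite (ltW yx) (ltW (lt_trans qe qy)).
apply: measurableU; first by apply: open_measurable; exact: open_interior.
apply: measurableU; apply: bigcupT_measurable_rat => q;
  apply: measurable_subset1 => x y [Ax nx xq hx] [Ay ny yq hy].
- case: (ltgtP x y) => // xy; exfalso.
    by apply: ny; apply: opn hx _; rewrite xy.
  by apply: nx; apply: opn hy _; rewrite xy.
- case: (ltgtP x y) => // xy; exfalso.
    by apply: nx; apply: opn hy _; rewrite xy xq.
  by apply: ny; apply: opn hx _; rewrite xy yq.
Qed.

End MeasurableSided.

(** * Sharp maximal functions are measurable *)

Section SharpMaximal.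
Context {R : realType}.
Variables (m : nat) (E : set R) (f : R -> R).
Implicit Types (k : nat) (x y : R) (S : {fset R}).

Lemma sharp_weight_ge0 k x S : #|` S| = k.+1 -> 0 <= sharp_weight m k x S.
Proof.
move=> Sk; rewrite /sharp_weight; case: ifP => // _.
have /fset0Pn[s sS] : S != fset0 by rewrite -cardfs_gt0 Sk.
by rewrite divr_ge0// -(normr0 R) -(subrr s); [exact: dist_le_diam|exact: diam_ge].
Qed.

Lemma sharp_maximal_ub k x S : admissible k E x S ->
  ((sharp_weight m k x S * `|divided_difference f S|)%:E <= sharp_maximal m E f k x)%E.
Proof.
move=> xS; rewrite /sharp_maximal; case: ifPn => [/asboolP e|_].
  by exfalso; have : set0 S by rewrite -e.
by apply: ereal_sup_ubound; exists S.
Qed.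

Lemma sharp_maximal_ge0 k x : (0 <= sharp_maximal m E f k x)%E.
Proof.
rewrite /sharp_maximal; case: ifPn => // /asboolPn/eqP/set0P[S xS].
apply: (@le_trans _ _ (sharp_weight m k x S * `|divided_difference f S|)%:E).
  by rewrite lee_fin mulr_ge0// sharp_weight_ge0//; case: xS.
by apply: ereal_sup_ubound; exists S.
Qed.

Lemma sharp_maximal_le k x (M : \bar R) : (0 <= M)%E ->
  (forall S, admissible k E x S ->
    (sharp_weight m k x S * `|divided_difference f S|)%:E <= M)%E ->
  (sharp_maximal m E f k x <= M)%E.
Proof.
move=> M0 HM; rewrite /sharp_maximal; case: ifPn => // _.
by apply: ge_ereal_sup => y [S xS <-]; exact: HM.
Qed.

(** Moving x towards a point of S does not enlarge the set. *)
Lemma diam_segment S x y s : s \in S -> (x <= y <= s) || (s <= y <= x) ->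
  diam ([set` S] `|` [set y]) <= diam ([set` S] `|` [set x]).
Proof.
move=> sS xys; have D0 : 0 <= diam ([set` S] `|` [set x]).
  by rewrite -(normr0 R) -(subrr s); exact: diam_ge.
have near_y a : a \in S -> `|a - y| <= diam ([set` S] `|` [set x]).
  move=> aS; have := dist_diam x aS; have := diam_ge x aS sS.
  by rewrite !ler_norml => /andP[? ?] /andP[? ?]; case/orP: xys => /andP[? ?];
    apply/andP; split; lra.
apply: diam_le => [|a b]; first by exists y; right.
move=> [/= aS|->] [/= bS|->].
- exact: diam_ge.
- exact: near_y.
- by rewrite distrC near_y.
- by rewrite subrr normr0.
Qed.

Lemma diam_gt0 S x : (1 < #|` S|)%N -> 0 < diam ([set` S] `|` [set x]).
Proof.
move=> S1; have /fset0Pn[a aS] : S != fset0 by rewrite -cardfs_gt0 (ltn_trans _ S1).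
have /fset0Pn[b] : (S `\ a)%fset != fset0.
  by move: S1; rewrite (cardfsD1 a) aS -cardfs_gt0.
rewrite in_fsetD1 => /andP[ba bS]; apply: lt_le_trans (diam_ge x aS bS).
by rewrite normr_gt0 subr_eq0 eq_sym.
Qed.

(** If some S makes f#_k (x) exceed a, the same S works for all points between x and
    a point of S, because the diameters of S with these points added do not
    increase.  So the set where f#_k exceeds a extends to one side of each of its
    points. *)
Lemma measurable_sharp_maximal k : (0 < m)%N -> (k <= m)%N ->
  measurable_fun setT (sharp_maximal m E f k).
Proof.
move=> m0 km; apply: (measurability _ (ErealGenOInfty.measurableE R)) => //.
move=> _ [_ [a ->]] <-; rewrite setTI.
apply: measurable_sided => x /=; rewrite in_itv/= andbT => ax.
have above y S : admissible k E x S -> admissible k E y S ->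
    (a%:E < (sharp_weight m k x S * `|divided_difference f S|)%:E)%E ->
    sharp_weight m k x S <= sharp_weight m k y S -> (a%:E < sharp_maximal m E f k y)%E.
  move=> xS yS aS xy; apply: lt_le_trans (sharp_maximal_ub yS).
  by rewrite (lt_le_trans aS)// lee_fin ler_wpM2r.
have [a0|a0] := ltP a 0.
  exists 1 => //; left => y _; rewrite in_itv/= andbT.
  by apply: lt_le_trans (sharp_maximal_ge0 k y); rewrite lte_fin.
move: (ax); rewrite {1}/sharp_maximal; case: ifPn => [_|_ /ereal_sup_gt[_ [S xS <-] aS]].
  by rewrite lte_fin ltNge a0.
have [SE Sk Sx1] := xS.
have seg s y : s \in S -> (x <= y <= s) || (s <= y <= x) ->
    (a%:E < sharp_maximal m E f k y)%E.
  move=> sS xys; have yx := diam_segment sS xys.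
  apply: (above _ _ xS _ aS); first by split => //; exact: le_trans Sx1.
  rewrite /sharp_weight; case: ifPn => // nkm; rewrite ler_wpM2l//.
    by rewrite -(normr0 R) -(subrr s); exact: dist_le_diam.
  have S1 : (1 < #|` S|)%N by rewrite Sk ltnS lt0n; apply/negP => /eqP k0; rewrite k0 m0 in nkm.
  by rewrite lef_pV2 ?posrE ?diam_gt0.
have [[s sS sx]|Sx] := pselect (exists2 s, s \in S & s != x).
  have [xs|sx'|e] := ltgtP x s.
  - exists (s - x); first by rewrite subr_gt0.
    left => y /andP[xy ys]; rewrite in_itv/= andbT; apply: (seg s) => //.
    by rewrite xy; rewrite addrC subrK in ys; rewrite ys.
  - exists (x - s); first by rewrite subr_gt0.
    right => y /andP[sy yx]; rewrite in_itv/= andbT; apply: (seg s) => //.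
    by rewrite yx andbT; apply/orP; right; rewrite subKr in sy.
  - by rewrite e eqxx in sx.
have eS s : s \in S -> s = x.
  by move=> sS; apply/eqP/negPn/negP => sx; apply: Sx; exists s.
have S1 : S = [fset x]%fset.
  have /fset0Pn[s sS] : S != fset0 by rewrite -cardfs_gt0 Sk.
  apply/fsetP => y; rewrite in_fset1; apply/idP/eqP => [/eS//|->].
  by rewrite -(eS _ sS).
have k0 : k = 0%N by move: Sk; rewrite S1 cardfs1 => -[].
exists 1 => //; left => y /andP[xy yx]; rewrite in_itv/= andbT.
apply: (above _ _ xS _ aS); last by rewrite /sharp_weight k0 m0.
split => //; apply: diam_le => [|b c]; first by exists y; right.
have yx1 : `|x - y| <= 1 by rewrite ler_norml; apply/andP; split; lra.
by move=> [/= /eS ->|->] [/= /eS ->|->]; rewrite ?subrr ?normr0// distrC.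
Qed.

End SharpMaximal.

(** * Sharp maximal functions of a smooth function *)

Section MaximalBounds.
Context {R : realType}.
Local Notation mu := (@lebesgue_measure R).
Local Notation HL := (@HL_maximal R).
Implicit Types (u v w : R -> R) (x y c r : R).

(** The normalization of averages in the definition of the maximal function. *)
Lemma integral_ball_HL w x r : 0 < r ->
  (\int[mu]_(y in ball x r) `|(w y)%:E| <= (r *+ 2)%:E * HL w x)%E.
Proof.
move=> r0; have mB : mu (ball x r) = (r *+ 2)%:E by rewrite lebesgue_measure_ball// ltW.
have r2 : 0 < r *+ 2 by rewrite mulrn_wgt0.
have : (iavg w (ball x r) <= HL w x)%E.
  by apply: ereal_sup_ubound; exists r => //=; rewrite in_itv/= r0.
by rewrite /iavg mB inver gt_eqF// lee_pdivrMl.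
Qed.

Lemma primitive_le_ball v w x r c y : locally_integrable setT w -> primitive v w ->
  `|x - c| < r -> `|x - y| < r ->
  (`|v c - v y|%:E <= \int[mu]_(z in ball x r) `|(w z)%:E|)%E.
Proof.
move=> lw vw; have [mw _ _] := lw; wlog yc : c y / y <= c => [H|] xc xy.
  have [yc|/ltW yc] := leP y c; first exact: H.
  by rewrite distrC; exact: H.
apply: (le_trans (primitive_le_abs lw vw yc)).
apply: ge0_subset_integral => //.
- exact: measurable_ball.
- by apply/measurable_EFinP; apply: measurable_funTS; exact: measurableT_comp.
move=> z; rewrite /= in_itv/= => /andP[yz zc]; rewrite /ball/=.
move: xc xy; rewrite !ltr_norml => /andP[? ?] /andP[? ?]; apply/andP; split; lra.
Qed.

Lemma primitive_osc_HL v w x r c y : locally_integrable setT w -> primitive v w ->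
  0 < r -> `|x - c| <= r -> `|x - y| <= r ->
  (`|v c - v y|%:E <= (4 * r)%:E * HL w x)%E.
Proof.
move=> lw vw r0 xc xy; have r2 : r < 2 * r by rewrite ltr_pMl// ltr1n.
apply: (le_trans (primitive_le_ball lw vw (le_lt_trans xc r2) (le_lt_trans xy r2))).
have -> : 4 * r = (2 * r) *+ 2 by ring.
by apply: integral_ball_HL; rewrite mulr_gt0.
Qed.

(** Average |v c| <= |v y| + |v c - v y| over y in the ball of radius 2 about x. *)
Lemma value_le_HL v w x c : continuous v -> locally_integrable setT w -> primitive v w ->
  `|x - c| <= 1 -> (`|v c|%:E <= 4%:E * (HL v x + HL w x))%E.
Proof.
move=> cv lw vw xc; have mv : measurable_fun setT v by exact: continuous_measurable_fun.
have mB : mu (ball x 2) = 4%:E by rewrite lebesgue_measure_ball//; congr EFin; ring.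
have mBm : measurable (ball x (2 : R)) by exact: measurable_ball.
have cstE (a : \bar R) : (\int[mu]_(y in ball x 2) cst a y = a * 4%:E)%E.
  by rewrite -mB; exact: integral_cst.
set J := (\int[mu]_(z in ball x 2) `|(w z)%:E|)%E.
have J0 : (0 <= J)%E by exact: integral_ge0.
have : (\int[mu]_(y in ball x 2) (cst `|v c|%:E y) <=
        \int[mu]_(y in ball x 2) (`|(v y)%:E| + cst J y))%E.
  apply: ge0_le_integral => //.
  - by move=> y _; rewrite /= lee_fin.
  - apply: emeasurable_funD => //; apply: measurable_funTS; apply: measurableT_comp => //.
    exact/measurable_EFinP.
  - move=> y xy; change (`|v c|%:E <= `|v y|%:E + J)%E.
    rewrite -{1}(subrK (v y) (v c)) addrC.
    apply: (@le_trans _ _ (`|v y| + `|v c - v y|)%:E); first by rewrite lee_fin ler_normD.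
    rewrite EFinD leeD2l//; apply: primitive_le_ball => //.
    by apply: le_lt_trans xc _; rewrite ltr1n.
rewrite ge0_integralD//; last first.
  by apply: measurable_funTS; apply: measurableT_comp => //; exact/measurable_EFinP.
rewrite !cstE muleC => H.
have J4 : (J <= 4%:E * HL w x)%E.
  have -> : 4 = 2 *+ 2 :> R by ring.
  exact: integral_ball_HL.
have V4 : (\int[mu]_(y in ball x 2) `|(v y)%:E| <= 4%:E * HL v x)%E.
  have -> : 4 = 2 *+ 2 :> R by ring.
  exact: integral_ball_HL.
rewrite -(@lee_pmul2l _ 4%:E)//; apply: (le_trans H).
rewrite muleA -EFinM.
apply: (@le_trans _ _ (4%:E * HL v x + (4%:E * HL w x) * 4%:E)%E).
  by apply: leeD; [exact: V4|apply: lee_wpmul2r; [|exact: J4]].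
rewrite ge0_muleDr ?HL_ge0// muleAC -EFinM leeD2r// lee_wpmul2r ?HL_ge0// lee_fin.
lra.
Qed.

Lemma seq_max (s : seq R) : s != [::] -> exists2 a, a \in s & forall y, y \in s -> y <= a.
Proof.
move=> s0; have [|a /mapP[b bs ->] hb] := seq_min (s := map -%R s).
  by rewrite -size_eq0 size_map size_eq0.
by exists b => // y ys; rewrite -lerN2; apply: hb; rewrite map_f.
Qed.

Lemma fact_inv_le1 k (a : R) : `|a / k`!%:R| <= `|a|.
Proof.
have f1 : 1 <= k`!%:R :> R by rewrite ler1n fact_gt0.
have f0 := lt_le_trans ltr01 f1.
by rewrite normrM normfV (gtr0_norm f0) ler_piMr// invf_le1.
Qed.

Variables (m : nat) (h : nat -> R -> R).
Hypothesis m0 : (0 < m)%N.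
Hypothesis hD : forall k x, (k.+1 < m)%N -> is_derive x 1 (h k) (h k.+1 x).
Hypothesis hC : forall k, (k < m)%N -> continuous (h k).
Hypothesis hL : locally_integrable setT (h m).
Hypothesis hP : primitive (h m.-1) (h m).

Lemma chain_locally_integrable k : (k <= m)%N -> locally_integrable setT (h k).
Proof.
rewrite leq_eqVlt => /predU1P[->//|km].
by apply: continuous_locally_integrable; exact: hC.
Qed.

Lemma chain_primitive k : (k < m)%N -> primitive (h k) (h k.+1).
Proof.
move=> km; have [km1|] := ltnP k.+1 m.
  by apply: derive_primitive => [x|]; [exact: hD|exact: hC].
by move=> mk; have <- : m = k.+1; [apply/eqP; rewrite eqn_leq mk|have -> : k = m.-1 by lia].
Qed.

(** For k < m the divided difference is a value of the k-th derivative near x.  For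
    k = m, multiplication by the diameter turns it into an increment of the
    derivative of order m - 1 between two points of the convex hull of S. *)
Lemma sharp_maximal_le_HL E k x : (k <= m)%N ->
  (sharp_maximal m E (h 0) k x <= 4%:E * (HL (h k) x + HL (h (minn k.+1 m)) x))%E.
Proof.
move=> km; apply: sharp_maximal_le => [|S [SE Sk Sx1]].
  by rewrite mule_ge0// adde_ge0// HL_ge0.
have xS y : y \in S -> `|x - y| <= 1 by move=> yS; exact: le_trans (dist_diam x yS) Sx1.
have dS j : (j < m)%N -> forall i y, (i < j)%N -> is_derive y 1 (h i) (h i.+1 y).
  by move=> jm i y ij; apply: hD; exact: leq_ltn_trans ij jm.
have [{}km|mk] := ltnP k m.
  have [|c cx ->] := @divided_difference_mean R k h S (x - 1) (x + 1) (dS _ km) Sk.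
    by move=> y /xS; rewrite ler_norml => /andP[? ?]; apply/andP; split; lra.
  rewrite /sharp_weight km mul1r (minn_idPl km).
  apply: (@le_trans _ _ `|h k c|%:E); first by rewrite lee_fin fact_inv_le1.
  apply: value_le_HL; [exact: hC|exact: chain_locally_integrable|exact: chain_primitive|].
  by rewrite ler_norml; apply/andP; split; lra.
(* The case k = m, with a and b the largest and the smallest point of S. *)
have {}km : k = m by apply/eqP; rewrite eqn_leq km.
rewrite km in Sk *; rewrite /sharp_weight ltnn (minn_idPr (leqnSn m)).
have S0 : enum_fset S != [::] by rewrite -size_eq0 -[size _]/(#|` S|) Sk.
have [a aS ha] := seq_max S0; have [b bS hb] := seq_min S0.
set D := diam (_ `|` _).
have D0 : 0 < D by apply: diam_gt0; rewrite Sk ltnS.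
have dab : diam [set` S] <= a - b.
  apply: diam_le => [|c d /= cS dS']; first by exists a.
  have := ha c cS; have := ha d dS'; have := hb c cS; have := hb d dS'.
  by move=> ? ? ? ?; rewrite ler_norml; apply/andP; split; lra.
have ab : a != b.
  apply/eqP => e; have : (1 < #|` S|)%N by rewrite Sk ltnS.
  have -> : S = [fset a]%fset; last by rewrite cardfs1.
  apply/fsetP => y; rewrite in_fset1; apply/idP/eqP => [yS|->//].
  by apply/eqP; rewrite eq_le ha//= e hb.
pose A := (S `\ a `\ b)%fset.
have aA : a \notin A by rewrite !in_fsetD1 eqxx andbF.
have bA : b \notin A by rewrite !in_fsetD1 eqxx.
have bSa : b \in (S `\ a)%fset by rewrite in_fsetD1 eq_sym ab.
have SA : S = (a |` (b |` A))%fset by rewrite /A fsetD1K// fsetD1K.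
have cA : #|` A|.+2 = m.+1.
  by move: Sk; rewrite (cardfsD1 a) aS (cardfsD1 b (S `\ a)%fset) bSa.
have m1 : (m.-1 < m)%N by rewrite prednK.
have mean c : c \in S -> c \notin A -> exists2 z, b <= z <= a &
    divided_difference (h 0) (c |` A)%fset = h m.-1 z / (m.-1)`!%:R.
  move=> cS cnA; apply: divided_difference_mean; first exact: dS.
    by rewrite cardfsU1 cnA add1n prednK//; case: cA => <-.
  move=> y yA; have yS : y \in S.
    by move: yA; rewrite in_fset1U => /predU1P[->//|]; rewrite !in_fsetD1 => /and3P[].
  by rewrite ha// hb.
have [z zab ez] := mean a aS aA; have [z' zab' ez'] := mean b bS bA.
have := divided_difference_recursion (h 0) aA bA ab; rewrite ez ez' -SA => rec.
have abD : 0 < a - b by rewrite subr_gt0 lt_neqAle eq_sym ab hb.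
have zD c : b <= c <= a -> `|x - c| <= D.
  move=> cab; have := dist_diam x aS; have := dist_diam x bS; rewrite -/D.
  rewrite !ler_norml => /andP[? ?] /andP[? ?].
  by move: cab => /andP[? ?]; apply/andP; split; lra.
have osc := primitive_osc_HL hL hP D0 (zD _ zab) (zD _ zab').
have step : diam [set` S] / D * `|divided_difference (h 0) S| <= `|h m.-1 z - h m.-1 z'| / D.
  rewrite -mulrA mulrC -mulrA mulrC ler_wpM2r ?invr_ge0 ?(ltW D0)//.
  apply: (@le_trans _ _ (`|divided_difference (h 0) S| * (a - b))).
    exact: ler_wpM2l.
  rewrite -[X in _ * X](gtr0_norm abD) -normrM -rec -mulrBl; exact: fact_inv_le1.
apply: (@le_trans _ _ (`|h m.-1 z - h m.-1 z'| / D)%:E); first by rewrite lee_fin.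
rewrite EFinM muleC lee_pdivrMl//; apply: (le_trans osc).
rewrite mulrC EFinM -muleA lee_wpmul2l ?lee_fin ?(ltW D0)// lee_wpmul2l//.
by rewrite leeDr// HL_ge0.
Qed.

End MaximalBounds.

(** * Traces of Sobolev functions *)

Section Trace.
Context {R : realType}.
Local Notation mu := (@lebesgue_measure R).
Local Notation HL := (@HL_maximal R).
Implicit Types (u F f : R -> R) (m k : nat).

Lemma abs_continuous_continuous u : abs_continuous u -> continuous u.
Proof.
move=> ac x; apply/cvgrPdist_lt => e e0; have [d d0 H] := ac e e0.
have osc a b : a <= b -> b - a < d -> `|u b - u a| < e.
  move=> ab abd; have := H 1%N (fun=> a) (fun=> b); rewrite !big_ord1; apply => //.
  by move=> i j _ _ _; rewrite (ord1 i) (ord1 j).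
near=> y; have xyd : `|x - y| < d by near: y; apply: cvgr_dist_lt.
move: xyd; rewrite ltr_norml => /andP[? ?]; have [xy|/ltW yx] := leP x y.
  by rewrite distrC; apply: osc => //; lra.
by apply: osc => //; lra.
Unshelve. all: by end_near. Qed.

Lemma is_derive_derive1n F k (x : R) : derivable (derive1n k F) x 1 ->
  is_derive x 1 (derive1n k F) (derive1n k.+1 F x).
Proof. by move=> /derivableP; rewrite derive1nS derive1E. Qed.

(** The chosen representative is a weak derivative as soon as there is one. *)
Lemma weak_deriveP u g : is_weak_derivative u g -> is_weak_derivative u (weak_derive u).
Proof. by move=> ug; apply: (@xgetPex _ (cst 0)); exists g. Qed.

Lemma sobolev_chain m p F : (0 < m)%N -> homogeneous_sobolev m p F ->
  let h := sobolev_derive m F in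
  [/\ forall k (x : R), (k.+1 < m)%N -> is_derive x 1 (h k) (h k.+1 x),
      forall k, (k < m)%N -> continuous (h k),
      locally_integrable setT (h m) & primitive (h m.-1) (h m)].
Proof.
move=> m0 [dF acF [g ug _]] h.
have hk k : (k < m)%N -> h k = derive1n k F by rewrite /h /sobolev_derive => ->.
have hm : h m = weak_derive (derive1n m.-1 F) by rewrite /h /sobolev_derive ltnn.
have m1 : (m.-1 < m)%N by rewrite prednK.
have wF := weak_deriveP ug.
have cF := abs_continuous_continuous acF.
have isd k (x : R) : (k.+1 < m)%N -> is_derive x 1 (h k) (h k.+1 x).
  move=> km; rewrite (hk k (ltnW km)) (hk k.+1 km).
  by apply: is_derive_derive1n; apply: dF; rewrite -ltnS prednK.
split => //.
- move=> k km; have [km1|mk] := ltnP k.+1 m.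
    move=> x; apply: differentiable_continuous; apply/derivable1_diffP.
    by have [] := isd k x km1.
  by rewrite hk//; have -> : k = m.-1 by apply/eqP; rewrite -eqSS prednK// eqn_leq mk km.
- by rewrite hm; case: wF.
- rewrite hm hk//; have [psi [jpsi psi0 psi1 psi' [bpsi psi10]]] := @smooth_step R.
  exact: (weak_derivative_primitive jpsi psi0 psi1 psi' bpsi psi10).
Qed.

Lemma eq_sharp_maximal m E f F k x : (forall y, E y -> F y = f y) ->
  sharp_maximal m E F k x = sharp_maximal m E f k x.
Proof.
move=> Ff; rewrite /sharp_maximal; case: ifPn => // _; congr ereal_sup.
have dd S : admissible k E x S -> divided_difference F S = divided_difference f S.
  move=> [SE _ _]; rewrite /divided_difference !big_seq; apply: eq_bigr => y yS.
  by rewrite Ff//; exact: SE.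
by apply/seteqP; split => _ [S xS <-]; exists S => //; rewrite dd.
Qed.

(** The pointwise bound by maximal functions, together with the strong maximal
    inequality. *)
Theorem sharp_maximal_sobolev m (p : R) : (0 < m)%N -> 1 < p ->
  exists2 C : R, 0 < C & forall E f F, sobolev_extension m p E f F ->
    forall k, (k <= m)%N ->
    ('N[mu]_p%:E[sharp_maximal m E f k] <= C%:E * sobolev_norm m p F)%E.
Proof.
move=> m0 p1; have [B B0 HB] := strong_maximal p1.
exists (32 * B); first by rewrite mulr_gt0.
move=> E f F [[hF sF] Ff] k km; set h := sobolev_derive m F.
have [hD hC hL hP] := sobolev_chain m0 hF.
have lh j : (j <= m)%N -> locally_integrable setT (h j).
  exact: (chain_locally_integrable hC hL).
have mHL j : (j <= m)%N -> measurable_fun setT (HL (h j)) by move=> jm; exact: (measurable_HL (lh _ jm)).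
have HN j : (j <= m)%N -> ('N[mu]_p%:E[HL (h j)] <= B%:E * sobolev_norm m p F)%E.
  move=> jm; apply: (le_trans (HB _ (lh j jm))); rewrite lee_wpmul2l ?lee_fin ?(ltW B0)//.
  rewrite /sobolev_norm; have jm' : (j < m.+1)%N by [].
  rewrite (bigD1 (Ordinal jm'))//= leeDl//.
  by apply: sume_ge0 => i _; exact: Lnorm_ge0.
set j := minn k.+1 m; have jm : (j <= m)%N by rewrite geq_minr.
apply: (@le_trans _ _ ('N[mu]_p%:E[(fun x => 4%:E * (HL (h k) x + HL (h j) x))])%E).
  apply: Lnorm_le_ae => //.
  - exact: measurable_sharp_maximal.
  - by apply: measurable_funeM; apply: emeasurable_funD; exact: mHL.
  apply: nearW => x; rewrite !gee0_abs ?sharp_maximal_ge0//; last first.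
    by rewrite mule_ge0// adde_ge0// HL_ge0.
  rewrite -(eq_sharp_maximal _ _ _ Ff).
  have -> : F = h 0 by rewrite /h /sobolev_derive m0.
  exact: sharp_maximal_le_HL.
rewrite Lnorm_scale//; last by apply: emeasurable_funD; exact: mHL.
have -> : 32 * B = 4 * (4 * (B + B)) by ring.
rewrite EFinM -muleA lee_wpmul2l//.
apply: (le_trans (@LnormD_le _ _ _ mu p p1 _ _ (mHL _ km) (mHL _ jm) (HL_ge0 _) (HL_ge0 _))).
rewrite EFinM -muleA lee_wpmul2l// EFinD ge0_muleDl ?lee_fin ?(ltW B0)//.
by rewrite leeD// HN.
Qed.

End Trace.


(** * Functions with an integrable power *)

Section PowerIntegrable.
Context {R : realType}.
Local Notation mu := (@lebesgue_measure R).
Variables (p : R) (G0 : R -> \bar R).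
Hypothesis p1 : 1 < p.
Hypothesis mG0 : measurable_fun setT G0.
Hypothesis G00 : forall x, (0 <= G0 x)%E.
Hypothesis finG0 : ('N[mu]_p%:E[G0] < +oo)%E.

Let p0 : 0 < p. Proof. exact: lt_trans p1. Qed.

Lemma measurable_pow : measurable_fun setT (fun x => (G0 x `^ p)%E).
Proof. exact: (measurableT_comp (measurable_poweR p)). Qed.

Lemma integral_pow_lty : (\int[mu]_x (G0 x `^ p) < +oo)%E.
Proof.
have -> : (\int[mu]_x (G0 x `^ p) = 'N[mu]_p%:E[G0] `^ p)%E.
  rewrite poweR_Lnorm ?gt_eqF//; apply: eq_integral => x _.
  by rewrite gee0_abs.
by apply: poweR_lty.
Qed.

Lemma pow_integrable : mu.-integrable setT (fun x => (G0 x `^ p)%E).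
Proof.
apply/integrableP; split; first exact: measurable_pow.
under eq_integral => x _ do rewrite gee0_abs ?poweR_ge0//.
exact: integral_pow_lty.
Qed.

Lemma ae_fin_num : {ae mu, forall x, G0 x \is a fin_num}.
Proof.
have aeF := ae_filter_ringOfSetsType mu.
apply: filterS (integrable_ae measurableT pow_integrable) => x /(_ I).
have := G00 x; case: (G0 x) => [r| |]//= _.
by rewrite (gt_eqF p0).
Qed.

(** Makes a function with integrable p-th power locally integrable. *)
Lemma le_1_pow (a : R) : 0 <= a -> a <= 1 + a `^ p.
Proof.
move=> a0; have [a1|a1] := leP a 1; first by rewrite ler_wpDr// powR_ge0.
rewrite ler_wpDl// -{1}[a]powRr1//; apply: ler_powR; exact: ltW.
Qed.

Lemma measurable_fine_fun : measurable_fun setT (fun x => fine (G0 x)).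
Proof. by apply: measurableT_comp => //; exact: fine_measurable. Qed.

Lemma fine_pow_integrable : mu.-integrable setT (EFin \o (fun x => fine (G0 x) `^ p)).
Proof.
have mf : measurable_fun setT (fun x => fine (G0 x) `^ p).
  exact: measurableT_comp (measurable_powR p) measurable_fine_fun.
apply/integrableP; split; first exact/measurable_EFinP.
apply: le_lt_trans integral_pow_lty; apply: ge0_le_integral => //.
- by apply: measurableT_comp => //; exact/measurable_EFinP.
- exact: measurable_pow.
move=> x _ /=; rewrite ger0_norm ?powR_ge0//.
have := G00 x; case: (G0 x) => [r| |] //= _.
  by rewrite (gt_eqF p0) leey.
Qed.

Lemma locally_integrable_fine (C : R) : 0 <= C ->
  locally_integrable setT (fun x => C * fine (G0 x)).
Proof.
move=> C0; split; first by apply: measurable_funM => //; exact: measurable_fine_fun.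
  exact: openT.
move=> K _ cK; have mK : measurable K by exact: compact_measurable.
have := fine_pow_integrable; move=> /integrableP[/measurable_EFinP mf finf].
apply: (@le_lt_trans _ _ (\int[mu]_(x in K) (C%:E * (1 + (fine (G0 x) `^ p)%:E)))%E).
  apply: ge0_le_integral => //.
  - apply/measurable_EFinP; apply: measurable_funTS; apply: measurableT_comp => //.
    by apply: measurable_funM => //; exact: measurable_fine_fun.
  - apply: measurable_funTS; apply: measurable_funeM; apply: emeasurable_funD => //.
    exact/measurable_EFinP.
  move=> x _; rewrite -EFinD -EFinM lee_fin ger0_norm ?mulr_ge0 ?fine_ge0//.
  by rewrite ler_wpM2l// le_1_pow// fine_ge0.
rewrite ge0_integralZl_EFin//; last 2 first.
- by move=> x _; rewrite -EFinD lee_fin addr_ge0// powR_ge0.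
- by apply: measurable_funTS; apply: emeasurable_funD => //; exact/measurable_EFinP.
rewrite ge0_integralD//; last 2 first.
- by move=> x _; rewrite lee_fin powR_ge0.
- by apply: measurable_funTS; exact/measurable_EFinP.
rewrite lte_mul_pinfty ?lee_fin// lte_add_pinfty//.
  rewrite (_ : (\int[mu]_(x in K) 1 = \int[mu]_(x in K) cst 1%E x)%E)// integral_cst// mul1e.
  exact: compact_finite_measure.
apply: le_lt_trans finf; under [leRHS]eq_integral => x _ do rewrite gee0_abs ?lee_fin ?powR_ge0//.
apply: ge0_subset_integral => //; first exact/measurable_EFinP.
by move=> x _; rewrite lee_fin powR_ge0.
Qed.

(** Absolute continuity of the integral of 1 + G0^p, which dominates G0; the
    intervals are disjoint, so the increments are bounded by the integral over
    their union. *)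
Lemma abs_continuous_primitive (C : R) (u : R -> R) : 0 < C ->
  (forall a b, a <= b ->
     (`|u b - u a|%:E <= \int[mu]_(x in `[a, b]) (C * fine (G0 x))%:E)%E) ->
  abs_continuous u.
Proof.
move=> C0 uG e e0; have eC : 0 < e / C / 2 by rewrite !divr_gt0.
have [d [d0 Hd]] := integral_normr_continuous fine_pow_integrable eC.
have := fine_pow_integrable; move=> /integrableP[/measurable_EFinP mf finf].
exists (Num.min d (e / C / 2)); first by rewrite lt_min d0.
move=> n a b ab dis; rewrite lt_min => /andP[Sd Se].
pose A i := `]a i, b i[%classic; pose s := index_enum 'I_n.
pose D := \big[setU/set0]_(i <- s) A i.
have mA i : measurable (A i) by exact: measurable_itv.
have mD : measurable D by exact: bigsetU_measurable.
have disA : trivIset [set` s] A by apply: sub_trivIset dis.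
have us : uniq s by exact: index_enum_uniq.
have mG : measurable_fun setT (fun x => (C * fine (G0 x))%:E).
  by apply/measurable_EFinP; apply: measurable_funM => //; exact: measurable_fine_fun.
have G_ge0 x : (0 <= (C * fine (G0 x))%:E)%E by rewrite lee_fin mulr_ge0 ?(ltW C0)// fine_ge0.
have cst1 B : measurable B -> (\int[mu]_(x in B) cst 1%E x = mu B)%E.
  by move=> mB; rewrite integral_cst// mul1e.
have muitv (x y : R) : x <= y -> mu `]x, y[ = (y - x)%:E.
  rewrite le_eqVlt => /predU1P[->|xy]; first by rewrite set_itvoo0 ?measure0 ?subrr.
  by rewrite lebesgue_measure_itv/= lte_fin xy EFinB.
have muD : mu D = (\sum_(i < n) (b i - a i))%:E.
  rewrite -(cst1 _ mD) ge0_integral_bigsetU//.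
  rewrite -sumEFin; apply: eq_bigr => i _.
  exact: etrans (cst1 _ (mA i)) (muitv _ _ (ab i)).
rewrite -lte_fin -sumEFin.
apply: (@le_lt_trans _ _ (\sum_(i < n) \int[mu]_(x in A i) (C * fine (G0 x))%:E)%E).
  apply: lee_sum => i _; apply: (le_trans (uG _ _ (ab i))).
  by rewrite integral_itv_bndoo//; exact: measurable_funTS.
rewrite -ge0_integral_bigsetU//; last exact: measurable_funTS.
apply: (@le_lt_trans _ _ (\int[mu]_(x in D) (C%:E * (1 + `|fine (G0 x) `^ p|%:E)))%E).
  apply: ge0_le_integral => //.
  - exact: measurable_funTS.
  - apply: measurable_funTS; apply: measurable_funeM; apply: emeasurable_funD => //.
    by apply/measurable_EFinP; exact: measurableT_comp.
  move=> x _; rewrite -EFinD -EFinM lee_fin ger0_norm ?powR_ge0//.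
  by rewrite ler_wpM2l ?(ltW C0)// le_1_pow// fine_ge0.
have mn : measurable_fun setT (fun x => `|fine (G0 x) `^ p|%:E).
  by apply/measurable_EFinP; exact: measurableT_comp.
rewrite ge0_integralZl_EFin ?(ltW C0)//; last 2 first.
- by move=> x _; rewrite -EFinD lee_fin addr_ge0.
- by apply: measurable_funTS; exact: emeasurable_funD.
rewrite ge0_integralD//; last by exact: measurable_funTS.
have -> : (\int[mu]_(x in D) 1 = (\sum_(i < n) (b i - a i))%:E)%E.
  exact: etrans (cst1 _ mD) muD.
have muDd : (mu D < d%:E)%E by rewrite muD lte_fin.
have := Hd D mD muDd.
rewrite /Rintegral; set I := (\int[mu]_(x in D) _)%E => HI.
have I0 : (0 <= I)%E by exact: integral_ge0.
have If : I \is a fin_num.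
  rewrite ge0_fin_numE//; apply: le_lt_trans finf.
  exact: ge0_subset_integral.
rewrite -(fineK If) -EFinD -EFinM lte_fin -ltr_pdivlMl// mulrC.
by rewrite [X in _ < X](splitr (e / C)) ltrD.
Qed.

End PowerIntegrable.

(** * Sobolev extensions and the trace theorem *)

Section Extension.
Context {R : realType}.
Local Notation mu := (@lebesgue_measure R).
Implicit Types (E : set R) (f F : R -> R) (S : {fset R}).

(** A limit along larger and larger finite sets. *)
Lemma fset_filter_ultra : exists2 F : set_system {fset R}, UltraFilter F &
  forall x : R, F [set S : {fset R} | x \in S].
Proof.
pose B S0 := [set S : {fset R} | (S0 `<=` S)%fset].
have FB : Filter (filter_from setT B).
  apply: filter_fromT_filter; first by exists fset0.
  move=> S1 S2; exists (S1 `|` S2)%fset => S /=.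
  by rewrite /B /= fsubUset => /andP[].
have PB : ProperFilter (filter_from setT B).
  by apply: filter_from_proper => S _; exists S; rewrite /B /=.
have [F [uF BF]] := ultraFilterLemma PB; exists F => // x; apply: BF.
by exists [fset x]%fset => // S /=; rewrite /B /= fsub1set.
Qed.

Lemma sharp_bound_fine m E f S x :
  let G0 := (\sum_(k < m.+1) sharp_maximal m E f k x)%E in
  [set` S] `<=` E -> G0 \is a fin_num -> sharp_bound m [set` S] f x (fine G0).
Proof.
move=> G0 SE fG0 k T km [TS Tk Tx].
rewrite -lee_fin fineK//; apply: (@le_trans _ _ (sharp_maximal m E f k x)).
  by apply: sharp_maximal_ub; split => //; exact: subset_trans SE.
have km' : (k < m.+1)%N by [].
rewrite /G0 (bigD1 (Ordinal km'))//= leeDl//.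
by apply: sume_ge0 => i _; exact: sharp_maximal_ge0.
Qed.

(** The extensions from the finite subsets of E have all their derivatives up to
    the order m dominated by one multiple of the sum of the sharp maximal
    functions; their limit along the finite subsets inherits the bounds. *)
Theorem sobolev_extension_sharp m (p : R) : (0 < m)%N -> 1 < p ->
  exists2 C : R, 0 < C & forall E f,
    (forall k, (k <= m)%N -> in_Lp p (sharp_maximal m E f k)) ->
    exists2 F, sobolev_extension m p E f F &
      (sobolev_norm m p F <=
       C%:E * \sum_(k < m.+1) 'N[mu]_p%:E[sharp_maximal m E f k])%E.
Proof.
move=> m0 p1; have [C0 C00 HC] := finite_extension R m0.
exists (m.+1%:R * (C0 * 4 ^+ m.+1)); first by rewrite !mulr_gt0// exprn_gt0.
move=> E f Hf; have aeF := ae_filter_ringOfSetsType mu.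
pose G0 x := (\sum_(k < m.+1) sharp_maximal m E f k x)%E.
have msh (k : 'I_m.+1) : measurable_fun setT (sharp_maximal m E f k).
  by apply: measurable_sharp_maximal => //; rewrite -ltnS.
have mG0 : measurable_fun setT G0 by exact: emeasurable_sum.
have G00 x : (0 <= G0 x)%E by apply: sume_ge0 => k _; exact: sharp_maximal_ge0.
set N := (\sum_(k < m.+1) 'N[mu]_p%:E[sharp_maximal m E f k])%E.
have NG0 : ('N[mu]_p%:E[G0] <= (4 ^+ m.+1)%:E * N)%E.
  (* A family indexed by all the naturals, measurable also beyond m. *)
  pose s k := if (k <= m)%N then sharp_maximal m E f k else cst 0%E.
  have sE (k : 'I_m.+1) : s k = sharp_maximal m E f k by rewrite /s -ltnS ltn_ord.
  have -> : G0 = (fun x => \sum_(k < m.+1) s k x)%E.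
    by apply/funext => x; apply: eq_bigr => k _; rewrite sE.
  have -> : N = (\sum_(k < m.+1) 'N[mu]_p%:E[s k])%E.
    by apply: eq_bigr => k _; rewrite sE.
  apply: Lnorm_sum_le => //.
  - by move=> k; rewrite /s; case: ifP => // km; exact: measurable_sharp_maximal.
  - by move=> k x; rewrite /s; case: ifP => // km; exact: sharp_maximal_ge0.
have N0 : (0 <= N)%E by apply: sume_ge0 => k _; exact: Lnorm_ge0.
have Nfin : (N < +oo)%E.
  by apply: lte_sum_pinfty => k _; case: (Hf k _) => //; rewrite -ltnS.
have G0fin : ('N[mu]_p%:E[G0] < +oo)%E.
  by apply: (le_lt_trans NG0); rewrite lte_mul_pinfty// lee_fin exprn_ge0.
pose G x := C0 * fine (G0 x).
have Gge0 x : 0 <= G x by rewrite mulr_ge0 ?(ltW C00)// fine_ge0.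
have lG : locally_integrable setT G by exact: (locally_integrable_fine p1 mG0 G00 G0fin (ltW C00)).
have [mG _ _] := lG.
have NG : ('N[mu]_p%:E[EFin \o G] <= (C0 * 4 ^+ m.+1)%:E * N)%E.
  have -> : EFin \o G = (fun x => C0%:E * (fine (G0 x))%:E)%E.
    by apply/funext => x; rewrite /= EFinM.
  rewrite Lnorm_scale ?(ltW C00)//; last by apply/measurable_EFinP; exact: measurable_fine_fun.
  rewrite EFinM -muleA lee_wpmul2l ?lee_fin ?(ltW C00)//; apply: le_trans NG0.
  apply: Lnorm_le_ae => //; first by apply/measurable_EFinP; exact: measurable_fine_fun.
  by apply: filterS (ae_fin_num p1 mG0 G00 G0fin) => x; move=> /fineK ->.
have NGfin : ('N[mu]_p%:E[EFin \o G] < +oo)%E.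
  apply: (le_lt_trans NG); rewrite lte_mul_pinfty// lee_fin.
  by rewrite mulr_ge0 ?exprn_ge0// ltW.
(* Indexing by all finite sets and intersecting with E avoids a subtype of
   finite subsets of E. *)
pose SE S := [fset x in S | `[< E x >]]%fset.
have SEE S : [set` SE S] `<=` E by move=> x /=; rewrite !inE => /andP[_ /asboolP].
have /choice[U HU] S := HC (SE S) f.
have [F uF HF] := fset_filter_ultra.
have GU : {ae mu, forall x, forall S k, (k <= m)%N -> `|U S k x| <= G x}.
  apply: filterS (ae_fin_num p1 mG0 G00 G0fin) => x fx S k km.
  have [_ _ HS] := HU S; apply: HS => //; first exact: fine_ge0.
  exact: sharp_bound_fine.
have jU S : jet (U S) by case: (HU S).
have [u [g [uU isu cu [lg pg] uG]]] := ultralimit_jets uF m0 jU lG Gge0 GU.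
have PF : ProperFilter F by exact: (@ultra_proper _ F uF).
have dn k : (k < m)%N -> derive1n k (u 0%N) = u k.
  elim: k => [//|k IH] km; rewrite derive1nS IH ?(ltnW km)//; apply/funext => x.
  by have [_ <-] := isu k x km; rewrite derive1E.
have m1 : (m.-1 < m)%N by rewrite prednK.
have acu : abs_continuous (u m.-1) by exact: (abs_continuous_primitive p1 mG0 G00 G0fin C00 uG).
have wu : is_weak_derivative (u m.-1) g.
  by apply: primitive_weak_derivative => //; exact: cu.
have prim_le v : locally_integrable setT v -> primitive (u m.-1) v ->
    {ae mu, forall x, `|v x| <= G x}.
  by move=> lv pv; exact: primitive_ae_le lv lG pv uG.
have Lp_le (v : R -> R) : measurable_fun setT v -> {ae mu, forall x, `|v x| <= G x} ->
    ('N[mu]_p%:E[EFin \o v] <= 'N[mu]_p%:E[EFin \o G])%E.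
  move=> mv vG; apply: Lnorm_le_ae => //; [exact/measurable_EFinP|exact/measurable_EFinP|].
  by apply: filterS vG => x vx /=; rewrite lee_fin (ger0_norm (Gge0 x)).
have in_Lp_le (v : R -> R) : measurable_fun setT v -> {ae mu, forall x, `|v x| <= G x} ->
    in_Lp p (EFin \o v).
  by move=> mv vG; split; [exact/measurable_EFinP|exact: le_lt_trans (Lp_le v mv vG) NGfin].
have homF : homogeneous_sobolev m p (u 0%N).
  split.
  - move=> k km x; have km' : (k.+1 < m)%N by rewrite -(prednK m0) ltnS.
    by rewrite dn ?(ltnW km')//; have [] := isu k x km'.
  - by rewrite dn.
  - exists g; first by rewrite dn.
    by case: (lg) => mg _ _; apply: in_Lp_le => //; exact: prim_le.
have [_ hC hL hP] := sobolev_chain m0 homF.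
have hm : sobolev_derive m (u 0%N) m.-1 = u m.-1 by rewrite /sobolev_derive m1 dn.
have hle k : (k <= m)%N -> measurable_fun setT (sobolev_derive m (u 0%N) k) /\
    {ae mu, forall x, `|sobolev_derive m (u 0%N) k x| <= G x}.
  rewrite leq_eqVlt => /predU1P[->|km].
    by split; [case: hL|apply: prim_le => //; rewrite -hm].
  split; first by apply: continuous_measurable_fun; exact: hC.
  rewrite /sobolev_derive km dn//; apply: filterS GU => x Ux.
  have c : `|U S k x| @[S --> F] --> `|u k x| by apply: cvg_norm; exact: uU.
  apply: (cvgr_to_le c); apply: nearW => S; apply: Ux; exact: ltnW.
exists (u 0%N).
  split; first by split => // k km; apply: in_Lp_le; case: (hle k km).
  move=> x Ex; have c := uU 0%N x m0.
  have c' : U S 0%N x @[S --> F] --> f x.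
    apply: cvg_near_cst; apply: filterS (HF x) => S xS.
    by have [_ US _] := HU S; apply: US; rewrite !inE xS; exact/asboolP.
  exact: cvg_unique c c'.
rewrite /sobolev_norm.
apply: (@le_trans _ _ (\sum_(k < m.+1) ((C0 * 4 ^+ m.+1)%:E * N))%E).
  apply: lee_sum => k _; apply: le_trans NG.
  have km : (k <= m)%N by rewrite -ltnS.
  by apply: Lp_le; case: (hle k km).
by rewrite sumr_const card_ord [in leRHS]EFinM -muleA -[leLHS]mule_natl.
Qed.

End Extension.

(** The two preceding theorems, with the infimum in the trace norm bounded by one
    extension in the first inequality, and the lower bound valid for every
    extension in the second. *)
Theorem theorem1p5 (R : realType) (m : nat) (p : R) :
  (0 < m)%N -> 1 < p ->
  exists2 C : R, 0 < C &
    forall (E : set R) (f : R -> R), closed E ->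
      (sobolev_trace m p E f <->
       forall k : nat, (k <= m)%N -> in_Lp p (sharp_maximal m E f k)) /\
      (sobolev_trace m p E f ->
       (sobolev_trace_norm m p E f <=
          C%:E * \sum_(k < m.+1)
                   'N[lebesgue_measure]_p%:E[sharp_maximal m E f k])%E /\
       (\sum_(k < m.+1) 'N[lebesgue_measure]_p%:E[sharp_maximal m E f k] <=
          C%:E * sobolev_trace_norm m p E f)%E).
Proof.
move=> m0 p1; have [C1 C10 H1] := sharp_maximal_sobolev m0 p1.
have [C2 C20 H2] := sobolev_extension_sharp m0 p1.
have C0 : 0 < C2 + m.+1%:R * C1 by rewrite addr_gt0// mulr_gt0.
exists (C2 + m.+1%:R * C1) => // E f _.
have normfin F : sobolev m p F -> (sobolev_norm m p F < +oo)%E.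
  by move=> [_ HF]; apply: lte_sum_pinfty => k _; case: (HF k _) => //; rewrite -ltnS.
have trace_Lp : sobolev_trace m p E f ->
    forall k, (k <= m)%N -> in_Lp p (sharp_maximal m E f k).
  move=> [F EF] k km; split; first exact: measurable_sharp_maximal.
  apply: (le_lt_trans (H1 _ _ _ EF _ km)); rewrite lte_mul_pinfty ?lee_fin ?(ltW C10)//.
  by apply: normfin; case: EF.
set N := (\sum_(k < m.+1) _)%E.
have N0 : (0 <= N)%E by apply: sume_ge0 => k _; exact: Lnorm_ge0.
split; first by split => // /H2[F EF _]; exists F.
move=> trE; split.
  have [F EF FN] := H2 _ _ (trace_Lp trE).
  apply: (@le_trans _ _ (sobolev_norm m p F)).
    by apply: ereal_inf_lbound; exists F.
  apply: (le_trans FN); rewrite lee_wpmul2r// lee_fin lerDl.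
  by rewrite mulr_ge0 ?(ltW C10).
rewrite -lee_pdivrMl//; apply: le_ereal_inf_tmp => _ [F EF <-].
have S0 : (0 <= sobolev_norm m p F)%E by apply: sume_ge0 => k _; exact: Lnorm_ge0.
rewrite lee_pdivrMl//; apply: (@le_trans _ _ ((m.+1%:R * C1)%:E * sobolev_norm m p F)%E).
  apply: (@le_trans _ _ (\sum_(k < m.+1) (C1%:E * sobolev_norm m p F))%E).
    by apply: lee_sum => k _; apply: H1 => //; rewrite -ltnS.
  by rewrite sumr_const card_ord [in leRHS]EFinM -muleA -[leLHS]mule_natl.
by rewrite lee_wpmul2r// lee_fin lerDr ltW.
Qed.
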